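(* Let $t\in\mathbb{C}^\times$. Let $w$ be a meromorphic function on $\mathbb{C}$ which is holomorphic on $\mathbb{R}$, satisfies $w(x+1)=w(x)$ and $w(x+\tau)=t\,w(x)$, and such that $x\mapsto w(x+\tfrac{\tau}{2})P(e^{2\pi i x})$ is holomorphic on a neighborhood of $\overline{V}$. Then the linear functional $T$ on $\mathcal{A}$ which vanishes on $\mathcal{A}_i$ for $i\ne 0$ and is given on $\mathcal{A}_0$ by \[ T(R(Z))=\int_0^1 w(x)R(e^{2\pi i x})\,dx,\qquad R\in\mathbb{C}[z,z^{-1}], \] is a $g_t$-twisted trace. Moreover, if all nonzero roots of $P$ lie in $U$, then every $g_t$-twisted trace on $\mathcal{A}$ is obtained in this way from a unique such function $w$.
   Context: Let $q\in\mathbb{C}$ with $0<|q|<1$. Let $P\in\mathbb{C}[z,z^{-1}]$ be a Laurent polynomial, $P=az^k+\dots+bz^l$ with $a,b\neq0$, $k\ge l$, and let $n=k-l>0$. The algebra $\mathcal{A}=\mathcal{A}_P$ is generated by $u,v,Z,Z^{-1}$ with relations $ZZ^{-1}=Z^{-1}Z=1$, $ZuZ^{-1}=q^2u$, $ZvZ^{-1}=q^{-2}v$, $uv=P(q^{-1}Z)$, $vu=P(qZ)$; $\mathcal{A}_i=\{a: ZaZ^{-1}=q^{2i}a\}$, so $\mathcal{A}=\bigoplus_i\mathcal{A}_i$ and $\mathcal{A}_0=\mathbb{C}[Z,Z^{-1}]$. For $t\in\mathbb{C}^\times$, $g_t$ is the automorphism $u\mapsto tu$, $v\mapsto t^{-1}v$,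 $Z\mapsto Z$, and a $g_t$-twisted trace is a linear $T\colon\mathcal{A}\to\mathbb{C}$ with $T(ab)=T(b\,g_t(a))$ for all $a,b$. Fix $\tau\in\mathbb{C}$ with $q=e^{\pi i\tau}$ (so $\operatorname{Im}\tau>0$). Let $U=\{z\in\mathbb{C}: |q|<|z|<|q|^{-1}\}$ and $V=\{x\in\mathbb{C}: |\operatorname{Im}x|<\tfrac12\operatorname{Im}\tau\}$ (so $x\in V$ iff $e^{2\pi i x}\in U$), with closure $\overline{V}$. *)

(* Defs.v *)
From HB Require Import structures.
From mathcomp Require Import all_boot all_order all_algebra.
From mathcomp Require Import complex.
From mathcomp Require Import all_classical all_reals all_analysis.
Set Implicit Arguments. Unset Strict Implicit. Unset Printing Implicit Defensive.
Import Order.TTheory GRing.Theory Num.Theory.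
Local Open Scope ring_scope.
Local Open Scope complex_scope.

Section Defs.
Variable R : realType.
Local Notation C := R[i].

Definition expC (z : C) : C :=
  (expR (complex.Re z))%:C * ((cos (complex.Im z))%:C + 'i%C * (sin (complex.Im z))%:C).

Definition cdiff_at (f : C -> C) (z : C) : Prop :=
  exists l : C, forall eps : C, 0 < eps -> exists2 d : C, 0 < d &
    forall h : C, 0 < `|h| < d -> `|(f (z + h) - f z) / h - l| < eps.

Definition holo_on (O : C -> Prop) (f : C -> C) : Prop :=
  forall z, O z -> cdiff_at f z.

Definition copen (O : C -> Prop) : Prop :=
  forall z, O z -> exists2 r : C, 0 < r & forall y, `|y - z| < r -> O y.

Definition cdiscrete (S : C -> Prop) : Prop :=
  forall z, exists2 r : C, 0 < r & forall s, S s -> `|s - z| < r -> s = z.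

(* A meromorphic function on C, represented by a total function whose values
   at the (discrete) pole set are irrelevant. *)
Definition meromorphic (w : C -> C) : Prop :=
  exists S : C -> Prop, [/\ cdiscrete S,
    (forall z, ~ S z -> cdiff_at w z) &
    (forall s, S s -> exists (k : nat) (g : C -> C), exists2 r : C, 0 < r &
        (forall z, `|z - s| < r -> cdiff_at g z) /\
        (forall z, `|z - s| < r -> z != s -> g z = (z - s) ^+ k * w z))].

Definition mero_eq (w1 w2 : C -> C) : Prop :=
  exists S : C -> Prop, cdiscrete S /\ (forall z, ~ S z -> w1 z = w2 z).

Definition leval (l : int) (p : {poly C}) (z : C) : C := z ^ l * p.[z].

Definition cint01 (f : R -> C) : C :=
  (Rintegral lebesgue_measure `[0, 1]%classic (fun x => complex.Re (f x)))%:C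
  + 'i%C * (Rintegral lebesgue_measure `[0, 1]%classic (fun x => complex.Im (f x)))%:C.

Section Alg.
Variable A : algType C.

Definition zpow (X Xi : A) (l : int) : A :=
  match l with Posz n => X ^+ n | Negz n => Xi ^+ n.+1 end.

Definition aeval (X Xi : A) (l : int) (p : {poly C}) : A :=
  zpow X Xi l * \sum_(i < size p) p`_i *: X ^+ i.

Definition is_alg_hom (B : algType C) (f : A -> B) : Prop :=
  [/\ forall (c : C) x y, f (c *: x + y) = c *: f x + f y,
      forall x y, f (x * y) = f x * f y & f 1 = 1].

Definition is_lin (T : A -> C) : Prop :=
  forall (c : C) x y, T (c *: x + y) = c * T x + T y.

Definition graded (Z Zi : A) (q : C) (i : int) (a : A) : Prop :=
  Z * a * Zi = q ^ (2 * i) *: a.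

Definition gt_aut (u v Z Zi : A) (t : C) (g : A -> A) : Prop :=
  [/\ is_alg_hom g, g u = t *: u, g v = t^-1 *: v, g Z = Z & g Zi = Zi].

Definition twisted_trace (u v Z Zi : A) (t : C) (T : A -> C) : Prop :=
  is_lin T /\ forall g, gt_aut u v Z Zi t g -> forall a b, T (a * b) = T (b * g a).

Definition trace_of_w (Z Zi : A) (q : C) (w : C -> C) (T : A -> C) : Prop :=
  (forall i : int, i != 0 -> forall a, graded Z Zi q i a -> T a = 0) /\
  (forall (m : int) (r : {poly C}),
     T (aeval Z Zi m r) =
     cint01 (fun x => w x%:C * leval m r (expC (2%:C * pi%:C * 'i%C * x%:C)))).
End Alg.

Definition gwa_rel (B : algType C) (u v Z Zi : B) (q : C) (l : int) (p : {poly C}) :=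
  [/\ Z * Zi = 1 /\ Zi * Z = 1, Z * u * Zi = q ^+ 2 *: u, Z * v * Zi = q ^- 2 *: v,
      u * v = aeval (q^-1 *: Z) (q *: Zi) l p &
      v * u = aeval (q *: Z) (q^-1 *: Zi) l p].

(* (A, u, v, Z, Zi) is the algebra presented by generators and relations,
   characterized by its universal property *)
Definition is_presented (A : algType C) (u v Z Zi : A) (q : C) (l : int) (p : {poly C}) :=
  gwa_rel u v Z Zi q l p /\
  forall (B : algType C) (u' v' Z' Zi' : B), gwa_rel u' v' Z' Zi' q l p ->
    exists f : A -> B, [/\ is_alg_hom f, f u = u' /\ f v = v', f Z = Z', f Zi = Zi' &
      forall g : A -> B, is_alg_hom g -> g u = u' -> g v = v' -> g Z = Z' -> g Zi = Zi' ->
        forall a, g a = f a].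

Definition admissible (tau t : C) (l : int) (p : {poly C}) (w : C -> C) : Prop :=
  [/\ meromorphic w,
      (forall x : R, cdiff_at w x%:C),
      mero_eq (fun z => w (z + 1)) w,
      mero_eq (fun z => w (z + tau)) (fun z => t * w z) &
      exists O : C -> Prop, [/\ copen O,
        (forall z : C, `|(complex.Im z)%:C| <= (complex.Im tau / 2)%:C -> O z) &
        exists h : C -> C, holo_on O h /\
          exists S, cdiscrete S /\ forall z, O z -> ~ S z ->
            h z = w (z + tau / 2%:C) * leval l p (expC (2%:C * pi%:C * 'i%C * z))]].
End Defs.

(* Main.v *)
Require Import Defs.
From HB Require Import structures.
From mathcomp Require Import all_boot all_order all_algebra.
From mathcomp Require Import complex.
From mathcomp Require Import all_classical all_reals all_analysis.
From mathcomp Require Import ring lra zify.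
Set Implicit Arguments. Unset Strict Implicit. Unset Printing Implicit Defensive.
Import Order.TTheory GRing.Theory Num.Theory.
Import numFieldNormedType.Exports.
Local Open Scope ring_scope.
Local Open Scope complex_scope.

(* Write e(x) = exp(2 pi i x). Since T(Z a) = T(a Z), a g_t-twisted trace T vanishes off degree 0,
   and it is determined by c_m = T(Z^m). The only remaining condition is
   T(u v Z^m) = t q^(2m) T(v u Z^m), a linear recurrence on c. If c_m is the integral of w(x) e(mx),
   then T(u v Z^m) and T(v u Z^m) are, up to explicit factors, the integrals of h(z) e(mz),
   h(z) = w(z + tau/2) P(e(z)), over the lower and upper edges of the strip; the recurrence is thus
   Cauchy's theorem for h on a period parallelogram. The same deformation shows that c determines
   the Fourier coefficients of h on every horizontal line of the strip, hence h, hence w.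

   Conversely, as m tends to +oo or to -oo the recurrence is an exponentially small perturbation of
   a constant coefficient one, with characteristic polynomial P(z/q) or P(qz). When all roots r of P
   satisfy |q| < |r| < 1/|q|, this makes c decay exponentially in both directions. So
   W(x) = sum c_m e(-mx) converges near the real line, and, by the recurrence, the Laurent series h
   with h(x - tau/2) = W(x) P(e(x)/q) converges near the closed strip and satisfies
   h(x + tau/2) = t W(x) P(q e(x)). Hence h(x - tau/2) / P(e(x)/q), taken on 0 <= Im x < Im tau and
   extended quasi-periodically, is the required weight. *)

(** * Complex differentiability *)

Section PointwiseCalculus.
Variable K : numFieldType.
Implicit Types (f g : K -> K) (z : K) (P Q : K -> Prop).

(** The algebra is known only through its universal property, and a meromorphic function only off a
    discrete set; both facts shape the proof. That the integral formula defines a functional at all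
    requires the powers of [Z] to be independent. This comes from a representation on two-sided
    sequences in which [Z] has the eigenvalues [q^(2j)]; they are pairwise distinct because |q| < 1,
    so they separate Laurent polynomials. Identities between meromorphic functions are carried on
    punctured neighbourhoods and become equalities only where both sides are continuous. Holomorphy
    of w on the real line makes this possible on the two edges of the strip, where h is compared
    with w. The condition on the roots acts three times: |r| < 1/|q| gives decay of c toward +oo,
    |q| < |r| gives decay toward -oo, and together they keep P(e(x)/q) and P(q e(x)) free of zeros
    on the real line. The last point matters because the constructed weight is defined band by band,
    with seams at the lines where Im x is a multiple of Im tau: near the seam on the real line both
    pieces are seen to coincide with the series W, so the weight is holomorphic there. *)

Definition near_at z P := exists2 r : K, 0 < r & forall y, `|y - z| < r -> P y.
(** Values at poles are arbitrary, so relations between meromorphic functions are stated off the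
    point; [cont_at_eq] recovers equality where both sides are continuous. *)
Definition pnear_at z P := near_at z (fun y => y != z -> P y).
Definition cont_at f z := forall e : K, 0 < e -> near_at z (fun y => `|f y - f z| < e).
(** At [K := R[i]] this unfolds to [cdiff_at], with which it is used interchangeably. *)
Definition diff_at f z := exists l : K, forall eps : K, 0 < eps -> exists2 d : K, 0 < d &
    forall h : K, 0 < `|h| < d -> `|(f (z + h) - f z) / h - l| < eps.

Lemma near_atE z P : near_at z P <-> \forall y \near z, P y.
Proof.
split=> [[r r0 h]|/nbhs_ballP[r /= r0 h]].
  apply/nbhs_ballP; exists r => //= y; rewrite /ball /= distrC; exact: h.
by exists r => // y yz; apply: h; rewrite /ball /= distrC.
Qed.

Lemma cont_atE f z : cont_at f z <-> {for z, continuous f}.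
Proof.
rewrite /prop_for /continuous_at; split=> [h|h e e0].
  apply/(@cvgrPdist_lt _ _ _ (nbhs z)) => e e0; apply: (near_atE _ _).1; have [r r0 hr] := h e e0.
  by exists r => // y /hr; rewrite distrC.
apply: (near_atE _ _).2; move/(@cvgrPdist_lt _ _ _ (nbhs z)) : h => /(_ e e0) h.
by near=> y; rewrite distrC; near: y; exact: h.
Unshelve. all: by end_near. Qed.

Lemma near_at_imp z P Q : (forall y, P y -> Q y) -> near_at z P -> near_at z Q.
Proof. by move=> h [r r0 H]; exists r => // y /H /h. Qed.

Lemma near_atI z P Q : near_at z P -> near_at z Q -> near_at z (fun y => P y /\ Q y).
Proof.
move=> /near_atE h1 /near_atE h2; apply/near_atE.
by near=> y; split; near: y; [exact: h1|exact: h2].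
Unshelve. all: by end_near. Qed.

Lemma near_at_here z P : near_at z P -> P z.
Proof. by move=> [r r0]; apply; rewrite subrr normr0. Qed.

Lemma near_at_near z P : near_at z P -> near_at z (fun y => near_at y P).
Proof.
move=> [r r0 h]; exists r => // y yz; exists (r - `|y - z|); first by rewrite subr_gt0.
move=> x xy; apply: h; rewrite -(subrK y x) -addrA (le_lt_trans (ler_normD _ _))//.
by rewrite -ltrBrDr.
Qed.

Lemma near_atT z P : (forall y, P y) -> near_at z P.
Proof. by exists 1 => //. Qed.

Lemma near_at_shift z c P : near_at (z + c) P -> near_at z (fun y => P (y + c)).
Proof. by move=> [r r0 h]; exists r => // y yz; apply: h; rewrite opprD addrACA subrr addr0. Qed.

Lemma near_at_pnear z P : near_at z P -> pnear_at z P.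
Proof. by apply: near_at_imp => y Py _. Qed.

Lemma pnear_at_imp z P Q : (forall y, P y -> Q y) -> pnear_at z P -> pnear_at z Q.
Proof. by move=> h; apply: near_at_imp => y Py /Py /h. Qed.

Lemma pnear_atI z P Q : pnear_at z P -> pnear_at z Q -> pnear_at z (fun y => P y /\ Q y).
Proof. by move=> /near_atI h/h; apply: near_at_imp => y [Py Qy] yz; split; auto. Qed.

Lemma pnear_at_shift z c P : pnear_at (z + c) P -> pnear_at z (fun y => P (y + c)).
Proof.
move=> /near_at_shift; apply: near_at_imp => y h yz; apply: h.
by apply: contra yz => /eqP/addIr ->.
Qed.

Lemma pnear_at_ex z P : pnear_at z P -> exists2 y, y != z & P y.
Proof.
move=> [r r0 h]; exists (z + r / 2); last (apply: h).
- by rewrite -subr_eq0 addrAC subrr add0r mulf_neq0// ?gt_eqF// invr_gt0.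
- by rewrite addrAC subrr add0r gtr0_norm ?divr_gt0// ltr_pdivrMr// ltr_pMr// ltr1n.
- by rewrite -subr_eq0 addrAC subrr add0r mulf_neq0// ?gt_eqF// invr_gt0.
Qed.

Lemma cont_at_cst c z : cont_at (fun=> c) z.
Proof. by move=> e e0; exists 1 => // y _; rewrite subrr normr0. Qed.

Lemma cont_at_id z : cont_at id z.
Proof. by move=> e e0; exists e. Qed.

Lemma cont_atD f g z : cont_at f z -> cont_at g z -> cont_at (fun y => f y + g y) z.
Proof. by move=> /cont_atE hf /cont_atE hg; apply/cont_atE; exact: continuousD. Qed.

Lemma cont_atN f z : cont_at f z -> cont_at (fun y => - f y) z.
Proof. by move=> /cont_atE hf; apply/cont_atE; exact: continuousN. Qed.

Lemma cont_atM f g z : cont_at f z -> cont_at g z -> cont_at (fun y => f y * g y) z.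
Proof. by move=> /cont_atE hf /cont_atE hg; apply/cont_atE; exact: continuousM. Qed.

Lemma cont_atV f z : f z != 0 -> cont_at f z -> cont_at (fun y => (f y)^-1) z.
Proof. by move=> fz /cont_atE hf; apply/cont_atE; exact: continuousV. Qed.

Lemma cont_at_comp f g z : cont_at f z -> cont_at g (f z) -> cont_at (fun y => g (f y)) z.
Proof.
move=> hf hg e e0; have [d d0 hd] := hg e e0; have [r r0 hr] := hf d d0.
by exists r => // y /hr /hd.
Qed.

Lemma cont_at_neq0 f z : cont_at f z -> f z != 0 -> near_at z (fun y => f y != 0).
Proof.
move=> hf fz; have [|r r0 h] := hf `|f z|; first by rewrite normr_gt0.
exists r => // y /h; apply: contraTneq => ->.
by rewrite sub0r normrN ltxx.
Qed.

Lemma cont_at_near f g z : near_at z (fun y => f y = g y) -> cont_at f z -> cont_at g z.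
Proof.
move=> fg hf e e0; have := near_atI fg (hf e e0).
by apply: near_at_imp => y [<-]; rewrite (near_at_here fg).
Qed.

(** If the values differed, the difference would stay nonzero near [z], against the agreement at
    some point [y != z]. *)
Lemma cont_at_eq f g z : cont_at f z -> cont_at g z ->
  pnear_at z (fun y => f y = g y) -> f z = g z.
Proof.
move=> hf hg fg; apply/eqP; rewrite -subr_eq0; apply/negPn/negP => fgz.
have /cont_at_neq0 : cont_at (fun y => f y - g y) z.
  apply: cont_atD => //; have := cont_atM (cont_at_cst (-1) z) hg.
  by apply: cont_at_near; apply: near_atT => y; rewrite mulN1r.
move=> /(_ fgz) /near_at_pnear /(pnear_atI fg)/pnear_at_ex[y _ [->]].
by rewrite subrr eqxx.
Qed.

(* Caratheodory's form of differentiability, from which the rules of calculus are read off. *)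
Lemma diff_atP f z :
  diff_at f z <-> exists2 phi, cont_at phi z & forall y, f y = f z + phi y * (y - z).
Proof.
split=> [[l hl]|[phi hphi hf]].
  exists (fun y => if y == z then l else (f y - f z) / (y - z)).
    move=> e e0; have [d d0 hd] := hl e e0; exists d => // y yz.
    rewrite eqxx; case: eqVneq => [_|nyz]; first by rewrite subrr normr0.
    have := hd (y - z); rewrite normr_gt0 subr_eq0 nyz yz [z + _]addrC subrK; exact.
  move=> y; case: eqVneq => [->|nyz]; first by rewrite subrr mulr0 addr0.
  by rewrite divfK ?subr_eq0// addrC subrK.
exists (phi z) => e e0; have [d d0 hd] := hphi e e0; exists d => // h /andP[h0 hd'].
rewrite hf addrAC subrr add0r addrAC subrr add0r mulfK -?normr_gt0//.
by apply: hd; rewrite addrAC subrr add0r.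
Qed.

Lemma diff_at_cst c z : diff_at (fun=> c) z.
Proof.
by apply/diff_atP; exists (fun=> 0) => [|y]; [exact: cont_at_cst|rewrite mul0r addr0].
Qed.

Lemma diff_at_id z : diff_at id z.
Proof.
by apply/diff_atP; exists (fun=> 1) => [|y]; [exact: cont_at_cst|rewrite mul1r addrC subrK].
Qed.

Lemma diff_at_cont f z : diff_at f z -> cont_at f z.
Proof.
move=> /diff_atP[phi hphi hf].
suff : cont_at (fun y => f z + phi y * (y - z)) z.
  by apply: cont_at_near; apply: near_atT => y; rewrite -hf.
apply: cont_atD; first exact: cont_at_cst.
by apply: cont_atM => //; apply: cont_atD; [exact: cont_at_id|exact: cont_at_cst].
Qed.

Lemma diff_atD f g z : diff_at f z -> diff_at g z -> diff_at (fun y => f y + g y) z.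
Proof.
move=> /diff_atP[p hp hf] /diff_atP[s hs hg]; apply/diff_atP.
exists (fun y => p y + s y); first exact: cont_atD.
by move=> y; rewrite hf hg mulrDl addrACA.
Qed.

Lemma diff_atM f g z : diff_at f z -> diff_at g z -> diff_at (fun y => f y * g y) z.
Proof.
move=> df dg; have cg := diff_at_cont dg.
move: df dg => /diff_atP[p hp hf] /diff_atP[s hs hg]; apply/diff_atP.
exists (fun y => p y * g y + f z * s y).
  by apply: cont_atD; apply: cont_atM => //; exact: cont_at_cst.
by move=> y; rewrite [in LHS]hf mulrDl mulrDl {1}[in LHS]hg mulrDr; ring.
Qed.

Lemma diff_atV f z : f z != 0 -> diff_at f z -> diff_at (fun y => (f y)^-1) z.
Proof.
move=> fz df; have cf := diff_at_cont df.
have [phi hphi hf] := (diff_atP f z).1 df.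
have /near_at_here _ := cont_at_neq0 cf fz.
have [r r0 hr] := cont_at_neq0 cf fz.
apply/diff_atP.
(* Where [f y = 0] the inverse is [0] by convention, so the slope there has to be the plain
   difference quotient. Such [y] stay away from [z] and do not affect continuity at [z]. *)
exists (fun y => if f y == 0 then (- (f z)^-1) / (y - z) else - phi y * (f y)^-1 * (f z)^-1).
  suff : cont_at (fun y => - phi y * (f y)^-1 * (f z)^-1) z.
    by apply: cont_at_near; exists r => // y /hr/negbTE ->.
  apply: cont_atM; last exact: cont_at_cst.
  apply: cont_atM; last exact: cont_atV.
  have := cont_atM (cont_at_cst (-1) z) hphi.
  by apply: cont_at_near; apply: near_atT => y; rewrite mulN1r.
move=> y; case: eqVneq => [fy|fy].
  rewrite fy invr0 divfK ?subrr// subr_eq0; apply: contra_neq fz => <-.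
  by rewrite fy.
have e : phi y * (y - z) = f y - f z by rewrite [in RHS]hf addrAC subrr add0r.
transitivity ((f z)^-1 - phi y * (y - z) * (f y)^-1 * (f z)^-1); last by ring.
by rewrite e; field; rewrite fz fy.
Qed.

Lemma diff_at_comp f g z : diff_at f z -> diff_at g (f z) -> diff_at (fun y => g (f y)) z.
Proof.
move=> df; have cf := diff_at_cont df.
move: df => /diff_atP[p hp hf] /diff_atP[s hs hg]; apply/diff_atP.
exists (fun y => s (f y) * p y).
  by apply: cont_atM => //; exact: cont_at_comp.
move=> y; rewrite hg [in s _ * _](_ : f y - f z = p y * (y - z)) ?mulrA//.
by rewrite [in LHS]hf addrAC subrr add0r.
Qed.

Lemma diff_at_near f g z : near_at z (fun y => f y = g y) -> diff_at f z -> diff_at g z.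
Proof.
move=> fg /diff_atP[p hp hf]; apply/diff_atP.
have fgz := near_at_here fg.
exists (fun y => if f y == g y then p y else (g y - g z) / (y - z)).
  move: hp; apply: cont_at_near; move: fg; apply: near_at_imp => y ->.
  by rewrite eqxx.
move=> y; case: eqP => [<-|ne]; first by rewrite -fgz.
rewrite divfK; first by rewrite addrC subrK.
by rewrite subr_eq0; apply: contra_not_neq ne => ->.
Qed.

Lemma diff_atX f n z : diff_at f z -> diff_at (fun y => f y ^+ n) z.
Proof.
move=> df; elim: n => [|n ih].
  apply: diff_at_near (diff_at_cst 1 z); apply: near_atT => y; by rewrite expr0.
apply: diff_at_near (diff_atM df ih); apply: near_atT => y; by rewrite exprS.
Qed.

Lemma diff_at_sum I (s : seq I) (F : I -> K -> K) z :
  (forall i, diff_at (F i) z) -> diff_at (fun y => \sum_(i <- s) F i y) z.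
Proof.
move=> dF; elim: s => [|i s ih].
  apply: diff_at_near (diff_at_cst 0 z); apply: near_atT => y; by rewrite big_nil.
apply: diff_at_near (diff_atD (dF i) ih); apply: near_atT => y; by rewrite big_cons.
Qed.

Lemma diff_at_exprz f (n : int) z : f z != 0 -> diff_at f z -> diff_at (fun y => f y ^ n) z.
Proof.
move=> fz df; case: n => n; first exact: (diff_atX n df).
by apply: diff_atV; rewrite ?expf_neq0//; exact: (diff_atX n.+1 df).
Qed.

Lemma diff_at_horner f (p : {poly K}) z : diff_at f z -> diff_at (fun y => p.[f y]) z.
Proof.
move=> df; have := @diff_at_sum _ (index_enum 'I_(size p)) (fun i y => p`_i * f y ^+ i) z.
move=> /(_ (fun i => diff_atM (diff_at_cst _ _) (diff_atX i df))).
apply: diff_at_near; apply: near_atT => y; by rewrite horner_coef.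
Qed.

(* At [z] the quotient is [0 / 0 = 0], which happens to be its limit. *)
Lemma diff_at_sqr_div f phi z : cont_at phi z -> phi z != 0 -> 
  (forall y, f y = phi y * (y - z)) -> diff_at (fun y => (y - z) ^+ 2 / f y) z.
Proof.
move=> cphi phiz hf; apply/diff_atP; exists (fun y => (phi y)^-1); first exact: cont_atV.
move=> y; rewrite subrr expr0n mul0r add0r hf; case: (eqVneq y z) => [->|yz].
  by rewrite subrr expr0n mul0r mulr0.
by rewrite invfM; set i := (phi y)^-1; field; rewrite subr_eq0.
Qed.

Lemma simple_zero_pnear f phi z : cont_at phi z -> phi z != 0 -> 
  (forall y, f y = phi y * (y - z)) -> pnear_at z (fun y => f y != 0).
Proof.
move=> cphi phiz hf; have := cont_at_neq0 cphi phiz; apply: near_at_imp => y py yz.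
by rewrite hf mulf_neq0// subr_eq0.
Qed.

End PointwiseCalculus.

(** * The complex exponential *)

Section ComplexNumbers.
Variable R : realType.
Local Notation C := R[i].
Implicit Types (f g : C -> C) (z : C) (P Q : C -> Prop).

(** The norm [|z|] of [R[i]] is itself a complex number; estimates are carried out in the ordered
    field [R]. *)
Definition nrm z : R := ComplexField.Normc.normc z.

Lemma nrmE z : `|z| = (nrm z)%:C. Proof. by []. Qed.

Lemma nrm_ge0 z : 0 <= nrm z. Proof. by rewrite -lecR -nrmE normr_ge0. Qed.
Lemma nrm0 : nrm 0 = 0. Proof. by apply: complexI; rewrite -nrmE normr0. Qed.
Lemma nrm1 : nrm 1 = 1. Proof. by apply: complexI; rewrite -nrmE normr1. Qed.
Lemma nrmN z : nrm (- z) = nrm z. Proof. by apply: complexI; rewrite -!nrmE normrN. Qed.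
Lemma nrmB z y : nrm (z - y) = nrm (y - z). Proof. by rewrite -nrmN opprB. Qed.
Lemma nrmM z y : nrm (z * y) = nrm z * nrm y.
Proof. by apply: complexI; rewrite rmorphM/= -!nrmE normrM. Qed.
Lemma nrmV z : nrm z^-1 = (nrm z)^-1.
Proof. by apply: complexI; rewrite fmorphV/= -!nrmE normfV. Qed.
Lemma nrmX z n : nrm (z ^+ n) = nrm z ^+ n.
Proof. by apply: complexI; rewrite rmorphXn/= -!nrmE normrX. Qed.
Lemma nrmD z y : nrm (z + y) <= nrm z + nrm y.
Proof. by rewrite -lecR rmorphD/= -!nrmE ler_normD. Qed.
Lemma nrm_sum I (s : seq I) (Q : pred I) (F : I -> C) :
  nrm (\sum_(i <- s | Q i) F i) <= \sum_(i <- s | Q i) nrm (F i).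
Proof.
elim/big_rec2 : _ => [|i x y _ h]; first by rewrite nrm0.
by rewrite (le_trans (nrmD _ _))// lerD2l.
Qed.
Lemma nrm_eq0 z : (nrm z == 0) = (z == 0).
Proof. by rewrite -(inj_eq (@complexI R)) -nrmE normr_eq0. Qed.
Lemma nrm_gt0 z : (0 < nrm z) = (z != 0).
Proof. by rewrite -ltcR -nrmE normr_gt0. Qed.
Lemma nrm_real (x : R) : nrm x%:C = `|x|.
Proof. by rewrite /nrm /= expr0n addr0 sqrtr_sqr. Qed.
Lemma nrm_dist z y : `|nrm z - nrm y| <= nrm (z - y).
Proof.
rewrite ler_norml; apply/andP; split.
  by rewrite lerNl opprB lerBlDr nrmB (le_trans _ (nrmD _ _))// subrK.
by rewrite lerBlDr (le_trans _ (nrmD _ _))// subrK.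
Qed.

Lemma norm_Re_le z : `|complex.Re z| <= nrm z.
Proof. by case: z => a b; rewrite /nrm /= -sqrtr_sqr ler_wsqrtr// lerDl sqr_ge0. Qed.
Lemma norm_Im_le z : `|complex.Im z| <= nrm z.
Proof. by case: z => a b; rewrite /nrm /= -sqrtr_sqr ler_wsqrtr// lerDr sqr_ge0. Qed.
Lemma nrm_le_ReIm z : nrm z <= `|complex.Re z| + `|complex.Im z|.
Proof.
rewrite [in leLHS](complexE z) (le_trans (nrmD _ _))// nrmM nrm_real nrm_real.
by rewrite /nrm /= expr0n expr1n add0r sqrtr1 mul1r.
Qed.

(** In the partial order of [R[i]], comparability with [0] forces a zero imaginary part; this turns
    complex radii and tolerances into real ones. *)
Lemma posC (e : C) : 0 < e -> 0 < complex.Re e /\ e = (complex.Re e)%:C.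
Proof. by case: e => a b; rewrite ltcE /= => /andP[/eqP -> ?]. Qed.

Lemma near_atR z P : near_at z P <-> exists2 r : R, 0 < r & forall y, nrm (y - z) < r -> P y.
Proof.
split=> [[r /posC[r0 ->] h]|[r r0 h]].
  by exists (complex.Re r) => // y yz; apply: h; rewrite nrmE ltcR.
by exists r%:C; rewrite ?ltcR// => y; rewrite nrmE ltcR; exact: h.
Qed.

Lemma cont_atR f z : cont_at f z <->
  forall e : R, 0 < e -> exists2 r : R, 0 < r & forall y, nrm (y - z) < r -> nrm (f y - f z) < e.
Proof.
split=> [h e e0|h e /posC[e0 ->]].
  have eC : 0 < e%:C :> C by rewrite ltcR.
  have [r r0 hr] := (near_atR _ _).1 (h _ eC).
  by exists r => // y /hr; rewrite nrmE ltcR.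
apply/near_atR; have [r r0 hr] := h _ e0; exists r => // y /hr.
by rewrite nrmE ltcR.
Qed.

(** First-order expansion in the form used by Goursat's argument. *)
Lemma cdiff_at_approx f z : cdiff_at f z -> exists l : C, forall e : R, 0 < e ->
  exists2 d : R, 0 < d & forall y, nrm (y - z) < d -> nrm (f y - f z - l * (y - z)) <= e * nrm (y - z).
Proof.
move=> /diff_atP[phi /cont_atR cphi hf]; exists (phi z) => e /cphi[d d0 hd].
exists d => // y /hd/ltW h.
have -> : f y - f z - phi z * (y - z) = (phi y - phi z) * (y - z) by rewrite hf; ring.
rewrite nrmM.
by rewrite ler_wpM2r// nrm_ge0.
Qed.

Lemma cdiscreteE (S : C -> Prop) : cdiscrete S <-> forall z, pnear_at z (fun y => ~ S y).
Proof.
split=> h z; have [r r0 hr] := h z; exists r => // s.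
  by move=> sz sz1 Ss; move: sz1; rewrite (hr s)// eqxx.
by move=> Ss sz; apply/eqP/negPn/negP => /(hr _ sz).
Qed.

(** The exceptional set can be taken to be the set where the two functions differ, so [mero_eq] is a
    local condition. *)
Lemma mero_eqE (w1 w2 : C -> C) :
  mero_eq w1 w2 <-> forall z, pnear_at z (fun y => w1 y = w2 y).
Proof.
split=> [[S [/cdiscreteE dS h]] z|h].
  by apply: pnear_at_imp (dS z) => y /h.
exists (fun y => w1 y <> w2 y); split; last by move=> z; apply: contra_notP.
by apply/cdiscreteE => z; apply: pnear_at_imp (h z) => y ->.
Qed.

Lemma mero_eq_all (w1 w2 : C -> C) : (forall z, w1 z = w2 z) -> mero_eq w1 w2.
Proof. by move=> h; apply/mero_eqE => z; apply: near_at_pnear; exact: near_atT. Qed.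

End ComplexNumbers.

(** * Exponential estimates and the function [e(x)] *)

Section ComplexExponential.
Variable R : realType.
Local Notation C := R[i].

Lemma expCD (z y : C) : expC (z + y) = expC z * expC y.
Proof.
rewrite /expC; case: z => a b; case: y => c d /=; rewrite expRD cosD sinD.
apply/eqP; rewrite eq_complex /=; apply/andP; split; apply/eqP; ring.
Qed.

Lemma expC0 : expC (0 : C) = 1.
Proof. by rewrite /expC /= expR0 cos0 sin0 mulr0 addr0 mulr1. Qed.

Lemma nrm_expC (z : C) : nrm (expC z) = expR (complex.Re z).
Proof.
rewrite /expC nrmM nrm_real ger0_norm ?expR_ge0//.
rewrite (_ : nrm _ = 1) ?mulr1//; rewrite /nrm /= !(mul0r,mul1r,addr0,add0r,subr0,oppr0).
by rewrite cos2Dsin2 sqrtr1.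
Qed.

Lemma expC_neq0 (z : C) : expC z != 0.
Proof. by rewrite -nrm_gt0 nrm_expC expR_gt0. Qed.

(** Only [1 + x <= exp x] goes in, at [a] and at [- a]: since [exp a * exp (- a) = 1], the second
    instance gives the upper bound [exp a * (1 - a) <= 1]. *)
Lemma expR_quad (a : R) : `|a| <= 2^-1 -> `|expR a - 1 - a| <= 2 * a ^+ 2.
Proof.
rewrite ler_norml => /andP[a1 a2].
have h1 := expR_ge1Dx a; have h2 := expR_ge1Dx (- a).
rewrite ger0_norm; last by lra.
have h3 : expR a * expR (- a) = 1 by rewrite -expRD subrr expR0.
have := expR_gt0 a; set x := expR a in h1 h3 *; set y := expR (- a) in h2 h3 *.
move=> x0; have : x * (1 - a) <= 1 by rewrite -[leRHS]h3 ler_pM2l.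
move=> h; suff : (x - 1 - a) * (1 - a) <= 2 * a ^+ 2 * (1 - a).
  by rewrite ler_pM2r//; lra.
have : 0 <= a ^+ 2 * (1 - 2 * a) by rewrite mulr_ge0 ?sqr_ge0//; lra.
by nra.
Qed.

(** The mean value form turns [sin b - b] into [b * (cos c - 1)], to which [cos_quad] applies. *)
Lemma sin_mean (b : R) : exists2 c, `|c| <= `|b| & sin b = b * cos c.
Proof.
wlog b0 : b / 0 <= b => [hw|].
  have [/hw//|b0] := leP 0 b.
  have [|c hc e] := hw (- b); first by rewrite oppr_ge0 ltW.
  exists c; first by rewrite -[leRHS]normrN.
  by move: e; rewrite sinN mulNr => /oppr_inj.
have [] := @MVT_segment R sin cos 0 b b0.
  by apply: continuous_subspaceT => x; exact: continuous_sin.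
move=> c /andP[c0 cb]; rewrite sin0 !subr0 => e; exists c; last by rewrite e mulrC.
by rewrite !ger0_norm.
Qed.

Lemma sin_le_norm (b : R) : `|sin b| <= `|b|.
Proof.
have [c _ ->] := sin_mean b; rewrite normrM ler_piMr//; exact: cos_max.
Qed.

Lemma cos_quad (b : R) : `|cos b - 1| <= b ^+ 2.
Proof.
have -> : cos b - 1 = - (2 * sin (b / 2) ^+ 2).
  rewrite [in LHS](splitr b) -mulr2n cos_mulr2n sin2cos2; ring.
rewrite normrN normrM normrX; have := sin_le_norm (b / 2).
rewrite normrM (ger0_norm (_ : 0 <= 2^-1))// -(@ler_pXn2r _ 2) ?nnegrE//.
have -> : (`|b| / 2) ^+ 2 = b ^+ 2 / 4 by rewrite exprMn real_normK ?num_real//; field.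
by rewrite normr_nat; have := sqr_ge0 b; lra.
Qed.

(** For [h = a + i b], the real part of the error is [exp a (cos b - 1) + (exp a - 1 - a)] and, with
    [sin b = b cos c], the imaginary part is [exp a b (cos c - 1) + (exp a - 1 - a) b + a b]. The
    bounds on these five terms add up to [7 r^2], where [r = nrm h]. *)
Lemma expC_quad (h : C) : nrm h <= 2^-1 -> nrm (expC h - 1 - h) <= 8 * nrm h ^+ 2.
Proof.
move=> hr; apply: (le_trans (nrm_le_ReIm _)); move: hr.
have := norm_Re_le h; have := norm_Im_le h; move: (nrm h) => r.
case: h => a b hb ha hr; rewrite /= in hb ha.
have r0 : 0 <= r by rewrite (le_trans _ ha).
have a2 : a ^+ 2 <= r ^+ 2 by rewrite -[a ^+ 2]real_normK ?num_real// ler_pXn2r ?nnegrE.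
have b2 : b ^+ 2 <= r ^+ 2 by rewrite -[b ^+ 2]real_normK ?num_real// ler_pXn2r ?nnegrE.
have E := expR_quad (le_trans ha hr).
have hc := cos_quad b.
have [c cb es] := sin_mean b.
have hcc := cos_quad c.
have c2 : c ^+ 2 <= r ^+ 2.
  by rewrite -[c ^+ 2]real_normK ?num_real// ler_pXn2r ?nnegrE// (le_trans cb).
have eq1 : complex.Re (expC (a +i* b) - 1 - (a +i* b)) =
  expR a * (cos b - 1) + (expR a - 1 - a) by rewrite /expC /=; ring.
have eq2 : complex.Im (expC (a +i* b) - 1 - (a +i* b)) =
  expR a * (b * (cos c - 1)) + (expR a - 1 - a) * b + a * b.
  by rewrite /expC /= es; ring.
have Ea2 : expR a <= 2.
  move: E; rewrite ler_norml => /andP[_]; move: ha; rewrite ler_norml => /andP[_ ha].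
  by nra.
have Ea0 := expR_ge0 a.
rewrite eq1 eq2.
have h1 : `|expR a * (cos b - 1)| <= 2 * r ^+ 2.
  rewrite normrM (ger0_norm Ea0) ler_pM//; exact: le_trans b2.
have h2 : `|expR a - 1 - a| <= 2 * r ^+ 2 by rewrite (le_trans E)// ler_pM2l.
have h3 : `|expR a * (b * (cos c - 1))| <= 2 * (2^-1 * r ^+ 2).
  rewrite normrM (ger0_norm Ea0) ler_pM// normrM ler_pM//; last exact: le_trans c2.
  exact: le_trans hr.
have h4 : `|(expR a - 1 - a) * b| <= 2 * r ^+ 2 * 2^-1.
  by rewrite normrM ler_pM//; exact: le_trans hr.
have h5 : `|a * b| <= r * r by rewrite normrM ler_pM.
have := ler_normD (expR a * (cos b - 1)) (expR a - 1 - a).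
have := ler_normD (expR a * (b * (cos c - 1)) + (expR a - 1 - a) * b) (a * b).
have := ler_normD (expR a * (b * (cos c - 1))) ((expR a - 1 - a) * b).
by have := sqr_ge0 r; lra.
Qed.

(** The slope is recorded together with its value [expC z] at [z]: being nonzero, it shows that
    [expC] takes each of its values simply, which controls the zeros of [P(e(x))]. *)
Lemma expC_caratheodory (z : C) : exists phi, [/\ cont_at phi z, phi z = expC z &
  forall y, expC y = expC z + phi y * (y - z)].
Proof.
exists (fun y => if y == z then expC z else (expC y - expC z) / (y - z)); split.
- apply/cont_atR => e e0; rewrite eqxx.
  have M0 : 0 < 8 * nrm (expC z) by rewrite mulr_gt0// nrm_gt0 expC_neq0.
  exists (Num.min 2^-1 (e / (8 * nrm (expC z)))).
    by rewrite lt_min invr_gt0 divr_gt0// ltr0n.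
  move=> y; rewrite lt_min => /andP[y1 y2]; case: eqVneq => [_|yz].
    by rewrite subrr nrm0.
  have -> : (expC y - expC z) / (y - z) - expC z =
      expC z * ((expC (y - z) - 1 - (y - z)) / (y - z)).
    have -> : expC y = expC z * expC (y - z) by rewrite -expCD addrC subrK.
    by field; rewrite subr_eq0.
  move: y2; rewrite ltr_pdivlMr//; apply: le_lt_trans.
  rewrite nrmM [nrm (_ / _)]nrmM nrmV [leRHS]mulrA [leRHS]mulrC ler_wpM2l ?nrm_ge0//.
  rewrite ler_pdivrMr ?nrm_gt0 ?subr_eq0// [leRHS]mulrAC -expr2 [leRHS]mulrC.
  exact/expC_quad/ltW.
- by rewrite eqxx.
- move=> y; case: eqVneq => [->|yz]; first by rewrite subrr mulr0 addr0.
  by rewrite divfK ?subr_eq0// addrC subrK.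
Qed.

Lemma diff_at_expC (z : C) : diff_at (@expC R) z.
Proof. by have [phi [? _ ?]] := expC_caratheodory z; apply/diff_atP; exists phi. Qed.

Definition ex (z : C) : C := expC (2%:C * pi%:C * 'i%C * z).

Lemma exD z y : ex (z + y) = ex z * ex y.
Proof. by rewrite /ex mulrDr expCD. Qed.
Lemma ex0 : ex 0 = 1. Proof. by rewrite /ex mulr0 expC0. Qed.
Lemma ex_neq0 z : ex z != 0. Proof. exact: expC_neq0. Qed.
Lemma exN z : ex (- z) = (ex z)^-1.
Proof. by apply: (mulfI (ex_neq0 z)); rewrite -exD subrr ex0 divff// ex_neq0. Qed.
Lemma ex1 : ex 1 = 1.
Proof.
rewrite /ex /expC /= !(mul0r,mul1r,mulr0,mulr1,addr0,add0r,subr0,oppr0,subrr) expR0.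
by rewrite mulr_natl cos2pi sin2pi mulr0 addr0 mulr1.
Qed.
Lemma exD1 z : ex (z + 1) = ex z. Proof. by rewrite exD ex1 mulr1. Qed.

Lemma exMz (z : C) (m : int) : ex (m%:~R * z) = ex z ^ m.
Proof.
have exn n : ex (n%:R * z) = ex z ^+ n.
  elim: n => [|n ih]; first by rewrite mul0r ex0 expr0.
  by rewrite -natr1 mulrDl mul1r exD ih exprSr.
case: m => n; first exact: exn.
by rewrite [in LHS]NegzE mulrNz mulNr exN; congr (_^-1); exact: exn.
Qed.

Lemma nrm_ex (z : C) : nrm (ex z) = expR (- (2 * pi * complex.Im z)).
Proof.
by rewrite /ex nrm_expC; congr expR; case: z => a b /=; ring.
Qed.

Lemma diff_at_ex (z : C) : diff_at ex z.
Proof.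
apply: (@diff_at_comp _ (fun y => 2%:C * pi%:C * 'i%C * y)); last exact: diff_at_expC.
by apply: diff_atM; [exact: diff_at_cst|exact: diff_at_id].
Qed.

Lemma ex_caratheodory (z : C) : exists phi, [/\ cont_at phi z, phi z != 0 &
  forall y, ex y = ex z + phi y * (y - z)].
Proof.
have [phi [cphi phiz hphi]] := expC_caratheodory (2%:C * pi%:C * 'i%C * z).
exists (fun y => phi (2%:C * pi%:C * 'i%C * y) * (2%:C * pi%:C * 'i%C)); split.
- apply: cont_atM (cont_at_cst _ _); apply: (@cont_at_comp _ (fun y => 2%:C * pi%:C * 'i%C * y)) => //.
  by apply: cont_atM; [exact: cont_at_cst|exact: cont_at_id].
- rewrite phiz mulf_neq0 ?expC_neq0// !mulf_neq0//.
  + by rewrite -nrm_gt0 nrm_real normr_gt0.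
  + by rewrite -nrm_gt0 nrm_real normr_gt0 gt_eqF ?pi_gt0.
  + by rewrite eq_complex /= oner_eq0 andbF.
- by move=> y; rewrite -[_ * _ * (y - z)]mulrA [_ * (y - z)]mulrBr; exact: hphi.
Qed.

End ComplexExponential.

(** * Path integrals and Goursat's theorem *)

Section PathIntegrals.
Variable R : realType.
Local Notation C := R[i].
Implicit Types (f g : R -> C) (a b c : R).
Local Notation mu := (@lebesgue_measure R).

(** The point [y] ranges over the whole line, so continuity is two-sided at the endpoints as
    well. *)
Definition cpath a b f := forall x, a <= x <= b -> forall e : R, 0 < e ->
  exists2 d : R, 0 < d & forall y, `|y - x| < d -> nrm (f y - f x) < e.

Definition cint a b f : C :=
  (Rintegral mu `[a, b]%classic (fun x => complex.Re (f x)))%:C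
  + 'i%C * (Rintegral mu `[a, b]%classic (fun x => complex.Im (f x)))%:C.

Lemma cint01E f : cint01 f = cint 0 1 f. Proof. by []. Qed.

Lemma integrable_of_continuous a b (h : R -> R) :
  (forall x, a <= x <= b -> forall e : R, 0 < e ->
     exists2 d : R, 0 < d & forall y, `|y - x| < d -> `|h y - h x| < e) ->
  mu.-integrable `[a, b]%classic (EFin \o h).
Proof.
move=> ch; apply: continuous_compact_integrable; first exact: segment_compact.
apply: continuous_in_subspaceT => x; rewrite inE /= in_itv /= => xab.
apply/(@cvgrPdist_lt _ _ _ (nbhs x)) => e /(ch _ xab)[d d0 hd].
apply/nbhs_ballP; exists d => //= y; rewrite /ball /= distrC => /hd.
by rewrite distrC.
Qed.

Lemma cpath_integrable a b f : cpath a b f ->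
  mu.-integrable `[a, b]%classic (EFin \o (fun x => complex.Re (f x))) /\
  mu.-integrable `[a, b]%classic (EFin \o (fun x => complex.Im (f x))).
Proof.
move=> cf; split; apply: integrable_of_continuous => x /cf h e /h[d d0 hd];
  exists d => // y /hd; apply: le_lt_trans; rewrite -raddfB;
  [exact: norm_Re_le|exact: norm_Im_le].
Qed.

Lemma cpath_sub a b a' b' f : a <= a' -> b' <= b -> cpath a b f -> cpath a' b' f.
Proof.
move=> aa bb cf x /andP[ax xb]; apply: cf.
by rewrite (le_trans aa)// (le_trans _ bb).
Qed.

Lemma cpath_cst a b (k : C) : cpath a b (fun=> k).
Proof. by move=> x _ e e0; exists 1 => // y _; rewrite subrr nrm0. Qed.

Lemma cpath_real a b : cpath a b (fun x => x%:C).
Proof. by move=> x _ e e0; exists e => // y; rewrite -rmorphB nrm_real. Qed.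

Lemma cpath_comp (F : C -> C) a b f :
  cpath a b f -> (forall x, a <= x <= b -> cont_at F (f x)) -> cpath a b (fun x => F (f x)).
Proof.
move=> cf cF x xab e /((cont_atR _ _).1 (cF _ xab))[r r0 hr].
by have [d d0 hd] := cf _ xab _ r0; exists d => // y /hd /hr.
Qed.

Lemma cpathD a b f g : cpath a b f -> cpath a b g -> cpath a b (fun x => f x + g x).
Proof.
move=> cf cg x xab e e0; have e2 : 0 < e / 2 by rewrite divr_gt0.
have [d d0 hd] := cf _ xab _ e2; have [d' d'0 hd'] := cg _ xab _ e2.
exists (Num.min d d'); first by rewrite lt_min d0.
move=> y; rewrite lt_min => /andP[/hd h /hd' h'].
rewrite opprD addrACA (le_lt_trans (nrmD _ _))// (splitr e).
exact: ltrD.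
Qed.

Lemma cpathM a b f g : cpath a b f -> cpath a b g -> cpath a b (fun x => f x * g x).
Proof.
move=> cf cg x xab e e0.
pose M := nrm (f x) + nrm (g x) + 1.
have M1 : 1 <= M by rewrite lerDr addr_ge0 ?nrm_ge0.
have M0 : 0 < M by rewrite (lt_le_trans _ M1).
pose e' := Num.min 1 (e / (2 * M)).
have e'0 : 0 < e' by rewrite lt_min ltr01 divr_gt0// mulr_gt0.
have [d d0 hd] := cf _ xab _ e'0; have [d' d'0 hd'] := cg _ xab _ e'0.
exists (Num.min d d'); first by rewrite lt_min d0.
move=> y; rewrite lt_min => /andP[/hd h /hd' h'].
have -> : f y * g y - f x * g x =
   (f y - f x) * (g y - g x) + (f y - f x) * g x + f x * (g y - g x) by ring.
have := nrmD ((f y - f x) * (g y - g x) + (f y - f x) * g x) (f x * (g y - g x)).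
have := nrmD ((f y - f x) * (g y - g x)) ((f y - f x) * g x).
rewrite !nrmM.
have := nrm_ge0 (f y - f x); have := nrm_ge0 (g y - g x).
have := nrm_ge0 (f x); have := nrm_ge0 (g x).
move: h h'; rewrite !lt_min !ltr_pdivlMr ?mulr_gt0// => /andP[h1 h2] /andP[h3 h4].
move: h1 h2 h3 h4; rewrite /M.
set A := nrm (f y - f x); set B := nrm (g y - g x).
set F := nrm (f x); set G := nrm (g x) => *.
have : A * B <= A by rewrite ler_piMr// ltW.
nra.
Qed.

Lemma eq_cint a b f g : (forall x, a <= x <= b -> f x = g x) -> cint a b f = cint a b g.
Proof.
move=> fg; rewrite /cint; congr (_%:C + _ * _%:C); apply: eq_Rintegral => x;
  by rewrite inE /= in_itv /= => /fg ->.
Qed.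

Lemma cintD a b f g : cpath a b f -> cpath a b g ->
  cint a b (fun x => f x + g x) = cint a b f + cint a b g.
Proof.
move=> /cpath_integrable[f1 f2] /cpath_integrable[g1 g2]; rewrite /cint.
have -> : (fun x => complex.Re (f x + g x)) = (fun x => complex.Re (f x) + complex.Re (g x)).
  by apply/funext => x; rewrite raddfD.
have -> : (fun x => complex.Im (f x + g x)) = (fun x => complex.Im (f x) + complex.Im (g x)).
  by apply/funext => x; rewrite raddfD.
rewrite RintegralD// RintegralD// !rmorphD /=; ring.
Qed.

Lemma cintZ a b (k : C) f : cpath a b f -> cint a b (fun x => k * f x) = k * cint a b f.
Proof.
move=> /cpath_integrable[f1 f2]; rewrite /cint; case: k => u v.
have -> : (fun x => complex.Re ((u +i* v) * f x)) =
    (fun x => u * complex.Re (f x) - v * complex.Im (f x)).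
  by apply/funext => x; case: (f x).
have -> : (fun x => complex.Im ((u +i* v) * f x)) =
    (fun x => u * complex.Im (f x) + v * complex.Re (f x)).
  by apply/funext => x; case: (f x).
have iZ (r : R) h : mu.-integrable `[a, b]%classic (EFin \o h) ->
    mu.-integrable `[a, b]%classic (EFin \o (fun x => r * h x)).
  by move=> ih; exact: (integrableZl _ r ih).
rewrite RintegralB// ?RintegralD//; [|exact: iZ..].
rewrite !RintegralZl//.
apply/eqP; rewrite eq_complex /=; apply/andP; split; apply/eqP; ring.
Qed.

Lemma cint_sum (I : Type) (s : seq I) (F : I -> R -> C) a b :
  (forall i, cpath a b (F i)) ->
  cpath a b (fun x => \sum_(i <- s) F i x) /\
  cint a b (fun x => \sum_(i <- s) F i x) = \sum_(i <- s) cint a b (F i).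
Proof.
move=> cF; elim: s => [|i s [ih1 ih2]].
  rewrite [X in cpath _ _ X](_ : _ = fun=> 0); last by apply/funext => x; rewrite big_nil.
  split; first exact: cpath_cst.
  rewrite big_nil; transitivity (cint a b (fun=> 0 * 0 : C)).
    by apply: eq_cint => x _; rewrite big_nil mul0r.
  by rewrite cintZ ?mul0r//; exact: cpath_cst.
rewrite [X in cpath _ _ X](_ : _ = fun x => F i x + \sum_(j <- s) F j x); last first.
  by apply/funext => x; rewrite big_cons.
split; first exact: cpathD.
rewrite big_cons -ih2 -cintD//; apply: eq_cint => x _; by rewrite big_cons.
Qed.

Lemma cint_chasles a b c f : a <= b -> b <= c -> cpath a c f ->
  cint a c f = cint a b f + cint b c f.
Proof.
move=> ab bc /cpath_integrable[i1 i2].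
have ch (h : R -> R) : mu.-integrable `[a, c]%classic (EFin \o h) ->
    Rintegral mu `[a, c]%classic h = Rintegral mu `[a, b]%classic h + Rintegral mu `[b, c]%classic h.
  move=> ih; have := @Rintegral_itvB R h (BLeft a) (BRight c) b ih.
  rewrite !bnd_simp => /(_ ab bc) e.
  rewrite -(@Rintegral_itv_obnd_cbnd _ b); last first.
    apply: integrableS ih => //; apply: subset_itvr; rewrite bnd_simp//.
  by rewrite -e addrC subrK.
rewrite /cint !ch// !rmorphD /=; ring.
Qed.

(** The factor [2] comes from bounding the real and imaginary parts separately by [M * (b - a)]. *)
Lemma nrm_cint_le a b f (M : R) : a <= b -> cpath a b f ->
  (forall x, a <= x <= b -> nrm (f x) <= M) -> nrm (cint a b f) <= 2 * M * (b - a).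
Proof.
move=> ab /cpath_integrable[i1 i2] hM.
have bd (h : R -> R) : mu.-integrable `[a, b]%classic (EFin \o h) ->
    (forall x, a <= x <= b -> `|h x| <= M) -> `|Rintegral mu `[a, b]%classic h| <= M * (b - a).
  move=> ih hh; rewrite (le_trans (le_normr_Rintegral _ ih))//.
  have -> : M * (b - a) = Rintegral mu `[a, b]%classic (fun=> M).
    rewrite Rintegral_cst//= lebesgue_measure_itv /= lte_fin.
    by case: ltP ab => //= ba ab; rewrite (@le_anti _ _ a b) ?ab// subrr.
  apply: le_Rintegral => //.
  - exact: (@integrable_norm _ _ _ mu _ _ ih).
  - apply: integrable_of_continuous => x _ e e0; exists 1 => // y _.
    by rewrite subrr normr0.

have h1 := bd _ i1 (fun x xab => le_trans (norm_Re_le _) (hM x xab)).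
have h2 := bd _ i2 (fun x xab => le_trans (norm_Im_le _) (hM x xab)).
rewrite (le_trans (nrm_le_ReIm _))// /cint /=.
rewrite !(mul0r,mul1r,addr0,add0r,subr0,mulr0,oppr0).
by rewrite -mulrA mulr_natl mulr2n lerD.
Qed.

Lemma Rint_primitive a b (F h : R -> R) : a <= b ->
  (forall x : R, is_derive x (1 : R) F (h x)) -> continuous h ->
  Rintegral mu `[a, b]%classic h = F b - F a.
Proof.
rewrite le_eqVlt => /predU1P[<- _ _|ab dF ch].
  by rewrite set_itv1 Rintegral_set1 subrr.
have cF : continuous F.
  by move=> x; apply: differentiable_continuous; apply/derivable1_diffP; have := dF x; case.
rewrite /Rintegral (@continuous_FTC2 R h F a b ab)//.
- exact: continuous_subspaceT.
- split; first by move=> x _; have := dF x; case.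
  + by apply: cvg_at_right_filter; exact: cF.
  + by apply: cvg_at_left_filter; exact: cF.
- by move=> x _; rewrite derive1E; have := dF x; case.
Qed.

(** The only integrals evaluated by primitives; they give the vanishing of affine contour integrals
    in Goursat's argument. *)
Lemma cint_affine a b (k l : C) : a <= b ->
  cint a b (fun x => k + l * x%:C) = k * (b - a)%:C + l * (b ^+ 2 / 2 - a ^+ 2 / 2)%:C.
Proof.
move=> ab; rewrite cintD; [|exact: cpath_cst|apply: cpathM; [exact: cpath_cst|exact: cpath_real]].
rewrite cintZ; last exact: cpath_real.
have e1 : cint a b (fun=> 1 : C) = (b - a)%:C.
  rewrite /cint (@Rint_primitive a b id (fun=> 1))//=; last first.
    by move=> x; exact: cvg_cst.
  rewrite (@Rint_primitive a b (fun=> 0) (fun=> 0))//=; last first.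
    by move=> x; exact: cvg_cst.
  by rewrite subrr mulr0 addr0.
have e2 : cint a b (fun x => x%:C) = (b ^+ 2 / 2 - a ^+ 2 / 2)%:C.
  have d2 (x : R) : is_derive x (1 : R) (fun y => y ^+ 2) (2 * x).
    apply: DeriveDef; first exact: exprn_derivable.
    by rewrite exp_derive /= expr1 /GRing.scale /= mulr1.
  have i2 := @Rint_primitive a b (fun x => x ^+ 2) (fun x => 2 * x) ab d2.
  have c2 : continuous (fun x : R => 2 * x).
    by move=> x; apply: cvgM; [exact: cvg_cst|exact: cvg_id].
  rewrite /cint /= (_ : \int[mu]_(x in `[a, b]) x = b ^+ 2 / 2 - a ^+ 2 / 2); last first.
    have := i2 c2; rewrite RintegralZl//; first by move=> e; lra.
    apply: integrable_of_continuous => x _ e e0; by exists e.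
  rewrite (@Rint_primitive a b (fun=> 0) (fun=> 0))//=; last first.
    by move=> x; exact: cvg_cst.
  by rewrite subrr mulr0 addr0.
rewrite e2 -[X in cint a b X + _](_ : (fun=> k * 1) = _); last by rewrite mulr1.
by rewrite cintZ ?e1//; exact: cpath_cst.
Qed.

End PathIntegrals.

(** * Goursat's theorem on parallelograms with horizontal sides *)

Section Goursat.
Variable R : realType.
Local Notation C := R[i].
Variable tau : C.
Implicit Types (f g : C -> C) (a b c d s r : R).

(** The common point is the supremum of the left ends. It serves both the bisection below and the
    summation of real series. *)
Lemma nested_segments (x y : nat -> R) :
  (forall k, x k <= x k.+1) -> (forall k, y k.+1 <= y k) -> (forall k, x k <= y k) ->
  exists z, forall k, x k <= z <= y k.
Proof.
move=> hx hy hxy.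
have xm i j : (i <= j)%N -> x i <= x j.
  exact: (@homo_leq _ x (fun u v => u <= v) (@lexx _ _) (fun _ _ _ => @le_trans _ _ _ _ _)).
have ym i j : (i <= j)%N -> y j <= y i.
  by apply: (@homo_leq _ y (fun u v => v <= u)) => // u v w /[swap]; exact: le_trans.
have xy i j : x i <= y j.
  rewrite (le_trans (xm i (maxn i j) _)) ?leq_maxl//.
  by rewrite (le_trans (hxy _))// ym// leq_maxr.
exists (sup (range x)) => k; apply/andP; split.
  apply: sup_upper_bound; last by exists k.
  by split; [exists (x 0%N), 0%N|exists (y 0%N) => _ [i _ <-]].
by apply: ge_sup; [exists (x 0%N), 0%N|move=> _ [i _ <-]].
Qed.

Definition hor f r a b := cint a b (fun s => f (s%:C + r%:C * tau)).
Definition ver f s c d := cint c d (fun r => f (s%:C + r%:C * tau)).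
(** Contour integral around a parallelogram in the oblique coordinates [s + r tau], bottom side
    first. Since [ver] integrates against [dr], the factor [tau] of [dz = tau dr] is put back
    here. *)
Definition circ f a b c d :=
  hor f c a b - hor f d a b + tau * ver f b c d - tau * ver f a c d.

Lemma hor_path f r a b : (forall s, a <= s <= b -> cont_at f (s%:C + r%:C * tau)) ->
  cpath a b (fun s => f (s%:C + r%:C * tau)).
Proof.
move=> cf; apply: (cpath_comp _ cf); apply: cpathD; [exact: cpath_real|exact: cpath_cst].
Qed.

Lemma ver_path f s c d : (forall r, c <= r <= d -> cont_at f (s%:C + r%:C * tau)) ->
  cpath c d (fun r => f (s%:C + r%:C * tau)).
Proof.
move=> cf; apply: (cpath_comp _ cf); apply: cpathD; first exact: cpath_cst.
by apply: cpathM; [exact: cpath_real|exact: cpath_cst].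
Qed.

Section Box.
Variables (f : C -> C) (A B c0 d0 : R).
Hypothesis cf : forall s r, A <= s <= B -> c0 <= r <= d0 -> cont_at f (s%:C + r%:C * tau).

Lemma box_hor r a b : A <= a -> b <= B -> c0 <= r <= d0 ->
  cpath a b (fun s => f (s%:C + r%:C * tau)).
Proof.
by move=> Aa bB hr; apply: hor_path => s /andP[h1 h2]; apply: cf; rewrite // (le_trans Aa)// (le_trans h2).
Qed.

Lemma box_ver s c d : c0 <= c -> d <= d0 -> A <= s <= B ->
  cpath c d (fun r => f (s%:C + r%:C * tau)).
Proof.
by move=> Aa bB hr; apply: ver_path => r /andP[h1 h2]; apply: cf; rewrite // (le_trans Aa)// (le_trans h2).
Qed.

Lemma circ_split_h a m b c d : A <= a -> a <= m -> m <= b -> b <= B -> c0 <= c -> c <= d -> d <= d0 ->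
  circ f a b c d = circ f a m c d + circ f m b c d.
Proof.
move=> Aa am mb bB cc cd dd; rewrite /circ /hor.
rewrite (cint_chasles am mb); last by apply: box_hor; rewrite // cc (le_trans cd).
rewrite (cint_chasles am mb); last by apply: box_hor; rewrite // dd (le_trans cc).
have id (V : comPzRingType) (x y z w t p1 p2 p3 : V) : x + y - (z + w) + t * p1 - t * p2 =
   x - z + t * p3 - t * p2 + (y - w + t * p1 - t * p3) by ring.
exact: id.
Qed.

Lemma circ_split_v a b c m d : A <= a -> a <= b -> b <= B -> c0 <= c -> c <= m -> m <= d -> d <= d0 ->
  circ f a b c d = circ f a b c m + circ f a b m d.
Proof.
move=> Aa ab bB cc cm md dd; rewrite /circ /ver.
rewrite (cint_chasles cm md); last by apply: box_ver; rewrite // bB (le_trans Aa).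
rewrite (cint_chasles cm md); last by apply: box_ver; rewrite // Aa (le_trans ab).
have id (V : comPzRingType) (x y z t p1 p2 p3 p4 : V) : x - y + t * (p1 + p2) - t * (p3 + p4) =
   x - z + t * p1 - t * p3 + (z - y + t * p2 - t * p4) by ring.
exact: id.
Qed.

Lemma circ_bound a b c d (M : R) : A <= a -> a <= b -> b <= B -> c0 <= c -> c <= d -> d <= d0 ->
  (forall s r, a <= s <= b -> c <= r <= d -> nrm (f (s%:C + r%:C * tau)) <= M) ->
  nrm (circ f a b c d) <= 4 * M * ((b - a) + nrm tau * (d - c)).
Proof.
move=> Aa ab bB cc cd dd hM; rewrite /circ.
have ha : A <= a <= B by rewrite Aa (le_trans ab).
have hb : A <= b <= B by rewrite bB (le_trans Aa).
have hc : c0 <= c <= d0 by rewrite cc (le_trans cd).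
have hd : c0 <= d <= d0 by rewrite dd (le_trans cc).
have h1 := nrm_cint_le ab (box_hor Aa bB hc) (fun s hs => hM s c hs (introT andP (conj (lexx c) cd))).
have h2 := nrm_cint_le ab (box_hor Aa bB hd) (fun s hs => hM s d hs (introT andP (conj cd (lexx d)))).
have h3 := nrm_cint_le cd (box_ver cc dd ha) (fun r hr => hM a r (introT andP (conj (lexx a) ab)) hr).
have h4 := nrm_cint_le cd (box_ver cc dd hb) (fun r hr => hM b r (introT andP (conj ab (lexx b))) hr).
move: h1 h2 h3 h4; rewrite -/(hor f c a b) -/(hor f d a b) -/(ver f a c d) -/(ver f b c d).
move: (hor f c a b) (hor f d a b) (ver f a c d) (ver f b c d) => x y z w h1 h2 h3 h4.
have t0 := nrm_ge0 tau.
have h3' := ler_wpM2l t0 h3; have h4' := ler_wpM2l t0 h4.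
have := nrmD (x - y + tau * w) (- (tau * z)); have := nrmD (x - y) (tau * w).
have := nrmD x (- y); rewrite !nrmN !(nrmM tau).
lra.
Qed.

End Box.

Lemma circ_affine a b c d (k l : C) : a <= b -> c <= d ->
  circ (fun z => k + l * z) a b c d = 0.
Proof.
move=> ab cd; rewrite /circ /hor /ver.
have e1 r : cint a b (fun s => k + l * (s%:C + r%:C * tau)) =
    (k + l * (r%:C * tau)) * (b - a)%:C + l * (b ^+ 2 / 2 - a ^+ 2 / 2)%:C.
  by rewrite -cint_affine//; apply: eq_cint => s _; ring.
have e2 s : cint c d (fun r => k + l * (s%:C + r%:C * tau)) =
    (k + l * s%:C) * (d - c)%:C + (l * tau) * (d ^+ 2 / 2 - c ^+ 2 / 2)%:C.
  by rewrite -cint_affine//; apply: eq_cint => r _; ring.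
by rewrite !e1 !e2 !rmorphB /=; ring.
Qed.

Lemma circ_add f g a b c d : a <= b -> c <= d ->
  (forall s r, a <= s <= b -> c <= r <= d -> cont_at f (s%:C + r%:C * tau)) ->
  (forall s r, a <= s <= b -> c <= r <= d -> cont_at g (s%:C + r%:C * tau)) ->
  circ (fun z => f z + g z) a b c d = circ f a b c d + circ g a b c d.
Proof.
move=> ab cd cf cg; rewrite /circ /hor /ver.
have aa : a <= a <= b by rewrite lexx.
have bb : a <= b <= b by rewrite ab lexx.
have cc : c <= c <= d by rewrite lexx.
have dd : c <= d <= d by rewrite cd lexx.
have id (V : comPzRingType) (x y z w t p1 p2 p3 p4 : V) :
   x + y - (z + w) + t * (p1 + p2) - t * (p3 + p4) =
   x - z + t * p1 - t * p3 + (y - w + t * p2 - t * p4) by ring.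
rewrite !cintD; [exact: id|..].
all: by [exact: (box_ver cf)|exact: (box_ver cg)|exact: (box_hor cf)|exact: (box_hor cg)].
Qed.

Opaque circ hor ver.

Lemma pigeonhole4 (e : R) (w1 w2 w3 w4 : C) : 4 * e <= nrm (w1 + w2 + (w3 + w4)) ->
  [\/ e <= nrm w1, e <= nrm w2, e <= nrm w3 | e <= nrm w4].
Proof.
move=> h.
have := nrmD (w1 + w2) (w3 + w4); have := nrmD w3 w4; have := nrmD w1 w2.
have [?|h1] := leP e (nrm w1); first by constructor 1.
have [?|h2] := leP e (nrm w2); first by constructor 2.
have [?|h3] := leP e (nrm w3); first by constructor 3.
have [?|h4] := leP e (nrm w4); first by constructor 4.
by lra.
Qed.

Section GoursatTheorem.
Variables (f : C -> C) (A B c0 d0 : R).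
Hypothesis df : forall s r, A <= s <= B -> c0 <= r <= d0 -> diff_at f (s%:C + r%:C * tau).

Let cf s r (hs : A <= s <= B) (hr : c0 <= r <= d0) : cont_at f (s%:C + r%:C * tau) :=
  diff_at_cont (df hs hr).

(** Up to an error [e * |z - z0|] the function is affine, and affine functions have zero contour
    integral. On a box of size [D] the error is at most [e * D], and it is integrated over a contour
    of length comparable to [D], whence the square. *)
Lemma circ_local s0 r0 (e : R) : A <= s0 <= B -> c0 <= r0 <= d0 -> 0 < e ->
  exists2 dl : R, 0 < dl & forall a b c d, A <= a <= s0 -> s0 <= b <= B -> c0 <= c <= r0 ->
    r0 <= d <= d0 -> (b - a) + nrm tau * (d - c) < dl ->
    nrm (circ f a b c d) <= 4 * e * ((b - a) + nrm tau * (d - c)) ^+ 2.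
Proof.
move=> hs hr e0; set z0 := s0%:C + r0%:C * tau.
have [l hl] := cdiff_at_approx (df hs hr); have [dl dl0 hd] := hl _ e0.
exists dl => // a b c d /andP[Aa as0] /andP[sb bB] /andP[cc cr] /andP[rd dd].
set D := (b - a) + _ => Ddl.
have ab := le_trans as0 sb; have cd := le_trans cr rd.
pose g z := f z - f z0 - l * (z - z0).
have cg s r : a <= s <= b -> c <= r <= d -> cont_at g (s%:C + r%:C * tau).
  move=> /andP[h1 h2] /andP[h3 h4].
  have fc : cont_at f (s%:C + r%:C * tau).
    by apply: cf; rewrite ?(le_trans Aa)//= ?(le_trans h2)// ?(le_trans cc)//= (le_trans h4).
  have h5 := cont_atD fc (cont_at_cst (- f z0) (s%:C + r%:C * tau)).
  have h6 := cont_atD (@cont_at_id _ (s%:C + r%:C * tau)) (cont_at_cst (- z0) _).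
  exact: (cont_atD h5 (cont_atN (cont_atM (cont_at_cst l _) h6))).
have gE : circ f a b c d = circ g a b c d.
  have -> : f = fun z => (f z0 - l * z0 + l * z) + g z.
    apply/funext => z; rewrite /g.
    have id (V : comPzRingType) (p w0 z2 z3 l0 : V) :
      p = w0 - l0 * z3 + l0 * z2 + (p - w0 - l0 * (z2 - z3)) by ring.
    exact: id.
  rewrite (circ_add (f := fun z => f z0 - l * z0 + l * z) ab cd _ cg).
    by rewrite circ_affine// add0r.
  move=> s r _ _; exact: (cont_atD (cont_at_cst _ _) (cont_atM (cont_at_cst l _) (@cont_at_id _ _))).
have zD s r : a <= s <= b -> c <= r <= d -> nrm (s%:C + r%:C * tau - z0) <= D.
  move=> /andP[h1 h2] /andP[h3 h4].
  have -> : s%:C + r%:C * tau - z0 = (s - s0)%:C + (r - r0)%:C * tau.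
    have id (V : comPzRingType) (p1 p2 p3 p4 l0 : V) :
      p1 + p2 * l0 - (p3 + p4 * l0) = p1 - p3 + (p2 - p4) * l0 by ring.
    by rewrite /z0 id !rmorphB.
  rewrite (le_trans (nrmD _ _))// nrmM !nrm_real lerD//.
    by rewrite ler_norml; lra.
  by rewrite mulrC ler_wpM2l ?nrm_ge0// ler_norml; lra.
rewrite gE expr2 mulrA -[4 * e * D]mulrA; apply: (circ_bound cg) => //.
move=> s r hs' hr'; have h := zD _ _ hs' hr'.
rewrite (le_trans (hd _ _))//; first exact: le_lt_trans Ddl.
by rewrite ler_wpM2l// ltW.
Qed.

Lemma quad_step x x1 x2 y y1 y2 (e : R) : A <= x -> x <= x1 -> x1 <= x2 -> x2 <= B ->
  c0 <= y -> y <= y1 -> y1 <= y2 -> y2 <= d0 -> 4 * e <= nrm (circ f x x2 y y2) ->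
  [\/ e <= nrm (circ f x x1 y y1), e <= nrm (circ f x x1 y1 y2), e <= nrm (circ f x1 x2 y y1) |
    e <= nrm (circ f x1 x2 y1 y2)].
Proof.
move=> h1 h2 h3 h4 h5 h6 h7 h8.
have x12 := le_trans h2 h3; have y12 := le_trans h6 h7.
rewrite (@circ_split_h _ _ _ _ _ cf x x1)//.
rewrite (@circ_split_v _ _ _ _ _ cf x _ y y1)//; last exact: le_trans h4.
rewrite (@circ_split_v _ _ _ _ _ cf x1 _ y y1)//; last exact: le_trans h2.
exact: pigeonhole4.
Qed.

(** Bisection: some quarter of each box carries at least a quarter of the contour integral, while
    [circ_local] at the common point of the boxes makes the integral over a box of size [K * h k] an
    arbitrarily small multiple of [h k ^ 2]. *)
Theorem goursat : A <= B -> c0 <= d0 -> circ f A B c0 d0 = 0.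
Proof.
move=> AB cd0; apply/eqP; rewrite -nrm_eq0; apply/negPn/negP => E0.
set E := nrm _ in E0; have {}E0 : 0 < E by rewrite lt_neqAle eq_sym E0 nrm_ge0.
pose L := B - A; pose M := d0 - c0; pose h k : R := 2^-1 ^+ k.
have L0 : 0 <= L by rewrite subr_ge0.
have M0 : 0 <= M by rewrite subr_ge0.
have h0 k : 0 < h k by rewrite exprn_gt0// invr_gt0.
have hS k : h k = h k.+1 + h k.+1 by rewrite /h exprS; field.
pose box k (p : R * R) := circ f p.1 (p.1 + L * h k) p.2 (p.2 + M * h k).
pose Inv k (p : R * R) := [/\ A <= p.1, p.1 + L * h k <= B, c0 <= p.2, p.2 + M * h k <= d0 &
   E * h k ^+ 2 <= nrm (box k p)].
(* The invariant stands under the existential quantifier, so that [choice] yields a successor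
   function defined on all boxes. *)
have step (kp : nat * (R * R)) : exists p', Inv kp.1 kp.2 ->
    Inv kp.1.+1 p' /\ [/\ kp.2.1 <= p'.1, p'.1 + L * h kp.1.+1 <= kp.2.1 + L * h kp.1,
      kp.2.2 <= p'.2 & p'.2 + M * h kp.1.+1 <= kp.2.2 + M * h kp.1].
  case: kp => k [x y] /=.
  have [[/= h1 h2 h3 h4 h5]|hi] := pselect (Inv k (x, y)); last by exists (x, y).
  have hE : E * h k ^+ 2 = 4 * (E * h k.+1 ^+ 2) by rewrite hS; ring.
  move: h2 h4 h5; rewrite hE /box /= hS !mulrDr => h2 h4 h5.
  have Lh : 0 <= L * h k.+1 by rewrite mulr_ge0// ltW.
  have Mh : 0 <= M * h k.+1 by rewrite mulr_ge0// ltW.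
  move: h2 h4 h5; rewrite !addrA => h2 h4 h5.
  have [H HE] : exists H, H = L * h k.+1 by eexists.
  have [V VE] : exists V, V = M * h k.+1 by eexists.
  rewrite /Inv /box /= -HE -VE in Lh Mh h2 h4 h5 *.
  have xH : x <= x + H by rewrite lerDl.
  have xHH : x + H <= x + H + H by rewrite lerDl.
  have yV : y <= y + V by rewrite lerDl.
  have yVV : y + V <= y + V + V by rewrite lerDl.
  have [] := quad_step h1 xH xHH h2 h3 yV yVV h4 h5 => h6.
  - exists (x, y) => _; split; split; rewrite /= ?lexx//; [exact: le_trans h2|exact: le_trans h4].
  - exists (x, y + V) => _; split; split; rewrite /= ?lexx//; [exact: le_trans h2|exact: le_trans yV].
  - exists (x + H, y) => _; split; split; rewrite /= ?lexx//; [exact: le_trans xH|exact: le_trans h4].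
  - exists (x + H, y + V) => _; split; split; rewrite /= ?lexx//; [exact: le_trans xH|exact: le_trans yV].
have [F hF] := choice step.
pose p := fix p k := if k is k'.+1 then F (k', p k') else (A, c0).
have pI k : Inv k (p k).
  elim: k => [|k ih].
    rewrite /Inv /box /= /h expr0 !mulr1 expr1n mulr1 /L /M.
    by rewrite ![_ + (_ - _)]addrC !subrK.
  by have [] := hF (k, p k) ih.
have pS k := (hF (k, p k) (pI k)).2.
have [s hs] : exists z, forall k, (p k).1 <= z <= (p k).1 + L * h k.
  apply: nested_segments => k; [by have [] := pS k|by have [] := pS k|].
  by rewrite lerDl mulr_ge0// ltW.
have [r hr] : exists z, forall k, (p k).2 <= z <= (p k).2 + M * h k.
  apply: nested_segments => k; [by have [] := pS k|by have [] := pS k|].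
  by rewrite lerDl mulr_ge0// ltW.
have hsA : A <= s <= B by have := hs 0%N; rewrite /= /h expr0 mulr1 /L addrC subrK.
have hrA : c0 <= r <= d0 by have := hr 0%N; rewrite /= /h expr0 mulr1 /M addrC subrK.
pose K := L + nrm tau * M.
have K0 : 0 <= K by rewrite addr_ge0// mulr_ge0// nrm_ge0.
(* With this [e] the local bound [4 * e * K ^ 2] equals [E / 2] times [K ^ 2 / (K ^ 2 + 1)], which
   is below [E]; the [1] covers the case [K = 0]. *)
pose e := E / (8 * (K ^+ 2 + 1)).
have e0 : 0 < e by rewrite divr_gt0// mulr_gt0// ltr_wpDl// sqr_ge0.
have [dl dl0 hdl] := circ_local hsA hrA e0.
have [k hk] : exists k, K * h k < dl.
  have : ((fun k => K * h k) @ \oo --> K * 0)%classic.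
    by apply: cvgM; [exact: cvg_cst|apply: cvg_expr; rewrite ger0_norm ?invr_ge0// invf_lt1// ltr1n].
  rewrite mulr0 => /cvgrPdist_lt/(_ _ dl0)[N _ hN]; exists N.
  by have := hN N (leqnn _); rewrite /= sub0r normrN; apply: le_lt_trans; exact: ler_norm.
have [i1 i2 i3 i4 i5] := pI k; have /andP[hs1 hs2] := hs k; have /andP[hr1 hr2] := hr k.
have := hdl (p k).1 ((p k).1 + L * h k) (p k).2 ((p k).2 + M * h k).
rewrite i1 hs1 hs2 i2 i3 hr1 hr2 i4 -/(box k (p k)).
have -> : (p k).1 + L * h k - (p k).1 + nrm tau * ((p k).2 + M * h k - (p k).2) = K * h k.
  by rewrite /K; ring.
move=> /(_ isT isT isT isT hk) ub.
have := le_trans i5 ub; rewrite [(K * _) ^+ 2]exprMn [leRHS]mulrA (ler_pM2r (exprn_gt0 2 (h0 k))).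
rewrite leNgt => /negP; apply.
rewrite /e (_ : 4 * _ * _ = (E / 2) * (K ^+ 2 / (K ^+ 2 + 1))); last first.
  by field; rewrite gt_eqF// ltr_wpDl// sqr_ge0.
have : K ^+ 2 / (K ^+ 2 + 1) <= 1 by rewrite ler_pdivrMr ?ltr_wpDl ?sqr_ge0// mul1r lerDl.
have : 0 < E / 2 by lra.
by move=> *; nra.
Qed.

Transparent circ hor ver.

(* The vertical sides of the unit parallelogram cancel by periodicity. *)
Corollary periodic_hor_eq : A = 0 -> B = 1 -> c0 <= d0 ->
  (forall r, c0 <= r <= d0 -> f (1 + r%:C * tau) = f (r%:C * tau)) ->
  hor f c0 0 1 = hor f d0 0 1.
Proof.
move=> A0 B1 cd0 per; have := goursat; rewrite A0 B1 => /(_ ler01 cd0) /eqP.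
rewrite /circ [ver f 0 _ _](_ : _ = ver f 1 c0 d0).
  by rewrite addrK subr_eq0 => /eqP.
by apply: eq_cint => r hr; rewrite add0r per.
Qed.

End GoursatTheorem.
End Goursat.

(** * Fourier coefficients *)

Section Fourier.
Variable R : realType.
Local Notation C := R[i].
Implicit Types (f g : R -> C) (a b x : R).

Lemma cpath_ex a b (k l : C) : cpath a b (fun x => ex (k * x%:C + l)).
Proof.
apply: (@cpath_comp _ (@ex R)); last by move=> x _; exact: diff_at_cont (diff_at_ex _).
apply: cpathD; last exact: cpath_cst.
by apply: cpathM; [exact: cpath_cst|exact: cpath_real].
Qed.

Lemma cpath_exZ a b (k : C) : cpath a b (fun x => ex (k * x%:C)).
Proof.
rewrite [X in cpath _ _ X](_ : _ = fun x => ex (k * x%:C + 0)); first exact: cpath_ex.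
by apply/funext => x; rewrite addr0.
Qed.

(* The integral of [ex (m z)] over a horizontal period does not depend on the height, but
   raising the height by one multiplies the integrand by a constant of modulus [<> 1]. *)
Lemma cint_ex (m : int) : cint 0 1 (fun x => ex (m%:~R * x%:C)) = (m == 0)%:R :> C.
Proof.
case: eqVneq => [->|m0].
  rewrite (@eq_cint _ _ _ _ (fun x => 1 + 0 * x%:C)); last by move=> x _; rewrite !mul0r ex0 addr0.
  by rewrite cint_affine// mul0r addr0 mul1r subr0.
pose f (z : C) := ex (m%:~R * z).
have df (s r : R) : 0 <= s <= 1 -> 0 <= r <= 1 -> diff_at f (s%:C + r%:C * 'i%C).
  move=> _ _; apply: (@diff_at_comp _ (fun z => m%:~R * z)); last exact: diff_at_ex.
  by apply: diff_atM; [exact: diff_at_cst|exact: diff_at_id].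
have := periodic_hor_eq df erefl erefl ler01; rewrite /hor.
have -> : cint 0 1 (fun s => f (s%:C + 1%:C * 'i%C)) =
    ex (m%:~R * 'i%C) * cint 0 1 (fun x => ex (m%:~R * x%:C)).
  rewrite -cintZ; last exact: cpath_exZ.
  by apply: eq_cint => s _; rewrite /f mul1r mulrDr exD mulrC.
have -> : cint 0 1 (fun s => f (s%:C + 0%:C * 'i%C)) = cint 0 1 (fun x => ex (m%:~R * x%:C)).
  by apply: eq_cint => s _; rewrite /f mul0r addr0.
have per r : 0 <= r <= 1 -> f (1 + r%:C * 'i%C) = f (r%:C * 'i%C).
  by move=> _; rewrite /f mulrDr mulr1 exD -[in X in X * _](mulr1 m%:~R) exMz ex1 exp1rz mul1r.
move=> /(_ per) /eqP; rewrite -subr_eq0 -[X in X - _]mul1r -mulrBl mulf_eq0 => /orP[|/eqP//].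
rewrite subr_eq0 => /eqP/(congr1 (@nrm R)); rewrite nrm1 nrm_ex => /esym/eqP.
rewrite -[X in _ == X]expR0 (inj_eq (@expR_inj R)) oppr_eq0 mulf_eq0 gt_eqF ?mulr_gt0 ?pi_gt0//=.
rewrite (_ : complex.Im _ = m%:~R); first by rewrite intr_eq0 (negbTE m0).
have -> : (m%:~R : C) = (m%:~R : R)%:C by rewrite rmorph_int.
by rewrite /= mul0r addr0 mulr1.
Qed.

Lemma cpath_bounded a b f : a <= b -> cpath a b f ->
  exists2 M, 0 < M & forall x, a <= x <= b -> nrm (f x) <= M.
Proof.
move=> ab cf; have [] := @EVT_max R (fun x => nrm (f x)) a b ab.
  apply: continuous_in_subspaceT => x; rewrite inE /= in_itv /= => xab.
  apply/(@cvgrPdist_lt _ _ _ (nbhs x)) => e /(cf _ xab)[d d0 hd].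
  apply/nbhs_ballP; exists d => //= y; rewrite /ball /= distrC => /hd.
  by apply: le_lt_trans; rewrite distrC nrm_dist.
move=> c _ hc; exists (nrm (f c) + 1); first by rewrite ltr_wpDl// nrm_ge0.
by move=> x xab; rewrite (le_trans (hc _ _)) ?lerDl// in_itv.
Qed.

Lemma Re_cint_ge a b f (M : R) : a <= b -> cpath a b f ->
  (forall x, a <= x <= b -> M <= complex.Re (f x)) -> M * (b - a) <= complex.Re (cint a b f).
Proof.
move=> ab cf hM; have [i1 _] := cpath_integrable cf.
have -> : complex.Re (cint a b f) =
    Rintegral lebesgue_measure `[a, b]%classic (fun x => complex.Re (f x)).
  by rewrite /cint /=; ring.
have -> : M * (b - a) = Rintegral (@lebesgue_measure R) `[a, b]%classic (fun=> M).
  rewrite Rintegral_cst//= lebesgue_measure_itv /= lte_fin.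
  by case: ltP ab => //= ba ab; rewrite (@le_anti _ _ a b) ?ab// subrr.
apply: le_Rintegral => //.
apply: integrable_of_continuous => x _ e e0; exists 1 => // y _.
by rewrite subrr normr0.
Qed.

(** On [[dl, 1 - dl]] the function [cos (pi d)] decreases from [cos (pi dl)] to its negative, so its
    square is largest at the ends. *)
Lemma cos_sqr_le (dl d : R) : 0 <= dl -> dl <= 2^-1 -> dl <= d -> d <= 1 - dl ->
  cos (pi * d) ^+ 2 <= cos (pi * dl) ^+ 2.
Proof.
move=> d0 d1 dd1 dd2; have p0 := pi_gt0 R.
have pib (y : R) : 0 <= y -> y <= 1 -> 0 <= pi * y <= pi.
  by move=> y0 y1; rewrite mulr_ge0 ?(ltW p0)//= ler_piMr// ltW.
have m (x y : R) : 0 <= x -> x <= y -> y <= 1 -> cos (pi * y) <= cos (pi * x).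
  move=> x0 xy y1; rewrite leNgt ltr_cos ?in_itv /=; first by rewrite -leNgt ler_pM2l.
    by apply: pib => //; exact: le_trans xy.
  by apply: pib => //; exact: le_trans y1.
have c0 : 0 <= cos (pi * dl).
  by rewrite -(@cos_pihalf R); apply: m => //; lra.
have h1 : cos (pi * d) <= cos (pi * dl) by apply: m; lra.
have h2 : - cos (pi * dl) <= cos (pi * d).
  have -> : - cos (pi * dl) = cos (pi * (1 - dl)).
    by rewrite mulrBr mulr1 addrC cosDpi cosN.
  by apply: m; lra.
by rewrite -[leLHS]real_normK ?num_real// ler_pXn2r ?nnegrE// ler_norml h1 h2.
Qed.

Lemma cos_sqr_lt (dl : R) : 0 < dl -> dl <= 2^-1 ->
  cos (pi * dl) ^+ 2 < cos (pi * (dl / 2)) ^+ 2.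
Proof.
move=> d0 d1; have p0 := pi_gt0 R.
have pib (y : R) : 0 <= y -> y <= 1 -> 0 <= pi * y <= pi.
  by move=> y0 y1; rewrite mulr_ge0 ?(ltW p0)//= ler_piMr// ltW.
have c0 : 0 <= cos (pi * dl).
  apply: cos_ge0_pihalf; apply/andP; split.
    by rewrite (@le_trans _ _ 0) ?oppr_le0 ?divr_ge0 ?mulr_ge0// ltW.
  by rewrite ler_pM2l.
have h : cos (pi * dl) < cos (pi * (dl / 2)).
  rewrite ltr_cos ?in_itv /=.
  - by rewrite ltr_pM2l//; lra.
  - by apply: pib; lra.
  - by apply: pib; lra.
by rewrite ltr_pXn2r ?nnegrE// ltW// (le_lt_trans c0).
Qed.

(** This is [cos^2 (pi (x - x0))] written as a trigonometric polynomial, so that multiplication by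
    it only mixes neighbouring Fourier coefficients. *)
Definition fker x0 x : C := (2 + ex (x - x0)%:C + ex (x0 - x)%:C) / 4.

Lemma fkerE x0 x : fker x0 x = (cos (pi * (x - x0)) ^+ 2)%:C.
Proof.
have e (y : R) : ex y%:C = (cos (2 * pi * y)) +i* (sin (2 * pi * y)).
  rewrite /ex /expC; set z := (_ * y%:C).
  have -> : z = 0 +i* (2 * pi * y).
    rewrite /z; apply/eqP; rewrite eq_complex /=; apply/andP; split; apply/eqP; ring.
  rewrite /= expR0; apply/eqP; rewrite eq_complex /=; apply/andP; split; apply/eqP; ring.
rewrite /fker !e -[x0 - x]opprB !mulrN cosN sinN.
have -> : 2 * pi * (x - x0) = (pi * (x - x0)) *+ 2 by rewrite mulr2n; ring.
rewrite cos_mulr2n; set c := cos _; set s := sin _.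
have -> : 2 + (c ^+ 2 *+ 2 - 1) +i* s + (c ^+ 2 *+ 2 - 1) -i* s = (4 * c ^+ 2)%:C.
  have -> : (2 : C) = 2 +i* 0 by rewrite -[RHS]/(2%:C) rmorph_nat.
  rewrite !mulr2n; apply/eqP; rewrite eq_complex /=; apply/andP; split; apply/eqP; ring.
by rewrite rmorphM /= rmorph_nat mulrC mulKf// pnatr_eq0.
Qed.

Lemma cpath_fker a b x0 : cpath a b (fker x0).
Proof.
have -> : fker x0 = fun x => (2 + ex (1 * x%:C + - x0%:C) + ex (-1 * x%:C + x0%:C)) * 4^-1.
  by apply/funext => x; rewrite /fker !rmorphB mul1r mulN1r [- _ + _]addrC.
apply: cpathM; last exact: cpath_cst.
apply: cpathD; last exact: cpath_ex.
by apply: cpathD; [exact: cpath_cst|exact: cpath_ex].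
Qed.

Lemma cpathX a b f n : cpath a b f -> cpath a b (fun x => f x ^+ n).
Proof.
move=> cf; elim: n => [|n ih].
  by rewrite [X in cpath _ _ X](_ : _ = fun=> 1); [exact: cpath_cst|apply/funext => x; rewrite expr0].
rewrite [X in cpath _ _ X](_ : _ = fun x => f x * f x ^+ n); first exact: cpathM.
by apply/funext => x; rewrite exprS.
Qed.

(** Induction on [n] for all frequencies at once: one factor of the kernel replaces the coefficient
    at [m] by a combination of those at [m - 1], [m] and [m + 1]. *)
Lemma cint_fker g x0 n (m : int) : cpath 0 1 g ->
  (forall m : int, cint 0 1 (fun x => g x * ex (m%:~R * x%:C)) = 0) ->
  cint 0 1 (fun x => g x * ex (m%:~R * x%:C) * fker x0 x ^+ n) = 0.
Proof.
move=> cg hg; elim: n m => [|n ih] m.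
  by rewrite -(hg m); apply: eq_cint => x _; rewrite mulr1.
pose G (k : int) x := g x * ex (k%:~R * x%:C) * fker x0 x ^+ n.
have cG k : cpath 0 1 (G k).
  by apply: cpathM; [apply: cpathM => //; exact: cpath_exZ|apply: cpathX; exact: cpath_fker].
rewrite (@eq_cint _ _ _ _ (fun x => 2^-1 * G m x + (ex (- x0%:C) / 4 * G (m + 1) x +
   ex x0%:C / 4 * G (m - 1) x))).
  have cZ k l : cpath 0 1 (fun x => l * G k x) := cpathM (cpath_cst l) (cG k).
  rewrite (cintD (cZ m _) (cpathD (cZ (m + 1) _) (cZ (m - 1) _))).
  rewrite (cintD (cZ (m + 1) _) (cZ (m - 1) _)) !(cintZ _ (cG _)).
  by rewrite /G !ih !mulr0 !addr0.
move=> x _; rewrite /G exprS; move: (_ ^+ n) => a6.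
have -> : fker x0 x = (2 + ex x%:C * ex (- x0%:C) + ex x0%:C * ex (- x%:C)) / 4.
  by rewrite /fker !rmorphB !exD.
rewrite !intrD mulrNz !mulr1z [(m%:~R + 1) * _]mulrDl [(m%:~R - 1) * _]mulrDl mulN1r mul1r !exD.
move: (ex (- x0%:C)) (ex x0%:C) (ex x%:C) (ex (- x%:C)) (ex (_ * _)) (g x) => b1 b2 b3 b4 b5 b0.
have id (V : fieldType) (h : (2 : V) != 0) (p a1 a2 a3 a4 a5 a7 : V) :
  p * a5 * ((2 + a3 * a1 + a2 * a4) / 4 * a7) =
  2^-1 * (p * a5 * a7) + (a1 / 4 * (p * (a5 * a3) * a7) + a2 / 4 * (p * (a5 * a4) * a7)).
  field; rewrite h (_ : 4 = 2 * 2 :> V); first by rewrite mulf_neq0.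
  by ring.
apply: id; by rewrite pnatr_eq0.
Qed.

(* Tested against the powers of the kernel [cos^2 (pi (x - x0))], which concentrate at [x0]. *)
Theorem fourier_unique g x0 : cpath 0 1 g -> 0 < x0 < 1 ->
  (forall m : int, cint 0 1 (fun x => g x * ex (m%:~R * x%:C)) = 0) -> g x0 = 0.
Proof.
move=> cg /andP[x00 x01] hg; apply/eqP/negPn/negP => gx0.
(* The conjugate factor makes the value at [x0] equal to [|g x0|^2], so real parts are enough. *)
pose G x := (g x0)^*%C * g x.
have cG : cpath 0 1 G by apply: cpathM => //; exact: cpath_cst.
have G0 : 0 < complex.Re (G x0).
  move: gx0; rewrite /G; case: (g x0) => u v /=; rewrite eq_complex /= negb_and.
  move=> h; rewrite mulNr opprK -!expr2; case/orP: h => h.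
    by rewrite ltr_pwDl ?sqr_ge0// exprn_even_gt0.
  by rewrite ltr_wpDl ?sqr_ge0// exprn_even_gt0.
set eta := complex.Re (G x0) / 2; have eta0 : 0 < eta by rewrite divr_gt0.
have x0i : 0 <= x0 <= 1 by rewrite !ltW.
have [d d0 hd] := cG _ x0i _ eta0.
(* The bound [d / 2] keeps the interval of radius [dl] strictly within the range of continuity, the
   bounds [x0] and [1 - x0] keep it inside [[0, 1]], and [1/2] makes [cos (pi dl)] nonnegative. *)
pose dl := Num.min (d / 2) (Num.min (Num.min x0 (1 - x0)) 2^-1).
have : dl <= d / 2 /\ dl <= x0 /\ dl <= 1 - x0 /\ dl <= 2^-1.
  by rewrite /dl !ge_min !lexx /= !orbT.
have : 0 < dl by rewrite !lt_min divr_gt0// x00 subr_gt0 x01 invr_gt0 ltr0n.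
move: dl => dl dl0 [dl1 [dl2 [dl3 dl4]]].
have near x : `|x - x0| <= dl -> eta <= complex.Re (G x).
  move=> xd; have : `|x - x0| < d by lra.
  move=> /hd h; have := norm_Re_le (G x - G x0); rewrite raddfB => /le_lt_trans/(_ h).
  rewrite ltr_norml => /andP[h1 _]; move: h1; rewrite /eta /=; lra.
have [M M0 hM] := cpath_bounded ler01 cG.
have [k1 k1E] : exists k, k = cos (pi * dl) ^+ 2 by eexists.
have [k2 k2E] : exists k, k = cos (pi * (dl / 2)) ^+ 2 by eexists.
have k12 : k1 < k2 by rewrite k1E k2E; exact: cos_sqr_lt.
have k10 : 0 <= k1 by rewrite k1E; exact: sqr_ge0.
have k20 : 0 < k2 by exact: le_lt_trans k12.
pose K x := cos (pi * (x - x0)) ^+ 2.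
have K0 x : 0 <= K x by exact: sqr_ge0.
have KN x : K x = cos (pi * `|x - x0|) ^+ 2.
  rewrite /K; have [h|h] := leP 0 (x - x0); first by rewrite ger0_norm.
  by rewrite ltr0_norm// mulrN cosN.
have far x : 0 <= x <= 1 -> dl <= `|x - x0| -> K x <= k1.
  move=> /andP[h1 h2] h; rewrite KN k1E; apply: cos_sqr_le => //; first exact: ltW.
  by rewrite ler_norml; lra.
have close x : `|x - x0| <= dl / 2 -> k2 <= K x.
  by move=> h; rewrite KN k2E; apply: cos_sqr_le => //; lra.
pose F n x := G x * fker x0 x ^+ n.
have cF n a b : 0 <= a -> b <= 1 -> cpath a b (F n).
  move=> h1 h2; apply: cpath_sub h1 h2 _; apply: cpathM => //.
  by apply: cpathX; exact: cpath_fker.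
have ReF n x : complex.Re (F n x) = complex.Re (G x) * K x ^+ n.
  by rewrite /F fkerE -rmorphXn /=; case: (G x) => u v /=; rewrite mulr0 subr0.
have IF n : cint 0 1 (F n) = 0.
  rewrite (@eq_cint _ _ _ _ (fun x => (g x0)^*%C * (g x * ex (0%:~R * x%:C) * fker x0 x ^+ n))).
    rewrite cintZ; first by rewrite cint_fker// mulr0.
    apply: cpathM; last by apply: cpathX; exact: cpath_fker.
    by apply: cpathM => //; exact: cpath_exZ.
  by move=> x _; rewrite /F /G mul0r ex0 mulr1 !mulrA.
have low n x : 0 <= x <= 1 -> - (M * k1 ^+ n) <= complex.Re (F n x).
  move=> xi; rewrite ReF; have [h|h] := leP (`|x - x0|) dl.
    apply: (@le_trans _ _ 0); first by rewrite oppr_le0 mulr_ge0 ?(ltW M0)// exprn_ge0.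
    apply: mulr_ge0; last exact: exprn_ge0.
    exact: le_trans (ltW eta0) (near _ h).
  have := le_trans (norm_Re_le (G x)) (hM _ xi); rewrite ler_norml => /andP[h1 _].
  have h2 : K x ^+ n <= k1 ^+ n by rewrite lerXn2r ?nnegrE ?far// ltW.
  have := exprn_ge0 n (K0 x); have := exprn_ge0 n k10; nra.
(* The total integral is zero, so the gain [eta * k2 ^ n] on the interval of length [dl] around [x0]
   cannot exceed the loss [M * k1 ^ n] elsewhere; as [k1 < k2], this fails for large [n]. *)
have key n : eta * k2 ^+ n * dl <= M * k1 ^+ n.
  have i1 : 0 <= x0 - dl / 2 by lra.
  have i2 : x0 - dl / 2 <= x0 + dl / 2 by lra.
  have i3 : x0 + dl / 2 <= 1 by lra.
  have := IF n; rewrite (@cint_chasles _ 0 (x0 - dl / 2))//; [|lra|exact: cF].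
  rewrite (@cint_chasles _ (x0 - dl / 2) (x0 + dl / 2))//; last exact: cF.
  move=> /(congr1 (@complex.Re R)) e.
  have {}e : complex.Re (cint 0 (x0 - dl / 2) (F n)) +
    (complex.Re (cint (x0 - dl / 2) (x0 + dl / 2) (F n)) +
     complex.Re (cint (x0 + dl / 2) 1 (F n))) = 0 by rewrite -!raddfD.
  have J1 := @Re_cint_ge 0 (x0 - dl / 2) (F n) (- (M * k1 ^+ n)) i1.
  have J2 := @Re_cint_ge (x0 - dl / 2) (x0 + dl / 2) (F n) (eta * k2 ^+ n) i2.
  have J3 := @Re_cint_ge (x0 + dl / 2) 1 (F n) (- (M * k1 ^+ n)) i3.
  have {}J1 : - (M * k1 ^+ n) * (x0 - dl / 2 - 0) <= complex.Re (cint 0 (x0 - dl / 2) (F n)).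
    apply: J1; first by apply: cF => //; lra.
    by move=> x xi; apply: low; lra.
  have {}J3 : - (M * k1 ^+ n) * (1 - (x0 + dl / 2)) <= complex.Re (cint (x0 + dl / 2) 1 (F n)).
    apply: J3; first by apply: cF => //; lra.
    by move=> x xi; apply: low; lra.
  have {}J2 : eta * k2 ^+ n * (x0 + dl / 2 - (x0 - dl / 2)) <=
      complex.Re (cint (x0 - dl / 2) (x0 + dl / 2) (F n)).
    apply: J2; first by apply: cF.
    move=> x xi; rewrite ReF; have xd : `|x - x0| <= dl / 2 by rewrite ler_norml; lra.
    have nx : eta <= complex.Re (G x) by apply: near; lra.
    have Kx : k2 ^+ n <= K x ^+ n by rewrite lerXn2r ?nnegrE ?(ltW k20)// close.
    by apply: ler_pM => //; [exact: ltW|exact/exprn_ge0/ltW].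
  have Mk : 0 <= M * k1 ^+ n * dl by exact: mulr_ge0 (mulr_ge0 (ltW M0) (exprn_ge0 n k10)) (ltW dl0).
  move: J1 J2 J3 e Mk; move: (M * k1 ^+ n) (eta * k2 ^+ n) => m w.
  move: (complex.Re _) (complex.Re _) (complex.Re _) => *; lra.
pose r := k1 / k2.
have r1 : `|r| < 1 by rewrite ger0_norm ?divr_ge0 ?(ltW k20)// ltr_pdivrMr// mul1r.
have : ((fun n => M * r ^+ n) @ \oo --> M * 0)%classic.
  by apply: cvgM; [exact: cvg_cst|exact: cvg_expr].
have ed0 : 0 < eta * dl by rewrite mulr_gt0.
rewrite mulr0 => /cvgrPdist_lt/(_ _ ed0)[N _ hN].
have := hN N (leqnn _); rewrite /= sub0r normrN => /(le_lt_trans (ler_norm _)).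
have kN : 0 < k2 ^+ N by rewrite exprn_gt0.
rewrite -(ltr_pM2r kN) /r expr_div_n mulrA mulfVK ?gt_eqF// => /lt_le_trans/(_ (lexx _)).
by rewrite mulrAC => /lt_le_trans; move: (key N) => /[swap]/[apply]; rewrite ltxx.
Qed.

End Fourier.

(** * Power series and Laurent series *)

Section Series.
Variable R : realType.
Local Notation C := R[i].
Implicit Types (a b : nat -> C) (K th : R).

(** The intervals of radius [K / (1 - th) * th ^ N] around the partial sums are nested, because the
    radius drops by exactly [K * th ^ N] at step [N]; their common point is the sum. *)
Lemma real_geometric_sum (x : nat -> R) K th : 0 <= th < 1 ->
  (forall n, `|x n| <= K * th ^+ n) ->
  exists s, forall N, `|s - \sum_(n < N) x n| <= K / (1 - th) * th ^+ N.
Proof.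
move=> /andP[th0 th1] hx; have d0 : 0 < 1 - th by rewrite subr_gt0.
have K0 : 0 <= K by have := hx 0%N; rewrite expr0 mulr1; exact: le_trans.
pose t N := K / (1 - th) * th ^+ N.
have t0 N : 0 <= t N by rewrite /t mulr_ge0 ?exprn_ge0 ?divr_ge0 ?(ltW d0).
have tS N : t N = t N.+1 + K * th ^+ N by rewrite /t exprS; field; rewrite gt_eqF.
have [| | |s hs] := @nested_segments R (fun N => \sum_(n < N) x n - t N) (fun N => \sum_(n < N) x n + t N).
- move=> N; have := hx N; rewrite big_ord_recr /= ler_norml => /andP[h1 h2]; have := tS N; lra.
- move=> N; have := hx N; rewrite big_ord_recr /= ler_norml => /andP[h1 h2]; have := tS N; lra.
- by move=> N; have := t0 N; lra.
by exists s => N; have /andP[h1 h2] := hs N; rewrite ler_norml -/(t N); lra.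
Qed.

(** Convergence at a geometric rate: stable under sums, scalings and shifts, and sufficient to
    determine the limit. *)
Definition converges a S := exists K th, 0 <= th < 1 /\
  forall N, nrm (S - \sum_(n < N) a n) <= K * th ^+ N.

Lemma geometric_sum a K th : 0 <= th < 1 -> (forall n, nrm (a n) <= K * th ^+ n) ->
  exists s, forall N, nrm (s - \sum_(n < N) a n) <= 2 * K / (1 - th) * th ^+ N.
Proof.
move=> ht ha.
have [s1 h1] := @real_geometric_sum (fun n => complex.Re (a n)) K th ht
  (fun n => le_trans (norm_Re_le _) (ha n)).
have [s2 h2] := @real_geometric_sum (fun n => complex.Im (a n)) K th ht
  (fun n => le_trans (norm_Im_le _) (ha n)).
exists (s1 +i* s2) => N; rewrite (le_trans (nrm_le_ReIm _))//.
have -> : complex.Re (s1 +i* s2 - \sum_(n < N) a n) = s1 - \sum_(n < N) complex.Re (a n).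
  by rewrite raddfB raddf_sum.
have -> : complex.Im (s1 +i* s2 - \sum_(n < N) a n) = s2 - \sum_(n < N) complex.Im (a n).
  by rewrite raddfB raddf_sum.
by have := lerD (h1 N) (h2 N); lra.
Qed.

Lemma cvg0_eq0 (x : R) K th : 0 <= th < 1 -> 0 <= x -> (forall N, x <= K * th ^+ N) -> x = 0.
Proof.
move=> /andP[th0 th1] x0 h; apply/eqP; rewrite eq_le x0 andbT leNgt; apply/negP => {}x0.
have : ((fun N => K * th ^+ N) @ \oo --> K * 0)%classic.
  by apply: cvgM; [exact: cvg_cst|apply: cvg_expr; rewrite ger0_norm].
rewrite mulr0 => /cvgrPdist_lt/(_ _ x0)[N _ /(_ N (leqnn _))].
by rewrite /= sub0r normrN => /(le_lt_trans (ler_norm _))/(le_lt_trans (h N)); rewrite ltxx.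
Qed.

Lemma converges_unique a S S' : converges a S -> converges a S' -> S = S'.
Proof.
move=> [K [th [/andP[th0 th1] h]]] [K' [th' [/andP[th'0 th'1] h']]].
have mx : 0 <= Num.max th th' < 1 by rewrite le_max th0 gt_max th1.
have m0 : 0 <= Num.max th th' by rewrite le_max th0.
have K0 : 0 <= K by have := h 0%N; rewrite expr0 mulr1; apply: le_trans; exact: nrm_ge0.
have K'0 : 0 <= K' by have := h' 0%N; rewrite expr0 mulr1; apply: le_trans; exact: nrm_ge0.
apply/eqP; rewrite -subr_eq0 -nrm_eq0; apply/eqP; apply: (@cvg0_eq0 _ (K + K') _ mx (nrm_ge0 _)).
move=> N; have -> : S - S' = (S - \sum_(n < N) a n) - (S' - \sum_(n < N) a n).
  by rewrite opprB addrA subrK.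
rewrite (le_trans (nrmD _ _))// nrmN mulrDl lerD//.
  by rewrite (le_trans (h N))// ler_wpM2l// lerXn2r ?nnegrE// le_max lexx.
by rewrite (le_trans (h' N))// ler_wpM2l// lerXn2r ?nnegrE// le_max lexx orbT.
Qed.

(** The limit is selected by choice, with default [0] when there is no geometric convergence;
    [csumP] identifies it. *)
Definition csum a : C := xget 0 [set S | converges a S]%classic.

Lemma csumP a S : converges a S -> csum a = S.
Proof. by move=> h; apply: converges_unique (h); exact: xgetPex (ex_intro _ S h). Qed.

Lemma csum_bound a K th : 0 <= th < 1 -> (forall n, nrm (a n) <= K * th ^+ n) ->
  converges a (csum a) /\
  forall N, nrm (csum a - \sum_(n < N) a n) <= 2 * K / (1 - th) * th ^+ N.
Proof.
move=> ht ha; have [s hs] := geometric_sum ht ha.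
have cs : converges a s by exists (2 * K / (1 - th)), th.
by rewrite (csumP cs).
Qed.

Lemma convergesD a b S S' : converges a S -> converges b S' ->
  converges (fun n => a n + b n) (S + S').
Proof.
move=> [K [th [/andP[th0 th1] h]]] [K' [th' [/andP[th'0 th'1] h']]].
have m0 : 0 <= Num.max th th' by rewrite le_max th0.
have K0 : 0 <= K by have := h 0%N; rewrite expr0 mulr1; apply: le_trans; exact: nrm_ge0.
have K'0 : 0 <= K' by have := h' 0%N; rewrite expr0 mulr1; apply: le_trans; exact: nrm_ge0.
exists (K + K'), (Num.max th th'); split; first by rewrite m0 gt_max th1.
move=> N; rewrite big_split /= opprD addrACA.
rewrite (le_trans (nrmD _ _))// mulrDl lerD//.
  by rewrite (le_trans (h N))// ler_wpM2l// lerXn2r ?nnegrE// le_max lexx.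
by rewrite (le_trans (h' N))// ler_wpM2l// lerXn2r ?nnegrE// le_max lexx orbT.
Qed.

Lemma convergesZ a (k : C) S : converges a S -> converges (fun n => k * a n) (k * S).
Proof.
move=> [K [th [ht h]]]; exists (nrm k * K), th; split => // N.
by rewrite -mulr_sumr -mulrBr nrmM -mulrA ler_wpM2l// nrm_ge0.
Qed.

Lemma converges_cons a S : converges a S -> converges (fun n => a n.+1) (S - a 0%N).
Proof.
move=> [K [th [/andP[th0 th1] h]]]; exists (K * th), th; split; first by rewrite th0.
move=> N; have := h N.+1; rewrite big_ord_recl /= exprS mulrA; apply: le_trans.
by rewrite opprD addrA.
Qed.

Definition pser a (z : C) := csum (fun n => a n * z ^+ n).

Lemma pser_bound a K s (z : C) : 0 <= s -> (forall n, nrm (a n) <= K * s ^+ n) -> s * nrm z < 1 ->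
  converges (fun n => a n * z ^+ n) (pser a z) /\
  forall N, nrm (pser a z - \sum_(n < N) a n * z ^+ n) <=
    2 * K / (1 - s * nrm z) * (s * nrm z) ^+ N.
Proof.
move=> s0 ha sz; apply: csum_bound; first by rewrite sz mulr_ge0// nrm_ge0.
by move=> n; rewrite nrmM nrmX exprMn mulrA ler_wpM2r// exprn_ge0// nrm_ge0.
Qed.

Lemma pser_cons a K s (z : C) : 0 <= s -> (forall n, nrm (a n) <= K * s ^+ n) -> s * nrm z < 1 ->
  pser a z = a 0%N + z * pser (fun n => a n.+1) z.
Proof.
move=> s0 ha sz; have [/converges_cons h _] := pser_bound s0 ha sz.
have ha' n : nrm (a n.+1) <= (K * s) * s ^+ n by rewrite -mulrA -exprS.
have [/(convergesZ z) h' _] := pser_bound s0 ha' sz.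
apply/eqP; rewrite addrC -subr_eq eq_sym; apply/eqP.
rewrite [a 0%N](_ : _ = a 0%N * z ^+ 0); last by rewrite mulr1.
apply: converges_unique h' _; move: h; congr (converges _ _); apply/funext => n.
by rewrite exprS mulrCA.
Qed.

Lemma nat_le_expr (rho : R) n : 1 < rho -> n%:R <= rho ^+ n / (rho - 1).
Proof.
move=> r1; have d0 : 0 < rho - 1 by rewrite subr_gt0.
rewrite ler_pdivlMr//; elim: n => [|n ih]; first by rewrite mul0r expr0 ler01.
rewrite -natr1 exprS; have : 1 <= rho ^+ n by rewrite exprn_ege1// ltW.
by move: ih; move: (rho ^+ n) (n%:R) => x y; nra.
Qed.

(** Caratheodory's slope is the sum of [a n * q y n], where [q y n] is the divided difference of the
    [n]-th power. Its continuity at [z] follows from a bound on [q y n - q z n] that is proportional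
    to [|y - z|] and still summable against [a n]. *)
Lemma pser_diff a K s (z : C) : 0 < s -> (forall n, nrm (a n) <= K * s ^+ n) -> s * nrm z < 1 ->
  diff_at (pser a) z.
Proof.
move=> s0 ha sz.
have K0 : 0 <= K by have := ha 0%N; rewrite expr0 mulr1; apply: le_trans; exact: nrm_ge0.
have [r [zr sr]] : exists r, nrm z < r /\ s * r < 1.
  exists ((nrm z + s^-1) / 2); have : nrm z < s^-1 by rewrite -[s^-1]mul1r ltr_pdivlMr// mulrC.
  move=> h; split; first by lra.
  by rewrite mulrC -ltr_pdivlMr// div1r; lra.
have r0 : 0 < r by exact: le_lt_trans (nrm_ge0 z) zr.
(* The bounds on the divided differences carry factors [n] and [n^2]. They are absorbed by powers of
   [rho > 1] through [n <= rho ^ n / (rho - 1)], while [s * r * rho^2] stays below [1]. *)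
have [rho [rho1 srr]] : exists rho, 1 < rho /\ s * r * (rho * rho) < 1.
  have p0 : 0 < s * r by rewrite mulr_gt0.
  exists (1 + (1 - s * r) / 3); split; first by lra.
  by move: p0 sr; move: (s * r) => p p0 p1; nra.
have rho0 : 0 < rho by exact: lt_trans rho1.
have d0 : 0 < rho - 1 by rewrite subr_gt0.
pose q y n : C := \sum_(i < n) y ^+ (n.-1 - i) * z ^+ i.
have qE y n : y ^+ n - z ^+ n = (y - z) * q y n by exact: subrXX.
have qS y n : q y n.+1 = y ^+ n + z * q y n.
  have [->|yz] := eqVneq y z.
    rewrite /q big_ord_recl /= subn0 expr0 mulr1 mulr_sumr; congr (_ + _).
    case: n => [|n]; first by rewrite !big_ord0.
    apply: eq_bigr => i _; rewrite /bump /= add1n exprS mulrCA; congr (_ * (_ ^+ _ * _)).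
  have yz0 : y - z != 0 by rewrite subr_eq0.
  by apply: (mulfI yz0); rewrite mulrDr mulrCA -!qE !exprS; ring.
have qb y n : nrm y <= r -> nrm (q y n) <= n%:R * r ^+ n / r.
  move=> yr; elim: n => [|n ih]; first by rewrite /q big_ord0 nrm0 !mul0r.
  rewrite qS (le_trans (nrmD _ _))// nrmX nrmM.
  have h1 : nrm y ^+ n <= r ^+ n by rewrite lerXn2r ?nnegrE ?nrm_ge0// ltW.
  have h2 : nrm z * nrm (q y n) <= r * (n%:R * r ^+ n / r) by rewrite ler_pM ?nrm_ge0// ltW.
  rewrite (le_trans (lerD h1 h2))// -natr1 exprS.
  by rewrite le_eqVlt; apply/orP; left; apply/eqP; field; rewrite gt_eqF.
have sb y n : nrm y <= r -> nrm (q y n - q z n) <= nrm (y - z) * (n%:R ^+ 2 * r ^+ n / r ^+ 2).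
  move=> yr; elim: n => [|n ih]; first by rewrite /q !big_ord0 subrr nrm0 expr0n !mul0r mulr0.
  rewrite !qS opprD addrACA -mulrBr qE (le_trans (nrmD _ _))// !nrmM.
  have h1 : nrm (y - z) * nrm (q y n) <= nrm (y - z) * (n%:R * r ^+ n / r).
    by rewrite ler_wpM2l ?nrm_ge0// qb.
  have h2 : nrm z * nrm (q y n - q z n) <= r * (nrm (y - z) * (n%:R ^+ 2 * r ^+ n / r ^+ 2)).
    by rewrite ler_pM ?nrm_ge0// ltW.
  rewrite (le_trans (lerD h1 h2))//.
  have -> : nrm (y - z) * (n%:R * r ^+ n / r) + r * (nrm (y - z) * (n%:R ^+ 2 * r ^+ n / r ^+ 2)) =
     nrm (y - z) * ((n%:R + n%:R ^+ 2) * (r ^+ n / r)) by field; rewrite gt_eqF.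
  have -> : n.+1%:R ^+ 2 * r ^+ n.+1 / r ^+ 2 = (n%:R + 1) ^+ 2 * (r ^+ n / r).
    by rewrite -natr1 (exprS r); field; rewrite gt_eqF.
  rewrite ler_wpM2l ?nrm_ge0// ler_wpM2r ?divr_ge0 ?exprn_ge0 ?(ltW r0)//.
  by have := ler0n R n; nra.
set th := s * r * (rho * rho) in srr.
have th0 : 0 < th by rewrite !mulr_gt0.
have ht : 0 <= th < 1 by rewrite srr ltW.
have thE n : s ^+ n * (rho ^+ n * rho ^+ n * r ^+ n) = th ^+ n by rewrite /th !exprMn; ring.
pose K1 := K / (r * (rho - 1)); pose K2 := K / (r * (rho - 1)) ^+ 2.
have K20 : 0 <= K2 by rewrite divr_ge0// sqr_ge0.
have rn n : 1 <= rho ^+ n by rewrite exprn_ege1// ltW.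
have b1 y n : nrm y <= r -> nrm (a n * q y n) <= K1 * th ^+ n.
  move=> yr; rewrite nrmM.
  have h1 : nrm (q y n) <= rho ^+ n * rho ^+ n / (rho - 1) * r ^+ n / r.
    rewrite (le_trans (qb _ _ yr))// !ler_wpM2r ?invr_ge0 ?exprn_ge0 ?(ltW r0)//.
    rewrite (le_trans (nat_le_expr n rho1))// ler_wpM2r ?invr_ge0 ?(ltW d0)//.
    by rewrite ler_peMl ?exprn_ge0// ltW.
  rewrite (le_trans (ler_pM (nrm_ge0 _) (nrm_ge0 _) (ha n) h1))// -thE /K1.
  by rewrite le_eqVlt; apply/orP; left; apply/eqP; field; rewrite !gt_eqF.
have b2 y n : nrm y <= r -> nrm (a n * q y n + -1 * (a n * q z n)) <= (nrm (y - z) * K2) * th ^+ n.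
  move=> yr; rewrite mulN1r -mulrBr nrmM.
  have h1 : nrm (q y n - q z n) <=
      nrm (y - z) * ((rho ^+ n / (rho - 1)) ^+ 2 * r ^+ n / r ^+ 2).
    rewrite (le_trans (sb _ _ yr))// ler_wpM2l ?nrm_ge0// !ler_wpM2r ?invr_ge0 ?exprn_ge0 ?(ltW r0)//.
    by rewrite lerXn2r ?nnegrE ?ler0n ?nat_le_expr// divr_ge0 ?exprn_ge0// ltW.
  rewrite (le_trans (ler_pM (nrm_ge0 _) (nrm_ge0 _) (ha n) h1))// -thE /K2.
  by rewrite le_eqVlt; apply/orP; left; apply/eqP; field; rewrite !gt_eqF.
pose phi0 y := csum (fun n => a n * q y n).
have c1 y : nrm y <= r -> converges (fun n => a n * q y n) (phi0 y).
  by move=> yr; have [] := csum_bound ht (b1 y ^~ yr).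
(* Outside the disc of radius [r] the series of slopes is not controlled, so the plain difference
   quotient is taken there; [nrm z < r] keeps such [y] away from [z]. *)
pose phi y := if nrm y <= r then phi0 y else (pser a y - pser a z) / (y - z).
have zr' : nrm z <= r by rewrite ltW.
have cphi : cont_at phi z.
  pose B := 2 * K2 / (1 - th).
  have B0 : 0 <= B by apply: divr_ge0; [exact: mulr_ge0|rewrite subr_ge0 ltW].
  apply/cont_atR => e e0; exists (Num.min (r - nrm z) (e / (B + 1))).
    by rewrite lt_min subr_gt0 zr divr_gt0// ltr_wpDl.
  move=> y; rewrite lt_min => /andP[y1 y2].
  have yr : nrm y <= r.
    rewrite -[y](subrK z) (le_trans (nrmD _ _))//; move: y1; rewrite ltrBrDr; exact: ltW.
  rewrite /phi yr zr'.
  have cd := convergesD (c1 _ yr) (convergesZ (-1) (c1 _ zr')).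
  have [_ /(_ 0%N)] := csum_bound ht (b2 y ^~ yr).
  rewrite (csumP cd) big_ord0 subr0 mulN1r expr0 mulr1 => h.
  rewrite (le_lt_trans h)//; move: y2; rewrite ltr_pdivlMr ?ltr_wpDl// => y2.
  rewrite (le_lt_trans _ y2)// (_ : 2 * _ / _ = nrm (y - z) * B); last by rewrite /B; ring.
  by rewrite ler_wpM2l ?nrm_ge0// lerDl.
apply/diff_atP; exists phi => // y; rewrite /phi; case: ifPn => [yr|yr]; last first.
  rewrite divfK; first by rewrite addrC subrK.
  by rewrite subr_eq0; apply: contraNneq yr => ->.
have sy : s * nrm y < 1 by rewrite (le_lt_trans _ sr)// ler_pM2l.
have [cy _] := pser_bound (ltW s0) ha sy; have [cz _] := pser_bound (ltW s0) ha sz.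
apply: (converges_unique cy); rewrite mulrC.
have := convergesD cz (convergesZ (y - z) (c1 _ yr)); congr (converges _ _).
by apply/funext => n; rewrite mulrCA -qE mulrBr addrC subrK.
Qed.

End Series.

(** * Two-sided series in [e(x)] with geometrically decaying coefficients *)

Section LaurentSeries.
Variable R : realType.
Local Notation C := R[i].
Implicit Types (b : int -> C) (s : R).

Definition gbound b s := exists K : R, forall m, nrm (b m) <= K * s ^+ `|m|%N.

(** The sum of [b m e(m x)] over all integers [m]. As [Negz n] is [-(n + 1)], the negative half
    carries an extra factor [ex (- x)]. *)
Definition lser b (x : C) : C :=
  pser (fun n => b (Posz n)) (ex x) + ex (- x) * pser (fun n => b (Negz n)) (ex (- x)).

Lemma eq_lser b b' x : (forall m, b m = b' m) -> lser b x = lser b' x.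
Proof. by move=> e; have -> : b = b' by apply/funext. Qed.

(** The domain of convergence for coefficients of size [s ^ |m|]: an annulus for [ex x], hence a
    horizontal strip for [x]. *)
Definition annulus s x := s * nrm (ex x) < 1 /\ s * nrm (ex (- x)) < 1.

Lemma gbound_pos b s : gbound b s -> exists K : R, forall n, nrm (b (Posz n)) <= K * s ^+ n.
Proof. by move=> [K hK]; exists K => n; exact: hK. Qed.

Lemma gbound_neg b s : gbound b s -> exists K : R, forall n, nrm (b (Negz n)) <= K * s ^+ n.
Proof. by move=> [K hK]; exists (K * s) => n; rewrite -mulrA -exprS; exact: hK. Qed.

Lemma gbound_ge0 b s : gbound b s -> exists2 K : R, 0 <= K & forall m, nrm (b m) <= K * s ^+ `|m|%N.
Proof.
move=> [K hK]; exists K => //; have := hK 0; rewrite mulr1; apply: le_trans; exact: nrm_ge0.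
Qed.

Lemma gboundZ b s (k : C) : gbound b s -> gbound (fun m => k * b m) s.
Proof. by move=> [K hK]; exists (nrm k * K) => m; rewrite nrmM -mulrA ler_wpM2l ?nrm_ge0. Qed.

Lemma gboundD b b' s : gbound b s -> gbound b' s -> gbound (fun m => b m + b' m) s.
Proof.
move=> [K hK] [K' hK']; exists (K + K') => m.
by rewrite (le_trans (nrmD _ _))// mulrDl lerD.
Qed.

Lemma gbound_shift b s (k : int) : 0 < s -> s <= 1 -> gbound b s -> gbound (fun m => b (m - k)) s.
Proof.
move=> s0 s1 /gbound_ge0[K K0 hK]; exists (K / s ^+ `|k|%N) => m.
rewrite (le_trans (hK _))// -mulrA ler_wpM2l// mulrC ler_pdivlMr ?exprn_gt0// -exprD.
by apply: ler_wiXn2l; rewrite ?(ltW s0)//; lia.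
Qed.

Lemma gbound_sum (I : Type) (r : seq I) (B : I -> int -> C) s : 0 <= s -> (forall i, gbound (B i) s) ->
  gbound (fun m => \sum_(i <- r) B i m) s.
Proof.
move=> s0 hB; elim: r => [|i r [K hK]].
  by exists 0 => m; rewrite big_nil nrm0 mul0r.
have [K' hK'] := hB i; exists (K' + K) => m.
by rewrite big_cons (le_trans (nrmD _ _))// mulrDl lerD.
Qed.

Lemma lser_conv b s x : 0 < s -> gbound b s -> annulus s x ->
  converges (fun n => b (Posz n) * ex x ^+ n) (pser (fun n => b (Posz n)) (ex x)) /\
  converges (fun n => b (Negz n) * ex (- x) ^+ n) (pser (fun n => b (Negz n)) (ex (- x))).
Proof.
move=> s0 hb [h1 h2]; have [K hK] := gbound_pos hb; have [K' hK'] := gbound_neg hb.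
by split; [have [] := pser_bound (ltW s0) hK h1|have [] := pser_bound (ltW s0) hK' h2].
Qed.

Lemma lserD b b' s x : 0 < s -> gbound b s -> gbound b' s -> annulus s x ->
  lser (fun m => b m + b' m) x = lser b x + lser b' x.
Proof.
move=> s0 hb hb' hx; have [c1 c2] := lser_conv s0 hb hx; have [c1' c2'] := lser_conv s0 hb' hx.
have [d1 d2] := lser_conv s0 (gboundD hb hb') hx.
have e1 := converges_unique d1; have e2 := converges_unique d2.
rewrite /lser (e1 (pser (fun n => b (Posz n)) (ex x) + pser (fun n => b' (Posz n)) (ex x))); last first.
  by have := convergesD c1 c1'; congr converges; apply/funext => n; rewrite mulrDl.
rewrite (e2 (pser (fun n => b (Negz n)) (ex (- x)) + pser (fun n => b' (Negz n)) (ex (- x)))).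
  by rewrite mulrDr addrACA.
by have := convergesD c2 c2'; congr converges; apply/funext => n; rewrite mulrDl.
Qed.

Lemma lserZ b s (k : C) x : 0 < s -> gbound b s -> annulus s x ->
  lser (fun m => k * b m) x = k * lser b x.
Proof.
move=> s0 hb hx; have [c1 c2] := lser_conv s0 hb hx.
have [d1 d2] := lser_conv s0 (gboundZ k hb) hx.
have e1 := converges_unique d1; have e2 := converges_unique d2.
rewrite /lser (e1 (k * pser (fun n => b (Posz n)) (ex x))); last first.
  by have := convergesZ k c1; congr converges; apply/funext => n; rewrite mulrA.
rewrite (e2 (k * pser (fun n => b (Negz n)) (ex (- x)))); first by rewrite mulrCA -mulrDr.
by have := convergesZ k c2; congr converges; apply/funext => n; rewrite mulrA.
Qed.

Lemma lser_sum (I : Type) (r : seq I) (B : I -> int -> C) s x : 0 < s -> (forall i, gbound (B i) s) ->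
  annulus s x -> lser (fun m => \sum_(i <- r) B i m) x = \sum_(i <- r) lser (B i) x.
Proof.
move=> s0 hB hx; elim: r => [|i r ih].
  have h0 : gbound (fun=> 0) s by exists 0 => m; rewrite nrm0 mul0r.
  rewrite big_nil; transitivity (0 * lser (fun=> 0) x); last by rewrite mul0r.
  rewrite -(lserZ _ s0 h0 hx).
  by apply: eq_lser => m; rewrite big_nil mul0r.
rewrite big_cons -ih -(lserD s0 (hB i) (gbound_sum r (ltW s0) hB) hx).
by apply: eq_lser => m; rewrite big_cons.
Qed.

(** The shift moves the single term [b (-1)] from the negative half to the nonnegative one;
    [pser_cons] splits it off on either side. *)
Lemma lser_shift1 b s x : 0 < s -> s <= 1 -> gbound b s -> annulus s x ->
  lser (fun m => b (m - 1)) x = ex x * lser b x.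
Proof.
move=> s0 s1 hb [h1 h2].
have hb' := gbound_shift 1 s0 s1 hb.
have [K hK] := gbound_pos hb'; have [K' hK'] := gbound_neg hb.
rewrite /lser (pser_cons (ltW s0) hK h1) [X in ex x * (_ + _ * X)](pser_cons (ltW s0) hK' h2).
rewrite (_ : (fun n => b (Posz n.+1 - 1)) = fun n => b (Posz n)); last first.
  by apply/funext => n; congr b; lia.
rewrite (_ : (fun n => b (Negz n - 1)) = fun n => b (Negz n.+1)); last first.
  by apply/funext => n; congr b; lia.
rewrite (_ : Posz 0 - 1 = Negz 0)//.
by rewrite mulrDr mulrA -exD subrr ex0 mul1r addrCA addrA addrC; congr (_ + _).
Qed.

Lemma lser_shift b s (k : int) x : 0 < s -> s <= 1 -> gbound b s -> annulus s x ->
  lser (fun m => b (m - k)) x = ex (k%:~R * x) * lser b x.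
Proof.
move=> s0 s1; have pos (n : nat) b' : gbound b' s -> annulus s x ->
    lser (fun m => b' (m - Posz n)) x = ex (n%:R * x) * lser b' x.
  move=> hb hx; elim: n => [|n ih].
    rewrite mul0r ex0 mul1r; apply: eq_lser => m; by rewrite subr0.
  rewrite -natr1 mulrDl mul1r addrC exD -mulrA -ih -(lser_shift1 s0 s1 _ hx).
    by apply: eq_lser => m; congr b'; lia.
  exact: gbound_shift.
case: k => n hb hx; first exact: pos.
have hb' : gbound (fun m => b (m - Negz n)) s by exact: gbound_shift.
have := pos n.+1 _ hb' hx.
rewrite [X in lser X _ = _](_ : _ = b); last by apply/funext => m; congr b; lia.
by move=> ->; rewrite mulrA -exD NegzE mulrNz mulNr addNr ex0 mul1r.
Qed.

Lemma lser_diff b s x : 0 < s -> gbound b s -> annulus s x -> diff_at (lser b) x.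
Proof.
move=> s0 hb [h1 h2]; have [K hK] := gbound_pos hb; have [K' hK'] := gbound_neg hb.
have dN : diff_at (fun y => ex (- y)) x.
  apply: (@diff_at_comp _ (fun y => - y)); last exact: diff_at_ex.
  apply: (diff_at_near _ (diff_atM (diff_at_cst (-1) x) (@diff_at_id _ x))).
  by apply: near_atT => y; rewrite mulN1r.
apply: diff_atD; first by apply: (@diff_at_comp _ (@ex R)); [exact: diff_at_ex|exact: pser_diff hK h1].
apply: diff_atM => //; apply: (@diff_at_comp _ (fun y => ex (- y))) => //; exact: pser_diff hK' h2.
Qed.

Lemma lserD1 b x : lser b (x + 1) = lser b x.
Proof. by rewrite /lser !exN !exD1. Qed.

Lemma nrm_ex_real (k : int) (x : R) : nrm (ex (k%:~R * x%:C)) = 1.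
Proof.
rewrite nrm_ex (_ : k%:~R * x%:C = (k%:~R * x)%:C); last by rewrite rmorphM /= rmorph_int.
by rewrite /= mulr0 oppr0 expR0.
Qed.

Lemma annulus_real s (x : R) : s < 1 -> annulus s x%:C.
Proof.
move=> s1; have := nrm_ex_real 1 x; have := nrm_ex_real (-1) x.
by rewrite mulN1r mul1r /annulus => -> ->; rewrite !mulr1.
Qed.

Lemma annulus_near s x : annulus s x -> near_at x (annulus s).
Proof.
move=> [h1 h2]; have cN : cont_at (fun y => ex (- y)) x.
  apply: (@cont_at_comp _ (fun y => - y)); first by apply: cont_atN; exact: cont_at_id.
  exact: diff_at_cont (diff_at_ex _).
have aux (f : C -> C) : cont_at f x -> s * nrm (f x) < 1 -> near_at x (fun y => s * nrm (f y) < 1).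
  move=> cf hf; have [s0|s0] := leP s 0.
    by apply: near_atT => y; rewrite (@le_lt_trans _ _ 0)// mulr_le0_ge0// nrm_ge0.
  have e0 : 0 < s^-1 - nrm (f x) by rewrite subr_gt0 -[ltRHS]mul1r ltr_pdivlMr// mulrC.
  have [r r0 hr] := (cont_atR _ _).1 cf _ e0; apply/near_atR; exists r => // y /hr h.
  rewrite mulrC -ltr_pdivlMr// mul1r.
  have := nrmD (f y - f x) (f x); rewrite subrK => /le_lt_trans; apply.
  by rewrite -ltrBrDr.
have cE := diff_at_cont (diff_at_ex x).
exact: near_atI (aux _ cE h1) (aux _ cN h2).
Qed.

(** Integrating a partial sum keeps only the terms of total frequency [j + e * n = 0]. The
    hypothesis says that these add up to [V] from [N0] on, and the remainder is uniformly geometric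
    on the real line. *)
Lemma cint_pser (a : nat -> C) (K s : R) (e j : int) (V : C) N0 : 0 <= s < 1 ->
  (forall n, nrm (a n) <= K * s ^+ n) ->
  cpath 0 1 (fun x => pser a (ex (e%:~R * x%:C))) ->
  (forall N, (N0 <= N)%N -> \sum_(n < N) a n * (j + e * Posz n == 0)%:R = V) ->
  cint 0 1 (fun x => ex (j%:~R * x%:C) * pser a (ex (e%:~R * x%:C))) = V.
Proof.
move=> /andP[s0 s1] ha ca hV.
have cj := @cpath_exZ R 0 1 j%:~R.
pose P N x := \sum_(n < N) a n * ex ((j + e * Posz n)%:~R * x%:C) : C.
have cPn N : cpath 0 1 (P N) /\ cint 0 1 (P N) = \sum_(n < N) a n * (j + e * Posz n == 0)%:R.
  have := @cint_sum R 'I_N (index_enum _) (fun n x => a n * ex ((j + e * Posz n)%:~R * x%:C)) 0 1.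
  case=> [n|h1 h2]; first exact: cpathM (@cpath_cst R 0 1 _) (@cpath_exZ R 0 1 _).
  split=> //; rewrite /P h2; apply: eq_bigr => n _.
  by rewrite (cintZ _ (@cpath_exZ R 0 1 _)) cint_ex.
have cF := cpathM cj ca.
apply/eqP; rewrite -subr_eq0 -nrm_eq0; apply/eqP.
apply: (@cvg0_eq0 _ _ (4 * K / (1 - s) * s ^+ N0) s); rewrite ?s0 ?nrm_ge0// => N.
have [cP iP] := cPn (N + N0)%N; rewrite -(hV (N + N0)%N) ?leq_addl// -iP.
have -> : cint 0 1 (fun x => ex (j%:~R * x%:C) * pser a (ex (e%:~R * x%:C))) - cint 0 1 (P (N + N0)%N) =
    cint 0 1 (fun x => ex (j%:~R * x%:C) * pser a (ex (e%:~R * x%:C)) + -1 * P (N + N0)%N x).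
  rewrite cintD ?cintZ ?mulN1r//; apply: cpathM => //; exact: cpath_cst.
have := @nrm_cint_le R 0 1 _ (2 * K / (1 - s) * s ^+ (N + N0)) ler01 (cpathD cF (cpathM (@cpath_cst _ 0 1 (-1)) cP)).
rewrite subr0 mulr1 => h; apply: (le_trans (h _)) => [x _|]; last first.
  by rewrite exprD le_eqVlt; apply/orP; left; apply/eqP; ring.
have n1 := nrm_ex_real e x.
have sz : s * nrm (ex (e%:~R * x%:C)) < 1 by rewrite n1 mulr1.
have [_ /(_ (N + N0)%N)] := pser_bound s0 ha sz; rewrite n1 mulr1; apply: le_trans.
rewrite -[leRHS]mul1r -[X in _ <= X * _](nrm_ex_real j x) -nrmM mulrBr mulN1r /P mulr_sumr.
rewrite le_eqVlt; apply/orP; left; apply/eqP; congr (nrm (_ - _)); apply: eq_bigr => n _.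
rewrite intrD mulrDl exD intrM -mulrA mulrCA; congr (_ * _).
by congr (_ * _); rewrite mulrCA; exact: (exMz (e%:~R * x%:C) (Posz n)).
Qed.

(** Multiplication by [e(k x)] shifts the coefficients, which reduces the claim to the constant
    term. The negative half has frequencies [-1 - n] and contributes nothing. *)
Lemma cint_lser b s (k : int) : 0 < s -> s < 1 -> gbound b s ->
  cint 0 1 (fun x => lser b x%:C * ex (k%:~R * x%:C)) = b (- k).
Proof.
move=> s0 s1 hb; have s01 : 0 <= s < 1 by rewrite ltW.
have base b' : gbound b' s -> cint 0 1 (fun x => lser b' x%:C) = b' 0.
  move=> hb'; have [K hK] := gbound_pos hb'; have [K' hK'] := gbound_neg hb'.
  have c1 (e : int) (a : nat -> C) K1 : (forall n, nrm (a n) <= K1 * s ^+ n) ->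
      cpath 0 1 (fun x => pser a (ex (e%:~R * x%:C))).
    move=> ha; apply: (cpath_comp (@cpath_exZ _ 0 1 e%:~R)) => x _.
    by apply/diff_at_cont/(pser_diff s0 ha); rewrite nrm_ex_real mulr1.
  have i1 := @cint_pser _ K s 1 0 (b' 0) 1%N s01 hK (c1 1 _ _ hK).
  have i2 := @cint_pser _ K' s (-1) (-1) 0 0%N s01 hK' (c1 (-1) _ _ hK').
  have -> : b' 0 = b' 0 + 0 by rewrite addr0.
  rewrite -[X in X + 0]i1; last first.
    case=> // N _; rewrite big_ord_recl big1 ?addr0 ?mulr1// => i _.
    by rewrite (_ : (_ == _) = false) ?mulr0//; apply/eqP; rewrite /= /bump /=; lia.
  rewrite -[X in _ + X]i2; last first.
    by move=> N _; apply: big1 => i _; rewrite (_ : (_ == _) = false) ?mulr0//; apply/eqP; lia.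
  rewrite -cintD; [|exact: cpathM (@cpath_exZ _ 0 1 _) (c1 _ _ _ hK)|
    exact: cpathM (@cpath_exZ _ 0 1 _) (c1 _ _ _ hK')].
  by apply: eq_cint => x _; rewrite /lser mul0r ex0 !mul1r !mulN1r.
have -> : b (- k) = (fun m => b (m - k)) 0 by rewrite sub0r.
rewrite -[RHS](base (fun m => b (m - k))); last by apply: gbound_shift => //; exact: ltW.
apply: eq_cint => x _; rewrite (lser_shift k s0 (ltW s1) hb); first by rewrite mulrC.
exact: annulus_real.
Qed.

End LaurentSeries.

(** * Decay of solutions of the recurrence *)

Lemma int_offset (l m : int) : l <= m -> exists k : nat, m = l + Posz k.
Proof. by move=> h; exists (absz (m - l)%R); lia. Qed.

Lemma absz_add_le (l : int) (k : nat) : (absz (l + Posz k)%R <= absz l + k)%N.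
Proof. lia. Qed.

Lemma absz_sub_le (l : int) (k : nat) : (absz (l - Posz k)%R <= absz l + k)%N.
Proof. lia. Qed.

Section Recurrence.
Variable R : realType.
Local Notation C := R[i].
Implicit Types (c d : nat -> C) (f g p : {poly C}).

(** The difference operator [f(E)], where [E] is the shift of sequences; by [shiftopXsubC], linear
    factors of [f] act one after the other. *)
Definition shiftop f c m : C := \sum_(i < size f) f`_i * c (m + i)%N.

Lemma shiftop_wide f c m N : (size f <= N)%N -> shiftop f c m = \sum_(i < N) f`_i * c (m + i)%N.
Proof.
move=> fN; rewrite /shiftop (big_ord_widen _ (fun i => f`_i * c (m + i)%N) fN) big_mkcond /=.
apply: eq_bigr => i _; case: ltnP => // h; by rewrite nth_default// mul0r.
Qed.

Lemma shiftopZ f c m (k : C) : shiftop (k *: f) c m = k * shiftop f c m.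
Proof.
rewrite (shiftop_wide _ _ (size_scale_leq k f)) /shiftop mulr_sumr.
by apply: eq_bigr => i _; rewrite coefZ mulrA.
Qed.

Lemma shiftop1 c m : shiftop 1 c m = c m.
Proof. by rewrite /shiftop size_poly1 big_ord1 coef1 mul1r addn0. Qed.

Lemma shiftopXsubC f c m (r : C) :
  shiftop (('X - r%:P) * f) c m = shiftop f (fun k => c k.+1 - r * c k) m.
Proof.
have h : (size (('X - r%:P) * f)%R <= (size f).+1)%N.
  by rewrite (leq_trans (size_polyMleq _ _))// size_XsubC.
rewrite (shiftop_wide _ _ h) mulrBl.
under eq_bigr do rewrite coefB coefXM coefCM mulrBl.
rewrite sumrB big_ord_recl /= mul0r add0r.
rewrite [X in _ - X](_ : _ = \sum_(i < size f) r * f`_i * c (m + i)%N); last first.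
  by rewrite big_ord_recr /= nth_default// mulr0 mul0r addr0.
rewrite -sumrB /shiftop; apply: eq_bigr => i _.
by rewrite /bump /= add1n addnS mulrBr; congr (_ - _); rewrite mulrCA mulrA.
Qed.

Lemma geometric_small (K th e : R) : 0 <= th < 1 -> 0 < e -> exists N, K * th ^+ N <= e.
Proof.
move=> /andP[th0 th1] e0.
have : ((fun N => K * th ^+ N) @ \oo --> K * 0)%classic.
  by apply: cvgM; [exact: cvg_cst|apply: cvg_expr; rewrite ger0_norm].
rewrite mulr0 => /cvgrPdist_lt/(_ _ e0)[N _ /(_ N (leqnn _))].
by rewrite /= sub0r normrN => /(le_lt_trans (ler_norm _))/ltW h; exists N.
Qed.

(** The induction closes because [G = 1 + 1 / (rho - |r|)] satisfies [1 + |r| G <= rho G]. [G] does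
    not depend on the horizon [N], up to which alone the hypothesis is assumed. *)
Lemma decay_step (rho : R) (r : C) : 0 < rho -> nrm r < rho -> exists2 G : R, 1 <= G &
  forall c (F : R) N, 0 <= F -> nrm (c 0%N) <= F ->
   (forall m, (m < N)%N -> nrm (c m.+1 - r * c m) <= F * rho ^+ m) ->
   forall m, (m <= N)%N -> nrm (c m) <= G * F * rho ^+ m.
Proof.
move=> rho0 rr; have d0 : 0 < rho - nrm r by rewrite subr_gt0.
exists (1 + (rho - nrm r)^-1); first by rewrite lerDl invr_ge0 ltW.
move=> c F N F0 c0 hc; elim=> [_|m ih mN].
  by rewrite expr0 mulr1 mulrDl mul1r (le_trans c0)// lerDl mulr_ge0// invr_ge0 ltW.
have := nrmD (c m.+1 - r * c m) (r * c m); rewrite subrK nrmM => /le_trans; apply.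
have h1 := hc m mN; have h2 := ih (ltnW mN).
have h3 : nrm r * nrm (c m) <= nrm r * ((1 + (rho - nrm r)^-1) * F * rho ^+ m).
  by rewrite ler_wpM2l// nrm_ge0.
rewrite (le_trans (lerD h1 h3))// exprS -subr_ge0.
rewrite (_ : _ - _ = F * rho ^+ m * (rho - nrm r)); last by field; rewrite gt_eqF.
by rewrite !mulr_ge0 ?exprn_ge0// ltW.
Qed.

(** One linear factor at a time: [d k = c k.+1 - r * c k] is controlled by the remaining roots, with
    [F] enlarged by [1 + rho] to cover its initial values, and [decay_step] passes from [d] back to
    [c]. *)
Lemma decay_prod (rho : R) (rs : seq C) : 0 < rho -> (forall r, r \in rs -> nrm r < rho) ->
  exists2 G : R, 1 <= G & forall c (F : R) N, 0 <= F ->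
   (forall i, (i < size rs)%N -> nrm (c i) <= F) ->
   (forall m, (m < N)%N -> nrm (shiftop (\prod_(r <- rs) ('X - r%:P)) c m) <= F * rho ^+ m) ->
   forall m, (m < N + size rs)%N -> nrm (c m) <= G * F * rho ^+ m.
Proof.
move=> rho0; elim: rs => [|r rs ih] hr.
  exists 1 => // c F N F0 _ h m; rewrite addn0 mul1r => /h.
  by rewrite big_nil shiftop1.
have [G' G'1 hG'] : exists2 G : R, 1 <= G & forall c (F : R) N, 0 <= F ->
   (forall i, (i < size rs)%N -> nrm (c i) <= F) ->
   (forall m, (m < N)%N -> nrm (shiftop (\prod_(r <- rs) ('X - r%:P)) c m) <= F * rho ^+ m) ->
   forall m, (m < N + size rs)%N -> nrm (c m) <= G * F * rho ^+ m.
  by apply: ih => s srs; apply: hr; rewrite inE srs orbT.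
have rr : nrm r < rho by apply: hr; rewrite inE eqxx.
have [G1 G11 hG1] := decay_step rho0 rr.
have G'0 : 0 <= G' by exact: le_trans G'1.
have G10 : 0 <= G1 by exact: le_trans G11.
have rho1 : 1 <= 1 + rho by rewrite lerDl ltW.
have H1 : 1 <= G' * (1 + rho) by rewrite (le_trans G'1)// ler_peMr.
exists (G1 * (G' * (1 + rho))); first by rewrite (le_trans G11)// ler_peMr.
move=> c F N F0 hc hm m mN.
pose d k := c k.+1 - r * c k.
have F'0 : 0 <= (1 + rho) * F by rewrite mulr_ge0// (le_trans _ rho1).
have dF i : (i < size rs)%N -> nrm (d i) <= (1 + rho) * F.
  move=> irs; rewrite /d (le_trans (nrmD _ _))// nrmN nrmM mulrDl mul1r lerD//.
    by apply: hc.
  by apply: ler_pM; rewrite ?nrm_ge0 ?(ltW rr)//; apply: hc; rewrite /= ltnW.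
have dm k : (k < N)%N -> nrm (shiftop (\prod_(r <- rs) ('X - r%:P)) d k) <= (1 + rho) * F * rho ^+ k.
  move=> kN; have := hm k kN; rewrite big_cons shiftopXsubC => /le_trans; apply.
  by rewrite ler_wpM2r ?exprn_ge0 ?(ltW rho0)// ler_peMl.
have hd := hG' d _ N F'0 dF dm.
have := hG1 c (G' * ((1 + rho) * F)) (N + size rs)%N _ _ hd m.
rewrite !mulrA; apply => //.
- by rewrite -mulrA mulr_ge0.
- rewrite (le_trans (hc 0%N _))// -[leRHS]mulrA [(_ * F)]mulrC mulrCA ler_peMr//.
- by move: mN; rewrite /= addnS ltnS.
Qed.

(** Far out, the perturbation [eps m * g(E)] is so small that in the estimate of [decay_prod] it
    contributes at most half of the quantity being bounded. The condition [size g <= size f] keeps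
    the terms of [g(E) c] inside the window over which that quantity is a maximum. *)
Lemma recurrence_decay f g c (eps : nat -> C) (E kappa : R) :
  (size g <= size f)%N -> f != 0 -> (forall z, root f z -> nrm z < 1) ->
  0 <= kappa < 1 -> 0 <= E -> (forall m, nrm (eps m) <= E * kappa ^+ m) ->
  (forall m, shiftop f c m = eps m * shiftop g c m) ->
  exists rho K : R, [/\ 0 < rho, rho < 1 & forall m, nrm (c m) <= K * rho ^+ m].
Proof.
move=> gf f0 rf /andP[k0 k1] E0 heps hrec.
have [rs frs] := closed_field_poly_normal f.
have l0 : lead_coef f != 0 by rewrite lead_coef_eq0.
have rs1 r : r \in rs -> nrm r < 1.
  by move=> rrs; apply: rf; rewrite frs rootZ// root_prod_XsubC.
  have [rho rho0 [rho1 rrho]] : exists2 rho : R, 0 < rho & rho < 1 /\ forall r, r \in rs -> nrm r < rho.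
  elim: (rs) rs1 => [|r s ih] h.
    by exists 2^-1; rewrite ?invr_gt0// invf_lt1// ltr1n.
  have [|rho rho0 [rho1 hrho]] := ih; first by move=> x xs; apply: h; rewrite inE xs orbT.
  have r1 : nrm r < 1 by apply: h; rewrite inE eqxx.
  exists (Num.max rho ((1 + nrm r) / 2)); first by rewrite lt_max rho0.
  split; first by rewrite gt_max rho1 /=; lra.
  move=> x; rewrite inE lt_max => /predU1P[->|/hrho -> //].
  by apply/orP; right; lra.
have sizef : size f = (size rs).+1 by rewrite frs size_scale// size_prod_XsubC.
have [G G1 hG] := decay_prod rho0 rrho.
have G0 : 0 <= G by exact: le_trans G1.
pose S := \sum_(j < size g) nrm g`_j.
have S0 : 0 <= S by apply: sumr_ge0 => j _; exact: nrm_ge0.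
have ln0 : 0 < nrm (lead_coef f) by rewrite nrm_gt0.
pose A := (nrm (lead_coef f))^-1 * E * S.
have A0 : 0 <= A by rewrite !mulr_ge0// invr_ge0 ltW.
(* Beyond [m0] the perturbation has relative size [dl = A * kappa ^ m0] with [G * dl <= 1/2]; [A]
   accounts for the leading coefficient of [f] and the coefficients of [g]. *)
have [m0 hm0] : exists m0, (G * A) * kappa ^+ m0 <= 2^-1.
  by apply: geometric_small; rewrite ?k0// ?invr_gt0 ?mulr_ge0.
have [dl dlE] : exists dl, dl = A * kappa ^+ m0 by eexists.
have dl0 : 0 <= dl by rewrite dlE mulr_ge0// exprn_ge0.
have Gdl : G * dl <= 2^-1 by rewrite dlE mulrA.
pose c' m := c (m0 + m)%N.
have hrec' m : shiftop f c' m = eps (m0 + m)%N * shiftop g c' m.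
  have e h : shiftop h c' m = shiftop h c (m0 + m).
    by apply: eq_bigr => i _; rewrite /c' addnA.
  by rewrite !e hrec.
set n := size rs in sizef hG.
pose F0 := (\sum_(i < n) nrm (c' i)).
have F00 : 0 <= F0 by apply: sumr_ge0 => j _; exact: nrm_ge0.
have hF0 i : (i < n)%N -> nrm (c' i) <= F0.
  move=> hi; rewrite /F0 (bigD1 (Ordinal hi))//= lerDl; apply: sumr_ge0 => j _; exact: nrm_ge0.
have key N m : (m < N + n)%N -> nrm (c' m) <= 2 * G * F0 * rho ^+ m.
  (* [M] is a maximum over a finite window. The estimate becomes [M <= G * F0 + M / 2], and the
     resulting bound on [M] is uniform in [N]. *)
  pose M := \big[Num.max/0]_(m < N + n) (nrm (c' m) / rho ^+ m).
  have M0 : 0 <= M by exact: bigmax_ge_id.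
  have hM k : (k < N + n)%N -> nrm (c' k) <= M * rho ^+ k.
    move=> kN; rewrite -ler_pdivrMr ?exprn_gt0//.
    exact: (@le_bigmax _ _ _ 0 (fun m : 'I_(N + n) => nrm (c' m) / rho ^+ m) (Ordinal kN)).
  have F1 : 0 <= F0 + dl * M by rewrite addr_ge0// mulr_ge0.
  have op k : (k < N)%N -> nrm (shiftop (\prod_(r <- rs) ('X - r%:P)) c' k) <= (F0 + dl * M) * rho ^+ k.
    move=> kN; have -> : shiftop (\prod_(r <- rs) ('X - r%:P)) c' k = (lead_coef f)^-1 * shiftop f c' k.
      by rewrite [in shiftop f _ _]frs shiftopZ mulKf.
    rewrite hrec' !nrmM nrmV.
    have h1 : nrm (shiftop g c' k) <= S * (M * rho ^+ k).
      rewrite (le_trans (nrm_sum _ _ _))// mulr_suml; apply: ler_sum => j _.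
      rewrite nrmM ler_wpM2l ?nrm_ge0// (le_trans (hM _ _))//.
        have jn : (j < n.+1)%N by rewrite -sizef (leq_trans (ltn_ord j)).
        by rewrite ltnS in jn; rewrite -addSn; exact: leq_add kN jn.
      rewrite ler_wpM2l// exprD ler_piMr ?exprn_ge0 ?(ltW rho0)//.
      by rewrite exprn_ile1// ltW.
    have h2 : nrm (eps (m0 + k)%N) <= E * kappa ^+ m0.
      rewrite (le_trans (heps _))// ler_wpM2l// exprD ler_piMr ?exprn_ge0//.
      by rewrite exprn_ile1// ltW.
    have h3 := ler_pM (nrm_ge0 _) (nrm_ge0 _) h2 h1.
    have h4 : (nrm (lead_coef f))^-1 * (nrm (eps (m0 + k)%N) * nrm (shiftop g c' k)) <=
      (nrm (lead_coef f))^-1 * (E * kappa ^+ m0 * (S * (M * rho ^+ k))).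
      by rewrite ler_wpM2l// invr_ge0 ltW.
    rewrite (le_trans h4)// mulrDl (_ : _ * _ = dl * M * rho ^+ k); last by rewrite dlE /A; ring.
    by rewrite lerDr mulr_ge0// exprn_ge0// ltW.
  have hc' := hG c' _ N F1 (fun i hi => le_trans (hF0 i hi) _) op.
  have {}hc' k : (k < N + n)%N -> nrm (c' k) <= G * (F0 + dl * M) * rho ^+ k.
    by apply: hc'; rewrite lerDl mulr_ge0.
  have MM : M <= G * F0 + 2^-1 * M.
    apply: bigmax_le => [|i _]; first by rewrite addr_ge0 ?mulr_ge0.
    rewrite ler_pdivrMr ?exprn_gt0// (le_trans (hc' _ (ltn_ord i)))//.
    by rewrite ler_wpM2r ?exprn_ge0 ?(ltW rho0)// mulrDr lerD2l mulrA ler_wpM2r.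
  move=> mN; rewrite (le_trans (hM _ mN))// ler_wpM2r ?exprn_ge0 ?(ltW rho0)//.
  by move: MM; rewrite -mulrA; move: (G * F0) => GF; lra.
pose T := \sum_(i < m0) nrm (c i).
have T0 : 0 <= T by apply: sumr_ge0 => j _; exact: nrm_ge0.
(* [T] covers the first [m0] terms; division by [rho ^+ m0] undoes the shift of the index. *)
exists rho, ((T + 2 * G * F0) / rho ^+ m0); split => // m.
have B0 : 0 <= 2 * G * F0 by rewrite !mulr_ge0.
have r0 : 0 < rho ^+ m0 by rewrite exprn_gt0.
have [mm|mm] := ltnP m m0.
  have h1 : nrm (c m) <= T.
    by rewrite /T (bigD1 (Ordinal mm))//= lerDl; apply: sumr_ge0 => j _; exact: nrm_ge0.
  have h2 : 1 <= rho ^+ m / rho ^+ m0.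
    by rewrite ler_pdivlMr// mul1r; apply: ler_wiXn2l; rewrite ?(ltW rho0) ?(ltW rho1)// ltnW.
  rewrite -mulrA [_^-1 * _]mulrC (le_trans h1)// (@le_trans _ _ (T + 2 * G * F0))// ?lerDl//.
  by rewrite ler_peMr// addr_ge0.
have := key (m - m0).+1 (m - m0)%N; rewrite /c' subnKC// => h.
rewrite (le_trans (h _)) ?addSn ?ltnS ?leq_addr//.
rewrite -[leRHS]mulrA [_^-1 * _]mulrC -[X in _ <= _ * (rho ^+ X / _)](subnK mm) exprD mulfK ?gt_eqF//.
rewrite ler_wpM2r ?exprn_ge0 ?(ltW rho0)//.
by rewrite lerDr.
Qed.

(** Here [f = p(X / q)] and [g = p(q X)]. A root [z] of [f] gives the root [z / q] of [p], so the
    upper bound on the roots of [p] puts those of [f] in the unit disc. *)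
Lemma decay_one_sided (q t : C) p c : q != 0 -> nrm q < 1 -> p != 0 ->
  (forall z, root p z -> nrm z < (nrm q)^-1) ->
  (forall m, \sum_(i < size p) p`_i * q^-1 ^+ i * c (m + i)%N =
     t * (q ^+ 2) ^+ m * \sum_(i < size p) p`_i * q ^+ i * c (m + i)%N) ->
  exists rho K : R, [/\ 0 < rho, rho < 1 & forall m, nrm (c m) <= K * rho ^+ m].
Proof.
move=> q0 q1 p0 rp hrec.
pose f := \poly_(i < size p) (p`_i * q^-1 ^+ i); pose g := \poly_(i < size p) (p`_i * q ^+ i).
have sf : size f = size p.
  by apply: size_poly_eq; rewrite mulf_neq0 ?expf_neq0 ?invr_neq0// -lead_coefE lead_coef_eq0.
have q0' : 0 < nrm q by rewrite nrm_gt0.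
apply: (@recurrence_decay f g c (fun m => t * (q ^+ 2) ^+ m) (nrm t) (nrm q ^+ 2)).
- by rewrite sf; exact: size_poly.
- by rewrite -size_poly_eq0 sf size_poly_eq0.
- move=> z; rewrite /root horner_poly => /eqP h; have : root p (q^-1 * z).
    rewrite /root horner_coef -[X in _ == X]h; apply/eqP; apply: eq_bigr => i _.
    by rewrite exprMn mulrA.
  by move=> /rp; rewrite nrmM nrmV -[X in _ < X]mulr1 ltr_pM2l// invr_gt0.
- by rewrite exprn_ge0 ?nrm_ge0//= exprn_ilt1// ?nrm_ge0.
- exact: nrm_ge0.
- by move=> m; rewrite nrmM !nrmX.
- move=> m; have := hrec m; rewrite (shiftop_wide c m (_ : size f <= size p)%N) ?sf//.
  rewrite (shiftop_wide c m (size_poly _ _ : size g <= size p)%N) => e.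
  rewrite [LHS](_ : _ = \sum_(i < size p) p`_i * q^-1 ^+ i * c (m + i)%N); last first.
    by apply: eq_bigr => i _; rewrite coef_poly ltn_ord.
  rewrite e; congr (_ * _); apply: eq_bigr => i _; by rewrite coef_poly ltn_ord.
Qed.

(** Toward [+oo] the recurrence is read from index [l]; read backwards from [l + n] it has the same
    shape for the reciprocal polynomial [p'], with [t] inverted. The lower bound on the roots of [p]
    is the upper bound on those of [p'], and [p.[0] != 0] preserves the degree. *)
Theorem decay_two_sided (q t : C) (l : int) p (c : int -> C) : q != 0 -> nrm q < 1 -> t != 0 ->
  p.[0] != 0 -> (forall z, root p z -> nrm q < nrm z < (nrm q)^-1) ->
  (forall m : int, \sum_(i < size p) p`_i * q ^ (- (l + Posz i)) * c (m + l + Posz i) =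
     t * q ^ (2 * m) * \sum_(i < size p) p`_i * q ^ (l + Posz i) * c (m + l + Posz i)) ->
  exists2 rho : R, 0 < rho < 1 & gbound c rho.
Proof.
move=> q0 q1 t0 p00 rp hrec.
have p0 : p != 0 by apply: contraNneq p00 => ->; rewrite horner0.
have n0 : (0 < size p)%N by rewrite size_poly_gt0.
have XE (i : nat) : q ^ (Posz i) = q ^+ i by [].
have XNE (i : nat) : q ^ (- Posz i) = q^-1 ^+ i by rewrite -exprz_inv.
have [r1 [K1 [r10 r11 h1]]] : exists rho K : R, [/\ 0 < rho, rho < 1 &
    forall m : nat, nrm (c (l + Posz m)) <= K * rho ^+ m].
  apply: (@decay_one_sided q (t * q ^ (2 * l)) p (fun m : nat => c (l + Posz m)) q0 q1 p0) => [z /rp/andP[]//|m].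
  have := hrec (Posz m); rewrite [RHS]mulrC mulr_suml => e.
  apply: (mulfI (expfz_neq0 (- l) q0)); rewrite mulr_sumr.
  transitivity (\sum_(i < size p) p`_i * q ^ (- (l + Posz i)) * c (Posz m + l + Posz i)).
    apply: eq_bigr => i _; rewrite opprD expfzDr// XNE PoszD.
    rewrite (_ : l + (Posz m + Posz i) = Posz m + l + Posz i); last by lia.
    by rewrite !mulrA; congr (_ * _ * _); rewrite mulrC.
  rewrite e mulrC !mulr_sumr; apply: eq_bigr => i _.
  rewrite PoszD (_ : l + (Posz m + Posz i) = Posz m + l + Posz i); last by lia.
  rewrite expfzDr// -XE -exprM -[q ^+ (2 * m)]XE.
  rewrite -[in RHS]XE; have : q ^ (- l) * q ^ (2 * l) = q ^ l.
    by rewrite -expfzDr//; congr (_ ^ _); lia.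
  rewrite PoszM => <-; ring.
pose n := (size p).-1.
have nE : size p = n.+1 by rewrite /n prednK.
have ordE (i : 'I_(size p)) : (i <= n)%N by rewrite -ltnS -nE.
have szE (i : 'I_(size p)) : (size p - i.+1 = n - i)%N by rewrite [X in (X - _)%N]nE subSS.
pose p' := \poly_(i < size p) p`_(n - i).
have p'n : p'`_n = p`_0 by rewrite coef_poly nE ltnS leqnn subnn.
have sp' : size p' = size p.
  by rewrite nE /p' nE; apply: size_poly_eq; rewrite /= subnn -horner_coef0.
have p'0 : p' != 0 by rewrite -size_poly_eq0 sp' size_poly_eq0.
have rp' z : root p' z -> nrm z < (nrm q)^-1.
  move=> rz; have z0 : z != 0.
    apply: contraTneq rz => ->; rewrite /root horner_coef0 coef_poly n0 subn0.
    by rewrite /n -lead_coefE lead_coef_eq0.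
  have /rp/andP[h _] : root p z^-1.
    have zn0 : z ^+ n != 0 by rewrite expf_neq0.
    rewrite /root; apply/eqP; apply: (mulfI zn0); rewrite mulr0.
    move: rz; rewrite /root => /eqP <-.
    rewrite horner_poly horner_coef mulr_sumr [RHS](reindex_inj rev_ord_inj) /=.
    apply: eq_bigr => i _; rewrite szE; have ile := ordE i.
    rewrite exprVn mulrCA; congr (_ * _); first by rewrite subKn.
    by rewrite -{1}(subnK ile) exprD mulfK// expf_neq0.
  by move: h; rewrite nrmV => h; rewrite -[ltLHS]invrK ltf_pV2// posrE ?invr_gt0 nrm_gt0.
have [r2 [K2 [r20 r21 h2]]] : exists rho K : R, [/\ 0 < rho, rho < 1 &
    forall m : nat, nrm (c (l + Posz n - Posz m)) <= K * rho ^+ m].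
  (* Reversal writes [q^(l+i)] as [q^(l+n)] times [q^-(n-i)], and likewise for the inverses; the two
     resulting factors [q^-(l+n)] make up the constant. *)
  apply: (@decay_one_sided q (t^-1 * q ^ (- 2 * (l + Posz n))) p'
    (fun m : nat => c (l + Posz n - Posz m)) q0 q1 p'0 rp') => m.
  have := hrec (- Posz m); rewrite [RHS]mulrC mulr_suml => e.
  rewrite sp' (reindex_inj rev_ord_inj) /= [in RHS](reindex_inj rev_ord_inj) /=.
  have idx (i : 'I_(size p)) : l + Posz n - Posz (m + (size p - i.+1)) = - Posz m + l + Posz i.
    by rewrite szE; have := ordE i; lia.
  have coef (i : 'I_(size p)) : p'`_(size p - i.+1) = p`_i.
    by rewrite szE coef_poly [X in (_ < X)%N]nE ltnS leq_subr subKn.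
  have A1 (i : 'I_(size p)) : q^-1 ^+ (size p - i.+1) = q ^ (- Posz n) * q ^ (Posz i).
    by rewrite szE -XNE -expfzDr//; congr (_ ^ _); have := ordE i; lia.
  have A2 (i : 'I_(size p)) : q ^+ (size p - i.+1) = q ^ (Posz n) * q ^ (- Posz i).
    by rewrite szE -XE -expfzDr//; congr (_ ^ _); have := ordE i; lia.
  transitivity (t^-1 * q ^ (2 * Posz m) * q ^ (- (l + Posz n)) *
     \sum_(i < size p) p`_i * q ^ (- (l + Posz i)) * c (- Posz m + l + Posz i)).
    rewrite e [in RHS]mulr_sumr; apply: eq_bigr => i _.
    rewrite idx coef A1 !opprD !expfzDr//.
    have -> : q ^ (2 * - Posz m) = (q ^ (2 * Posz m))^-1 by rewrite invr_expz mulrN.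
    have -> : q ^ (- l) = (q ^ l)^-1 by rewrite invr_expz.
    by field; rewrite t0 !expfz_neq0.
  rewrite [in LHS]mulr_sumr [in RHS]mulr_sumr; apply: eq_bigr => i _.
  rewrite idx coef A2.
  have -> : (q ^+ 2) ^+ m = q ^ (2 * Posz m) by rewrite -exprM.
  have -> : q ^ (- 2 * (l + Posz n)) = q ^ (- (l + Posz n)) * q ^ (- l) * q ^ (- Posz n).
    by rewrite -!expfzDr//; congr (_ ^ _); lia.
  have -> : q ^ (- (l + Posz i)) = q ^ (- l) * q ^ (- Posz i) by rewrite opprD expfzDr.
  have : q ^ (- Posz n) * q ^ (Posz n) = 1 by rewrite -expfzDr// addNr.
  by move: (q ^ (- Posz n)) (q ^ (Posz n)) => x y xy; rewrite -[LHS]mul1r -xy; ring.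
pose rho := Num.max r1 r2.
have rho0 : 0 < rho by rewrite lt_max r10.
have rho1 : rho < 1 by rewrite gt_max r11.
have K10 : 0 <= K1 by have := h1 0%N; rewrite expr0 mulr1; apply: le_trans; exact: nrm_ge0.
have K20 : 0 <= K2 by have := h2 0%N; rewrite expr0 mulr1; apply: le_trans; exact: nrm_ge0.
exists rho; first by rewrite rho0.
(* Trades decay counted from [m0] for decay counted from [0], at the cost of dividing the constant
   by [rho ^ |m0|]. *)
have ag K k (m0 m : int) (r : R) x : 0 <= K -> 0 < r -> r <= rho -> (`|m|%N <= k + `|m0|%N)%N ->
   x <= K * r ^+ k -> x <= K / rho ^+ `|m0|%N * rho ^+ `|m|%N.
  move=> K0 r0 rr mk /le_trans; apply; rewrite -mulrA ler_wpM2l// mulrC.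
  rewrite ler_pdivlMr ?exprn_gt0// (@le_trans _ _ (rho ^+ k * rho ^+ `|m0|%N))//.
    by rewrite ler_wpM2r ?exprn_ge0 ?(ltW rho0)// lerXn2r ?nnegrE ?(ltW rho0) ?(ltW r0).
  by rewrite -exprD; apply: ler_wiXn2l; rewrite ?(ltW rho0) ?(ltW rho1).
exists (K1 / rho ^+ `|l|%N + K2 / rho ^+ absz (l + Posz n)%R) => m.
have [lm|ml] := lerP l m.
  have [k kE] := int_offset lm.
  have := h1 k; rewrite -kE => h.
  apply: (le_trans (ag K1 k l m r1 _ K10 r10 _ _ h)); first by rewrite le_max lexx.
    by rewrite kE addnC; exact: absz_add_le.
  by rewrite mulrDl lerDl mulr_ge0 ?divr_ge0 ?exprn_ge0 ?(ltW rho0).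
have [k kE'] : exists k : nat, l + Posz n = m + Posz k.
  by apply: int_offset; rewrite (le_trans (ltW ml))// lerDl.
have kE : m = l + Posz n - Posz k by rewrite kE' addrK.
have := h2 k; rewrite -kE => h.
apply: (le_trans (ag K2 k (l + Posz n) m r2 _ K20 r20 _ _ h)); first by rewrite le_max lexx orbT.
  by rewrite kE addnC; exact: absz_sub_le.
by rewrite mulrDl lerDr mulr_ge0 ?divr_ge0 ?exprn_ge0 ?(ltW rho0).
Qed.

End Recurrence.

(** * Generalized Weyl algebras *)

Section AlgebraHomomorphisms.
Variable R : realType.
Local Notation C := R[i].

Section Hom.
Variables (A B : algType C) (f : A -> B).
Hypothesis hf : is_alg_hom f.

Lemma homL (c : C) x y : f (c *: x + y) = c *: f x + f y. Proof. by case: hf. Qed.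
Lemma homM x y : f (x * y) = f x * f y. Proof. by case: hf. Qed.
Lemma hom1 : f 1 = 1. Proof. by case: hf. Qed.
Lemma hom0 : f 0 = 0.
Proof. by have := homL (-1) 0 0; rewrite scaler0 addr0 scaleN1r addNr. Qed.
Lemma homD x y : f (x + y) = f x + f y.
Proof. by have := homL 1 x y; rewrite !scale1r. Qed.
Lemma homZ (c : C) x : f (c *: x) = c *: f x.
Proof. by have := homL c x 0; rewrite hom0 !addr0. Qed.
Lemma homX x n : f (x ^+ n) = f x ^+ n.
Proof. by elim: n => [|n ih]; rewrite ?expr0 ?hom1// !exprS homM ih. Qed.
Lemma hom_sum I (s : seq I) (F : I -> A) : f (\sum_(i <- s) F i) = \sum_(i <- s) f (F i).
Proof. by elim: s => [|i s ih]; rewrite ?big_nil ?hom0// !big_cons homD ih. Qed.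
Lemma hom_zpow X Xi m : f (zpow X Xi m) = zpow (f X) (f Xi) m.
Proof. by case: m => n; exact: homX. Qed.
Lemma hom_aeval X Xi l p : f (aeval X Xi l p) = aeval (f X) (f Xi) l p.
Proof.
rewrite /aeval homM hom_zpow hom_sum; congr (_ * _); apply: eq_bigr => i _.
by rewrite homZ homX.
Qed.
End Hom.

Lemma hom_comp (A B D : algType C) (f : A -> B) (g : B -> D) :
  is_alg_hom f -> is_alg_hom g -> is_alg_hom (fun x => g (f x)).
Proof.
move=> hf hg; split=> [c x y|x y|]; first by rewrite (homL hf) (homL hg).
  by rewrite (homM hf) (homM hg).
by rewrite (hom1 hf) (hom1 hg).
Qed.

Lemma hom_id (A : algType C) : is_alg_hom (fun x : A => x). Proof. by []. Qed.

Lemma zpow_scale (A : algType C) (X Xi : A) (k : C) m :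
  zpow (k *: X) (k^-1 *: Xi) m = k ^ m *: zpow X Xi m.
Proof. by case: m => n; rewrite /zpow exprZn// exprVn. Qed.

Section Inverse.
Variables (A : algType C) (Z Zi : A).
Hypotheses (ZZi : Z * Zi = 1) (ZiZ : Zi * Z = 1).

Lemma zpow0 : zpow Z Zi 0 = 1. Proof. by []. Qed.
Lemma zpow1 : zpow Z Zi 1 = Z. Proof. by []. Qed.
Lemma zpowN1 : zpow Z Zi (-1) = Zi. Proof. by []. Qed.

Lemma zpowS m : zpow Z Zi (m + 1) = Z * zpow Z Zi m.
Proof.
case: m => [n|[|n]]; first by rewrite (_ : Posz n + 1 = n.+1); [exact: exprS|lia].
  by rewrite /= expr1 ZZi.
rewrite (_ : Negz n.+1 + 1 = Negz n); last by lia.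
by rewrite /= [in RHS]exprS mulrA ZZi mul1r.
Qed.

Lemma zpowB m : zpow Z Zi (m - 1) = Zi * zpow Z Zi m.
Proof. by rewrite -{2}[m](subrK 1) zpowS mulrA ZiZ mul1r. Qed.

Lemma zpowD a b : zpow Z Zi (a + b) = zpow Z Zi a * zpow Z Zi b.
Proof.
elim: a => [|n ih|n ih]; first by rewrite add0r zpow0 mul1r.
  by rewrite -addn1 PoszD addrAC !zpowS ih mulrA.
by rewrite -addn1 PoszD opprD addrAC !zpowB ih mulrA.
Qed.

Lemma aevalE l p : aeval Z Zi l p = \sum_(i < size p) p`_i *: zpow Z Zi (l + Posz i).
Proof.
rewrite /aeval mulr_sumr; apply: eq_bigr => i _.
by rewrite zpowD scalerAr.
Qed.
End Inverse.

Lemma aeval_scaleE (A : algType C) (Z Zi : A) (k : C) l p : k != 0 -> Z * Zi = 1 -> Zi * Z = 1 ->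
  aeval (k *: Z) (k^-1 *: Zi) l p =
    \sum_(i < size p) (p`_i * k ^ (l + Posz i)) *: zpow Z Zi (l + Posz i).
Proof.
move=> k0 h1 h2; rewrite aevalE; last 2 first.
- by rewrite -scalerAl -scalerAr scalerA divff// scale1r h1.
- by rewrite -scalerAl -scalerAr scalerA mulVf// scale1r h2.
by apply: eq_bigr => i _; rewrite zpow_scale scalerA.
Qed.

End AlgebraHomomorphisms.

(** * Induction over generators through subalgebras *)

Section Subalgebra.
Variables (R : realType) (A : algType R[i]) (Q : A -> Prop).
Local Notation C := R[i].
Hypotheses (QL : forall (c : C) x y, Q x -> Q y -> Q (c *: x + y))
  (QM : forall x y, Q x -> Q y -> Q (x * y)) (Q1 : Q 1).

Let Q0 : Q 0. Proof. by have := QL (-1) Q1 Q1; rewrite scaleN1r addNr. Qed.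
Let QD x y : Q x -> Q y -> Q (x + y). Proof. by move=> hx /(QL 1 hx); rewrite scale1r. Qed.
Let QZ (c : C) x : Q x -> Q (c *: x). Proof. by move=> /(QL c)/(_ Q0); rewrite addr0. Qed.
Let QN x : Q x -> Q (- x). Proof. by move=> /(QZ (-1)); rewrite scaleN1r. Qed.

(** The universal property of [A] speaks of algebra types, so a predicate closed under the
    operations has to be turned into one before it can be a target. *)
Record subalg := Subalg { sav : A; savP : Q sav }.
Local Notation S := subalg.

Lemma sav_inj : injective (sav : S -> A).
Proof. by move=> [x hx] [y hy] /= e; subst y; rewrite (Prop_irrelevance hx hy). Qed.

HB.instance Definition _ := gen_eqMixin S.
HB.instance Definition _ := gen_choiceMixin S.

Definition sa_mk x (h : Q x) : S := Subalg h.
Definition sa_add (x y : S) : S := sa_mk (QD (savP x) (savP y)).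
Definition sa_opp (x : S) : S := sa_mk (QN (savP x)).
Definition sa_mul (x y : S) : S := sa_mk (QM (savP x) (savP y)).
Definition sa_scale (c : C) (x : S) : S := sa_mk (QZ c (savP x)).

Fact sa_zmod_0 : associative sa_add.
Proof. by move=> x y z; apply: sav_inj; exact: addrA. Qed.
Fact sa_zmod_1 : commutative sa_add.
Proof. by move=> x y; apply: sav_inj; exact: addrC. Qed.
Fact sa_zmod_2 : left_id (sa_mk Q0) sa_add.
Proof. by move=> x; apply: sav_inj; exact: add0r. Qed.
Fact sa_zmod_3 : left_inverse (sa_mk Q0) sa_opp sa_add.
Proof. by move=> x; apply: sav_inj; exact: addNr. Qed.
HB.instance Definition _ := @GRing.isZmodule.Build S (sa_mk Q0) sa_opp sa_add sa_zmod_0 sa_zmod_1 sa_zmod_2 sa_zmod_3.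

Fact sa_ring_0 : associative sa_mul.
Proof. by move=> x y z; apply: sav_inj; exact: mulrA. Qed.
Fact sa_ring_1 : left_id (sa_mk Q1) sa_mul.
Proof. by move=> x; apply: sav_inj; exact: mul1r. Qed.
Fact sa_ring_2 : right_id (sa_mk Q1) sa_mul.
Proof. by move=> x; apply: sav_inj; exact: mulr1. Qed.
Fact sa_ring_3 : left_distributive sa_mul +%R.
Proof. by move=> x y z; apply: sav_inj; exact: mulrDl. Qed.
Fact sa_ring_4 : right_distributive sa_mul +%R.
Proof. by move=> x y z; apply: sav_inj; exact: mulrDr. Qed.
Fact sa_ring_5 : sa_mk Q1 != 0.
Proof. by apply/eqP => /(congr1 sav)/eqP; rewrite /= oner_eq0. Qed.
HB.instance Definition _ := @GRing.Zmodule_isNzRing.Build S (sa_mk Q1) sa_mul sa_ring_0 sa_ring_1 sa_ring_2 sa_ring_3 sa_ring_4 sa_ring_5.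

Fact sa_lmod_0 : forall a b x, sa_scale a (sa_scale b x) = sa_scale (a * b) x.
Proof. by move=> a b x; apply: sav_inj; exact: scalerA. Qed.
Fact sa_lmod_1 : left_id 1 sa_scale.
Proof. by move=> x; apply: sav_inj; exact: scale1r. Qed.
Fact sa_lmod_2 : right_distributive sa_scale +%R.
Proof. by move=> a x y; apply: sav_inj; exact: scalerDr. Qed.
Fact sa_lmod_3 : forall x, {morph sa_scale^~ x : a b / a + b}.
Proof. by move=> x a b; apply: sav_inj; exact: scalerDl. Qed.
HB.instance Definition _ := @GRing.Zmodule_isLmodule.Build C S sa_scale sa_lmod_0 sa_lmod_1 sa_lmod_2 sa_lmod_3.

Fact sa_lalg_0 : forall (a : C) (x y : S), a *: (x * y) = (a *: x) * y.
Proof. by move=> a x y; apply: sav_inj; exact: scalerAl. Qed.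
HB.instance Definition _ := @GRing.Lmodule_isLalgebra.Build C S sa_lalg_0.

Fact sa_alg_0 : forall (a : C) (x y : S), a *: (x * y) = x * (a *: y).
Proof. by move=> a x y; apply: sav_inj; exact: scalerAr. Qed.
HB.instance Definition _ := @GRing.Lalgebra_isAlgebra.Build C S sa_alg_0.

Lemma sav_hom : is_alg_hom (sav : S -> A). Proof. by []. Qed.

(* An algebra with the universal property has no proper subalgebra containing the generators:
   the induced map into such a subalgebra, followed by inclusion, is the identity. *)
Lemma presented_ind (u v Z Zi : A) (q : C) (l : int) (p : {poly C}) :
  is_presented u v Z Zi q l p -> Q u -> Q v -> Q Z -> Q Zi -> forall a, Q a.
Proof.
move=> [rel univ] Qu Qv QZ' QZi a.
have aev X Xi m r : sav (aeval X Xi m r : S) = aeval (sav X) (sav Xi) m r by exact: hom_aeval sav_hom _ _ _ _.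
have relS : gwa_rel (sa_mk Qu) (sa_mk Qv) (sa_mk QZ') (sa_mk QZi) q l p.
  case: rel => [[r1 r2] r3 r4 r5 r6]; split; first by split; exact: sav_inj.
  - exact: sav_inj.
  - exact: sav_inj.
  - by apply: sav_inj; rewrite aev; exact: r5.
  - by apply: sav_inj; rewrite aev; exact: r6.
have [f [hf [fu fv] fZ fZi _]] := univ _ _ _ _ _ relS.
have [f0 [_ _ _ _ uniq]] := univ A u v Z Zi rel.
have h := uniq _ (hom_comp hf sav_hom).
rewrite (uniq _ (hom_id A) erefl erefl erefl erefl a) -h ?fu ?fv ?fZ ?fZi//.
exact: savP.
Qed.

End Subalgebra.

(** * The algebra of operators on two-sided sequences *)

Section LinearEndomorphisms.
Variable R : realType.
Local Notation C := R[i].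

(** Composition is the product. This is the algebra in which [diagonal_model] realises the defining
    relations. *)
Record lend := Lend { lf :> (int -> C) -> int -> C;
  lfP : forall (c : C) x y j, lf (fun i => c * x i + y i) j = c * lf x j + lf y j }.

Lemma lend_ext (f g : lend) : (forall x j, f x j = g x j) -> f = g.
Proof.
case: f g => f hf [g hg] /= e; have fg : f = g by apply/funext => x; apply/funext => j.
by subst g; rewrite (Prop_irrelevance hf hg).
Qed.

HB.instance Definition _ := gen_eqMixin lend.
HB.instance Definition _ := gen_choiceMixin lend.

Fact le_zero_lin (c : C) (x y : int -> C) (j : int) : 0 = c * 0 + 0 :> C.
Proof. by rewrite mulr0 addr0. Qed.
Definition le_zero : lend := @Lend (fun _ _ => 0) le_zero_lin.
Definition le_one : lend := @Lend (fun x j => x j) (fun _ _ _ _ => erefl).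
Fact le_add_lin (f g : lend) (c : C) x y j :
  f (fun i => c * x i + y i) j + g (fun i => c * x i + y i) j = c * (f x j + g x j) + (f y j + g y j).
Proof. by rewrite !lfP mulrDr addrACA. Qed.
Definition le_add (f g : lend) : lend := Lend (le_add_lin f g).
Fact le_opp_lin (f : lend) (c : C) x y j :
  - f (fun i => c * x i + y i) j = c * (- f x j) + - f y j.
Proof. by rewrite lfP opprD mulrN. Qed.
Definition le_opp (f : lend) : lend := Lend (le_opp_lin f).
Fact le_scale_lin (k : C) (f : lend) (c : C) x y j :
  k * f (fun i => c * x i + y i) j = c * (k * f x j) + k * f y j.
Proof. by rewrite lfP mulrDr mulrCA. Qed.
Definition le_scale (k : C) (f : lend) : lend := Lend (le_scale_lin k f).
Fact le_mul_lin (f g : lend) (c : C) x y j :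
  f (g (fun i => c * x i + y i)) j = c * f (g x) j + f (g y) j.
Proof. by rewrite -lfP; congr (lf f _ _); apply/funext => i; rewrite lfP. Qed.
Definition le_mul (f g : lend) : lend := Lend (le_mul_lin f g).

Lemma lend0 (f : lend) j : f (fun=> 0) j = 0.
Proof.
transitivity (f (fun i => -1 * (fun=> 0) i + (fun=> 0) i) j).
  by congr (lf f _ _); apply/funext => i; rewrite mulr0 addr0.
by rewrite lfP mulN1r addNr.
Qed.

Fact le_zmod_0 : associative le_add.
Proof. by move=> f g h; apply: lend_ext => x j; exact: addrA. Qed.
Fact le_zmod_1 : commutative le_add.
Proof. by move=> f g; apply: lend_ext => x j; exact: addrC. Qed.
Fact le_zmod_2 : left_id le_zero le_add.
Proof. by move=> f; apply: lend_ext => x j; exact: add0r. Qed.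
Fact le_zmod_3 : left_inverse le_zero le_opp le_add.
Proof. by move=> f; apply: lend_ext => x j; exact: addNr. Qed.
HB.instance Definition _ := @GRing.isZmodule.Build lend le_zero le_opp le_add le_zmod_0 le_zmod_1 le_zmod_2 le_zmod_3.

Fact le_ring_0 : associative le_mul.
Proof. by move=> f g h; apply: lend_ext. Qed.
Fact le_ring_1 : left_id le_one le_mul.
Proof. by move=> f; apply: lend_ext. Qed.
Fact le_ring_2 : right_id le_one le_mul.
Proof. by move=> f; apply: lend_ext. Qed.
Fact le_ring_3 : left_distributive le_mul +%R.
Proof. by move=> f g h; apply: lend_ext. Qed.
Fact le_ring_4 : right_distributive le_mul +%R.
Proof. move=> f g h; apply: lend_ext => x j /=.
have := lfP f 1 (g x) (h x) j; rewrite mul1r => <-.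
by congr (lf f _ _); apply/funext => i; rewrite mul1r. Qed.
Fact le_ring_5 : le_one != 0.
Proof. apply/eqP => /(congr1 (fun f : lend => f (fun=> 1) 0)) /= /eqP; by rewrite oner_eq0. Qed.
HB.instance Definition _ := @GRing.Zmodule_isNzRing.Build lend le_one le_mul le_ring_0 le_ring_1 le_ring_2 le_ring_3 le_ring_4 le_ring_5.

Fact le_lmod_0 : forall a b x, le_scale a (le_scale b x) = le_scale (a * b) x.
Proof. by move=> a b f; apply: lend_ext => x j; exact: mulrA. Qed.
Fact le_lmod_1 : left_id 1 le_scale.
Proof. by move=> f; apply: lend_ext => x j; exact: mul1r. Qed.
Fact le_lmod_2 : right_distributive le_scale +%R.
Proof. by move=> a f g; apply: lend_ext => x j; exact: mulrDr. Qed.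
Fact le_lmod_3 : forall x, {morph le_scale^~ x : a b / a + b}.
Proof. by move=> f a b; apply: lend_ext => x j; exact: mulrDl. Qed.
HB.instance Definition _ := @GRing.Zmodule_isLmodule.Build C lend le_scale le_lmod_0 le_lmod_1 le_lmod_2 le_lmod_3.

Fact le_lalg_0 : forall (a : C) (x y : lend), a *: (x * y) = (a *: x) * y.
Proof. by move=> a x y; apply: lend_ext. Qed.
HB.instance Definition _ := @GRing.Lmodule_isLalgebra.Build C lend le_lalg_0.

Fact le_alg_0 : forall (a : C) (x y : lend), a *: (x * y) = x * (a *: y).
Proof.
move=> a x y; apply: lend_ext => w j /=.
have := lfP x a (y w) (fun=> 0) j; rewrite lend0 addr0 => <-.
by congr (lf x _ _); apply/funext => i; rewrite addr0. Qed.
HB.instance Definition _ := @GRing.Lalgebra_isAlgebra.Build C lend le_alg_0.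

End LinearEndomorphisms.

(** * Laurent polynomials as functions off zero *)

Section LaurentFunctions.
Variable R : realType.
Local Notation C := R[i].

Lemma levalE (m : int) (r : {poly C}) z : z != 0 ->
  leval m r z = \sum_(i < size r) r`_i * z ^ (m + Posz i).
Proof.
move=> z0; rewrite /leval horner_coef mulr_sumr; apply: eq_bigr => i _.
by rewrite expfzDr// mulrCA.
Qed.

Definition laurent (f : C -> C) := exists mr : int * {poly C},
  forall z, z != 0 -> f z = leval mr.1 mr.2 z.

Lemma laurent_lin (c : C) f g : laurent f -> laurent g -> laurent (fun z => c * f z + g z).
Proof.
move=> [[m r] hf] [[m' r'] hg]; pose M := Num.min m m'.
have [k kE] : exists k : nat, m = M + Posz k.
  by exists (absz (m - M)%R); rewrite /M; lia.
have [k' kE'] : exists k : nat, m' = M + Posz k.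
  by exists (absz (m' - M)%R); rewrite /M; lia.
exists (M, c *: ('X^k * r) + 'X^k' * r') => z z0.
rewrite hf// hg// /leval /= hornerD hornerZ !hornerM !hornerXn kE kE' !expfzDr//=.
by rewrite -!exprnP; ring.
Qed.

(** The points [q^(2j)] with [j >= 0] have distinct moduli, so they give the polynomial part more
    roots than its degree allows. *)
Lemma laurent_vanish (q : C) f : q != 0 -> nrm q < 1 -> laurent f ->
  (forall j : int, f (q ^ (2 * j)) = 0) -> forall z, z != 0 -> f z = 0.
Proof.
move=> q0 q1 [[m r] hf] hq z z0; rewrite hf//=; suff -> : r = 0 by rewrite /leval horner0 mulr0.
have rq (j : nat) : root r (q ^+ (2 * j)).
  have := hq (Posz j); rewrite hf ?expfz_neq0// /leval /= => /eqP.
  by rewrite mulf_eq0 expfz_eq0 (negbTE (expfz_neq0 _ q0)) andbF.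
apply/eqP/negPn/negP => r0.
have inj : injective (fun j : nat => q ^+ (2 * j)).
  move=> i j /(congr1 (@nrm R)); rewrite !nrmX => e.
  have : (2 * i = 2 * j)%N.
    by apply: (@ieexprIn _ (nrm q)) e; rewrite ?nrm_gt0// lt_eqF.
  by lia.
have := @max_poly_roots _ r [seq q ^+ (2 * j) | j <- iota 0 (size r)] r0.
rewrite size_map size_iota ltnn map_inj_uniq ?iota_uniq//.
by move=> /(_ _ isT) h;
  have /h : all (root r) [seq q ^+ (2 * j) | j <- iota 0 (size r)] by apply/allP => _ /mapP[j _ ->].
Qed.

End LaurentFunctions.

(** * Spanning monomials, grading, and the trace conditions *)

Section GeneralizedWeyl.
Variables (R : realType) (A : algType R[i]) (u v Z Zi : A) (q : R[i]) (l : int) (p : {poly R[i]}).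
Local Notation C := R[i].
Hypothesis pres : is_presented u v Z Zi q l p.
Hypotheses (q0 : q != 0) (q1 : nrm q < 1).

Let ZZi : Z * Zi = 1. Proof. by case: pres => [[[]]]. Qed.
Let ZiZ : Zi * Z = 1. Proof. by case: pres => [[[]]]. Qed.
Let zp := zpow Z Zi.
Let zpDE a b : zp (a + b) = zp a * zp b. Proof. exact: zpowD. Qed.

Let Zu : Z * u = q ^+ 2 *: (u * Z).
Proof. by case: pres => [[_ h _ _ _] _]; rewrite scalerAl -h -!mulrA ZiZ mulr1. Qed.
Let Zv : Z * v = q ^- 2 *: (v * Z).
Proof. by case: pres => [[_ _ h _ _] _]; rewrite scalerAl -h -!mulrA ZiZ mulr1. Qed.
Let uvE : u * v = \sum_(i < size p) (p`_i * q ^ (- (l + Posz i))) *: zp (l + Posz i).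
Proof.
case: pres => [[_ _ _ -> _] _]; rewrite -{2}[q]invrK aeval_scaleE ?invr_eq0//.
by apply: eq_bigr => i _; rewrite exprz_inv.
Qed.
Let vuE : v * u = \sum_(i < size p) (p`_i * q ^ (l + Posz i)) *: zp (l + Posz i).
Proof. by case: pres => [[_ _ _ _ ->] _]; rewrite aeval_scaleE. Qed.

Lemma zpow_comm x (k : C) m : k != 0 -> Z * x = k *: (x * Z) -> zp m * x = k ^ m *: (x * zp m).
Proof.
move=> k0 h; have h' : Zi * x = k^-1 *: (x * Zi).
  apply: (scalerI k0); rewrite scalerA divff// scale1r -[LHS]mulr1 -ZZi.
  have : Zi * (Z * x) * Zi = Zi * (k *: (x * Z)) * Zi by rewrite h.
  rewrite mulrA ZiZ mul1r => ->.
  by rewrite -!scalerAr -!scalerAl !mulrA.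
elim: m => [|n ih|n ih]; first by rewrite /zp zpow0 mul1r mulr1 scale1r.
  rewrite -addn1 PoszD /zp zpowS// -mulrA ih -scalerAr mulrA h -scalerAl scalerA.
  by rewrite -mulrA expfzDr// expr1z.
rewrite -addn1 PoszD opprD /zp zpowB// -mulrA ih -scalerAr mulrA h' -scalerAl scalerA.
by rewrite -mulrA expfzDr.
Qed.

Let zu m : zp m * u = q ^ (2 * m) *: (u * zp m).
Proof. by rewrite (zpow_comm m _ Zu) ?expf_neq0//; congr (_ *: _); exact: (exprz_exp q 2 m). Qed.
Let zv m : zp m * v = q ^ (- 2 * m) *: (v * zp m).
Proof.
rewrite (zpow_comm m _ Zv) ?invr_eq0 ?expf_neq0//; congr (_ *: _).
exact: (exprz_exp q (-2) m).
Qed.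

Definition mon (i m : int) : A :=
  match i with Posz n => u ^+ n * zp m | Negz n => v ^+ n.+1 * zp m end.

(** The linear span of the monomials, encoded as membership in every predicate that contains them
    and is closed under linear combinations; [span_ind] is then immediate. *)
Definition inspan (a : A) := forall Q : A -> Prop, Q 0 ->
  (forall (c : C) x y, Q x -> Q y -> Q (c *: x + y)) -> (forall i m, Q (mon i m)) -> Q a.

Lemma inspan_lin (c : C) x y : inspan x -> inspan y -> inspan (c *: x + y).
Proof. by move=> hx hy Q Q0 QL Qm; apply: (QL); [exact: hx|exact: hy]. Qed.
Lemma inspan0 : inspan 0. Proof. by []. Qed.
Lemma inspanZ (c : C) x : inspan x -> inspan (c *: x).
Proof. by move=> hx; rewrite -[_ *: _]addr0; apply: inspan_lin => //; exact: inspan0. Qed.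
Lemma inspan_mon i m : inspan (mon i m). Proof. by move=> Q _ _; apply. Qed.
Lemma inspan_sum I (s : seq I) (F : I -> A) : (forall i, inspan (F i)) -> inspan (\sum_(i <- s) F i).
Proof.
move=> h; elim: s => [|i s ih]; rewrite ?big_nil ?big_cons; first exact: inspan0.
by rewrite -[F i]scale1r; exact: inspan_lin.
Qed.

Lemma inspan_mulr x : (forall i m, inspan (mon i m * x)) -> forall a, inspan a -> inspan (a * x).
Proof.
move=> h a ha; apply: (ha (fun a => inspan (a * x))) => [|c y z hy hz|//].
  by rewrite mul0r; exact: inspan0.
by rewrite mulrDl -scalerAl; exact: inspan_lin.
Qed.

(** [presented_ind] wants a predicate closed under products, which is not evident for the span. The
    predicate used on [x] is that right multiplication by [x] preserves the span; it is then applied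
    to the element [1]. *)
Lemma inspan_all a : inspan a.
Proof.
rewrite -[a]mul1r; have : inspan 1.
  by rewrite (_ : 1 = mon 0 0); [exact: inspan_mon|exact: (esym (mulr1 (1 : A)))].
move: (1 : A); apply: (@presented_ind R A (fun x => forall b, inspan b -> inspan (b * x)) _ _ _ _ _ _ _ _ _ _ pres).
- by move=> c x y hx hy b hb; rewrite mulrDr -scalerAr; apply: inspan_lin; [exact: hx|exact: hy].
- by move=> x y hx hy b /hx/hy; rewrite mulrA.
- by move=> b; rewrite mulr1.
- apply: inspan_mulr => -[n|n] m; rewrite /mon -mulrA zu -scalerAr mulrA; apply: inspanZ.
    by rewrite -exprSr; exact: (inspan_mon (Posz n.+1)).
  rewrite exprSr -[v ^+ n * v * u]mulrA vuE mulr_sumr mulr_suml; apply: inspan_sum => i.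
  rewrite -scalerAr -scalerAl; apply: inspanZ; rewrite -mulrA -zpDE.
  by case: n => [|n]; [exact: (inspan_mon 0)|exact: (inspan_mon (Negz n))].
- apply: inspan_mulr => -[n|n] m; rewrite /mon -mulrA zv -scalerAr mulrA; apply: inspanZ.
    case: n => [|n]; first by rewrite expr0 mul1r; exact: (inspan_mon (Negz 0)).
    rewrite exprSr -[u ^+ n * u * v]mulrA uvE mulr_sumr mulr_suml; apply: inspan_sum => i.
    rewrite -scalerAr -scalerAl; apply: inspanZ; rewrite -mulrA -zpDE.
    exact: (inspan_mon (Posz n)).
  by rewrite -exprSr; exact: (inspan_mon (Negz n.+1)).
- apply: inspan_mulr => i m; rewrite (_ : mon i m * Z = mon i (m + 1)); first exact: inspan_mon.
  by case: i => n; rewrite /mon zpDE mulrA.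
- apply: inspan_mulr => i m; rewrite (_ : mon i m * Zi = mon i (m - 1)); first exact: inspan_mon.
  by case: i => n; rewrite /mon zpDE mulrA.
Qed.

Lemma span_ind (Q : A -> Prop) : Q 0 -> (forall (c : C) x y, Q x -> Q y -> Q (c *: x + y)) ->
  (forall i m, Q (mon i m)) -> forall a, Q a.
Proof. by move=> Q0 QL Qm a; exact: inspan_all. Qed.

Lemma gradedM i j a b : graded Z Zi q i a -> graded Z Zi q j b -> graded Z Zi q (i + j) (a * b).
Proof.
rewrite /graded => ha hb; have -> : Z * (a * b) * Zi = (Z * a * Zi) * (Z * b * Zi).
  by rewrite -!mulrA [Zi * (Z * _)]mulrA ZiZ mul1r.
by rewrite ha hb -scalerAl -scalerAr scalerA -expfzDr// mulrDr.
Qed.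

Lemma graded1 : graded Z Zi q 0 1.
Proof. by rewrite /graded mulr1 ZZi mulr0 scale1r. Qed.

Lemma gradedX i a n : graded Z Zi q i a -> graded Z Zi q (i * Posz n) (a ^+ n).
Proof.
move=> ha; elim: n => [|n ih]; first by rewrite mulr0; exact: graded1.
by rewrite exprS -add1n PoszD mulrDr mulr1; exact: gradedM.
Qed.

Lemma graded_u : graded Z Zi q 1 u.
Proof. by rewrite /graded mulr1; case: pres => [[]]. Qed.
Lemma graded_v : graded Z Zi q (-1) v.
Proof. by rewrite /graded mulrN1; case: pres => [[]]. Qed.
Lemma graded_zpow m : graded Z Zi q 0 (zp m).
Proof.
rewrite /graded mulr0 scale1r -[Z in LHS](zpow1 Z Zi) -[Zi in LHS](zpowN1 Z Zi) -/zp.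
by rewrite -!zpDE; congr zpow; lia.
Qed.

Lemma graded_mon i m : graded Z Zi q i (mon i m).
Proof.
case: i => n; rewrite /mon.
  by rewrite -[Posz n]addr0 -[Posz n]mul1r; apply: gradedM (gradedX n graded_u) (graded_zpow m).
have -> : Negz n = -1 * Posz n.+1 + 0 by lia.
exact: gradedM (gradedX n.+1 graded_v) (graded_zpow m).
Qed.

Section Traces.
Variables (t : C) (T : A -> C).
Hypotheses (t0 : t != 0) (TL : is_lin T).

Let T0 : T 0 = 0.
Proof. by have := TL (-1) 0 0; rewrite scaler0 addr0 mulN1r addNr. Qed.
Let TZ (c : C) x : T (c *: x) = c * T x.
Proof. by have := TL c x 0; rewrite T0 !addr0. Qed.
Let TD x y : T (x + y) = T x + T y.
Proof. by have := TL 1 x y; rewrite scale1r mul1r. Qed.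
Let Tsum I (s : seq I) (F : I -> A) : T (\sum_(i <- s) F i) = \sum_(i <- s) T (F i).
Proof. by elim: s => [|i s ih]; rewrite ?big_nil// !big_cons TD ih. Qed.

Definition trace_relation := forall m : int,
  \sum_(i < size p) p`_i * q ^ (- (l + Posz i)) * T (zp (m + l + Posz i)) =
     t * q ^ (2 * m) * \sum_(i < size p) p`_i * q ^ (l + Posz i) * T (zp (m + l + Posz i)).

Lemma T_uv m : T (u * v * zp m) =
  \sum_(i < size p) p`_i * q ^ (- (l + Posz i)) * T (zp (m + l + Posz i)).
Proof.
rewrite uvE mulr_suml Tsum; apply: eq_bigr => i _.
by rewrite -scalerAl TZ -zpDE; congr (_ * T (zp _)); lia.
Qed.

Lemma T_vu m : T (v * u * zp m) =
  \sum_(i < size p) p`_i * q ^ (l + Posz i) * T (zp (m + l + Posz i)).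
Proof.
rewrite vuE mulr_suml Tsum; apply: eq_bigr => i _.
by rewrite -scalerAl TZ -zpDE; congr (_ * T (zp _)); lia.
Qed.

(** [twisted_trace] quantifies over all [g] with the prescribed values. Existence keeps that
    condition from being vacuous: the rescaled generators satisfy the relations again. *)
Lemma exists_gt_aut : exists g : A -> A, gt_aut u v Z Zi t g.
Proof.
case: pres => rel univ; case: (rel) => [[r1 r2] r3 r4 r5 r6].
have rel' : gwa_rel (t *: u) (t^-1 *: v) Z Zi q l p.
  split=> //; rewrite ?(=^~scalerAl, =^~scalerAr).
  - by rewrite r3 !scalerA mulrC.
  - by rewrite r4 !scalerA mulrC.
  - by rewrite scalerA divff// scale1r.
  - by rewrite scalerA mulVf// scale1r.
by have [g [hg [gu gv] gZ gZi _]] := univ _ _ _ _ _ rel'; exists g; split.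
Qed.

(** Conjugation by [Z] gives [T a = q^(2i) T a], and [q] is not a root of unity since [|q| < 1]. *)
Lemma graded_conj i a : (forall b, T (Z * b) = T (b * Z)) -> i != 0 -> graded Z Zi q i a -> T a = 0.
Proof.
move=> hZ i0 ga; have : T a = q ^ (2 * i) * T a.
  by rewrite -TZ -ga -mulrA hZ -mulrA ZiZ mulr1.
move/eqP; rewrite -subr_eq0 -[X in X - _]mul1r -mulrBl mulf_eq0 subr_eq0 => /orP[/eqP e|/eqP//].
have := congr1 (@nrm R) e; rewrite nrm1.
have qn (n : nat) : (0 < n)%N -> nrm (q ^+ n) < 1.
  by move=> n0; rewrite nrmX exprn_ilt1 ?nrm_ge0// -lt0n.
have ql (k : int) : k != 0 -> nrm (q ^ k) != 1.
  case: k => n n0; first by rewrite lt_eqF// qn// lt0n.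
  rewrite (_ : q ^ Negz n = (q ^+ n.+1)^-1)// nrmV invr_eq1; by rewrite lt_eqF// qn.
by move/esym/eqP; rewrite (negbTE (ql _ _))//; lia.
Qed.

Lemma twisted_traceP : twisted_trace u v Z Zi t T ->
  (forall i a, i != 0 -> graded Z Zi q i a -> T a = 0) /\ trace_relation.
Proof.
move=> [_ hT]; have [g hg] := exists_gt_aut.
have h := hT g hg; case: hg => _ gu gv gZ gZi; split.
  by move=> i a i0; apply: graded_conj => // b; rewrite h gZ.
move=> m; have := h u (v * zp m); rewrite gu -scalerAr TZ mulrA T_uv => ->.
by rewrite -[v * zp m * u]mulrA zu -scalerAr TZ [v * (u * _)]mulrA T_vu mulrA.
Qed.

(** The set of [a] for which the identity holds with all [b] is a subalgebra, so generators suffice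
    for [a] and monomials for [b]. With [u] and [v] only monomials of the opposite degree
    contribute, and there the identity is [trace_relation]; with [Z] and [Zi] only degree [0]
    contributes. *)
Lemma twisted_trace_of : (forall i a, i != 0 -> graded Z Zi q i a -> T a = 0) ->
  trace_relation -> twisted_trace u v Z Zi t T.
Proof.
move=> Tg rel; split => // g [hg gu gv gZ gZi].
have lin (x y : A) : (forall i m, T (x * mon i m) = T (mon i m * y)) -> forall b, T (x * b) = T (b * y).
  move=> h; apply: span_ind => [|c b b' hb hb'|//]; first by rewrite mulr0 mul0r.
  by rewrite mulrDr mulrDl -scalerAr -scalerAl !TL hb hb'.
apply: (@presented_ind R A (fun a => forall b, T (a * b) = T (b * g a)) _ _ _ _ _ _ _ _ _ _ pres).
- move=> c x y hx hy b; rewrite mulrDl -scalerAl TL hx hy (homL hg) mulrDr -scalerAr.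
  by rewrite TL.
- by move=> x y hx hy b; rewrite -mulrA hx -mulrA hy -mulrA (homM hg).
- by move=> b; rewrite (hom1 hg) mul1r mulr1.
- rewrite gu; apply: lin => i m; rewrite -scalerAr TZ.
  case: (eqVneq i (-1)) => [->|i1]; last first.
    have gi := graded_mon i m; have i10 : 1 + i != 0 by apply: contraNneq i1 => h; apply/eqP; lia.
    have i01 : i + 1 != 0 by rewrite addrC.
    by rewrite (Tg _ _ i10 (gradedM graded_u gi)) (Tg _ _ i01 (gradedM gi graded_u)) mulr0.
  rewrite (_ : mon (-1) m = v * zp m) ?mulrA ?T_uv// rel.
  by rewrite -[v * zp m * u]mulrA zu -scalerAr TZ [v * (u * _)]mulrA T_vu mulrA.
- rewrite gv; apply: lin => i m; rewrite -scalerAr TZ.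
  case: (eqVneq i 1) => [->|i1]; last first.
    have gi := graded_mon i m; have i10 : -1 + i != 0 by apply: contraNneq i1 => h; apply/eqP; lia.
    have i01 : i + -1 != 0 by rewrite addrC.
    by rewrite (Tg _ _ i10 (gradedM graded_v gi)) (Tg _ _ i01 (gradedM gi graded_v)) mulr0.
  rewrite (_ : mon 1 m = u * zp m) ?mulrA ?T_vu//.
  rewrite -[u * zp m * v]mulrA zv -scalerAr TZ [u * (v * _)]mulrA T_uv rel !mulrA.
  rewrite [t^-1 * _ * t]mulrAC mulVf// mul1r -expfzDr//.
  by rewrite mulNr addNr mul1r.
- rewrite gZ; apply: lin => i m; case: (eqVneq i 0) => [->|i0].
    rewrite (_ : mon 0 m = zp m); last exact: mul1r.
    congr (T _); transitivity (zp (1 + m)); first by rewrite zpDE.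
    by rewrite addrC zpDE.
  have gi := graded_mon i m; have gZ' := graded_zpow 1.
  have := Tg _ _ i0; rewrite -{1}(add0r i) => /(_ _ (gradedM gZ' gi)) ->.
  by have := Tg _ _ i0; rewrite -{1}(addr0 i) => /(_ _ (gradedM gi gZ')) ->.
- rewrite gZi; apply: lin => i m; case: (eqVneq i 0) => [->|i0].
    rewrite (_ : mon 0 m = zp m); last exact: mul1r.
    congr (T _); transitivity (zp (-1 + m)); first by rewrite zpDE.
    by rewrite addrC zpDE.
  have gi := graded_mon i m; have gZ' := graded_zpow (-1).
  have := Tg _ _ i0; rewrite -{1}(add0r i) => /(_ _ (gradedM gZ' gi)) ->.
  by have := Tg _ _ i0; rewrite -{1}(addr0 i) => /(_ _ (gradedM gi gZ')) ->.
Qed.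

End Traces.

(* The action of the algebra on sequences indexed by the integers, in which Z is diagonal with
   the distinct eigenvalues [q ^ (2 j)], u is the shift and v a weighted backward shift. *)
Lemma diagonal_model : exists d : A -> int -> C,
  [/\ forall (c : C) x y j, d (c *: x + y) j = c * d x j + d y j,
      forall i a j, i != 0 -> graded Z Zi q i a -> d a j = 0 &
      forall m j, d (zp m) j = (q ^ (2 * j)) ^ m].
Proof.
have UL (c : C) (x y : int -> C) (j : int) : c * x (j - 1) + y (j - 1) = c * x (j - 1) + y (j - 1) by [].
(* Forced by [v u = P(q Z)]: the operator [V U] multiplies the [j]-th entry by [W j], and [Z] has
   the eigenvalue [q^(2j)] there. *)
pose W j := leval l p (q ^ (2 * j + 1)).
have VL (c : C) (x y : int -> C) j : W j * (c * x (j + 1) + y (j + 1)) = c * (W j * x (j + 1)) + W j * y (j + 1).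
  by rewrite mulrDr mulrCA.
have DL (m : int) (c : C) (x y : int -> C) j :
   (q ^ (2 * j)) ^ m * (c * x j + y j) = c * ((q ^ (2 * j)) ^ m * x j) + (q ^ (2 * j)) ^ m * y j.
  by rewrite mulrDr mulrCA.
pose U : lend R := @Lend R (fun x j => x (j - 1)) UL.
pose V : lend R := @Lend R (fun x j => W j * x (j + 1)) VL.
pose D m : lend R := @Lend R (fun x j => (q ^ (2 * j)) ^ m * x j) (DL m).
have q2 j : q ^ (2 * j) != 0 :> C by rewrite expfz_neq0.
have DM a b : D a * D b = D (a + b).
  by apply: lend_ext => x j; rewrite /= mulrA -(expfzDr _ _ (q2 j)).
have D0 : D 0 = 1 by apply: lend_ext => x j; rewrite /= mul1r.
have D1 : D 1 * D (-1) = 1 by rewrite DM.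
have D1' : D (-1) * D 1 = 1 by rewrite DM.
have zD m : zpow (D 1) (D (-1)) m = D m.
  elim: m => [|n ih|n ih]; first by rewrite D0.
    by rewrite -addn1 PoszD zpowS// ih DM addrC.
  by rewrite -addn1 PoszD opprD zpowB// ih DM addrC.
have lfD (f g : lend R) x j : (f + g) x j = f x j + g x j by [].
have lfZ (c : C) (f : lend R) x j : (c *: f) x j = c * f x j by [].
have lfM (f g : lend R) x j : (f * g) x j = f (g x) j by [].
have lf_sum I (s : seq I) (F : I -> lend R) x j : (\sum_(i <- s) F i) x j = \sum_(i <- s) F i x j.
  by elim: s => [|i s ih]; rewrite ?big_nil ?big_cons// lfD ih.
have ev (k : C) x j : k != 0 -> aeval (k *: D 1) (k^-1 *: D (-1)) l p x j = leval l p (k * q ^ (2 * j)) * x j.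
  move=> k0; rewrite aeval_scaleE// lf_sum levalE ?mulf_neq0// mulr_suml; apply: eq_bigr => i _.
  by rewrite lfZ zD /= exprzMl ?unitfE// !mulrA.
have rel : gwa_rel U V (D 1) (D (-1)) q l p.
  split=> //; apply: lend_ext => x j.
  - rewrite /= mulrA; congr (_ * _); rewrite expr1z exprN1 invr_expz -expfzDr//.
    by rewrite (_ : _ + _ = 2)//; lia.
  - rewrite /= expr1z exprN1 mulrCA [RHS]mulrCA; congr (_ * _); rewrite mulrA; congr (_ * _).
    by rewrite invr_expz -expfzDr// (_ : _ + _ = -2)//; lia.
  - rewrite -{2}[q]invrK ev ?invr_eq0// lfM /= (_ : j - 1 + 1 = j); last by lia.
    congr (_ * _); rewrite /W; congr leval; rewrite -exprN1 -expfzDr//.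
    by congr (_ ^ _); lia.
  - rewrite ev// lfM /= (_ : j + 1 - 1 = j); last by lia.
    congr (_ * _); rewrite /W; congr leval; rewrite -{2}[q]expr1z -expfzDr//.
    by congr (_ ^ _); lia.
have [f [hf _ fZ fZi _]] := pres.2 _ _ _ _ _ rel.
(* [d a] is the diagonal of the matrix of [f a]. Conjugation by [Z] fixes diagonal entries but
   multiplies degree [i] by [q^(2i)], so nonzero degrees have zero diagonal. *)
exists (fun a j => f a (fun i => (i == j)%:R) j); split.
- by move=> c x y j; rewrite (homL hf) lfD lfZ.
- move=> i a j i0 ga; have e : D 1 * f a * D (-1) = q ^ (2 * i) *: f a.
    by rewrite -fZ -fZi -!(homM hf) ga (homZ hf).
  have := congr1 (fun F : lend R => F (fun k => (k == j)%:R) j) e.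
  rewrite lfZ !lfM /=.
  rewrite (_ : (fun j0 : int => _) = fun k => (q ^ (2 * j)) ^ (-1) * (k == j)%:R + (fun=> 0) k); last first.
    by apply/funext => k; rewrite addr0; case: eqVneq => [->//|_]; rewrite !mulr0.
  rewrite lfP lend0 addr0 mulrA -expfzDr// mul1r => /eqP; rewrite -subr_eq0 -[X in X - _]mul1r.
  rewrite -mulrBl mulf_eq0 subr_eq0 => /orP[|/eqP//].
  move/eqP => e1; have := congr1 (@nrm R) e1; rewrite nrm1.
  have qn (n : nat) : (0 < n)%N -> nrm (q ^+ n) < 1.
    by move=> n0; rewrite nrmX exprn_ilt1 ?nrm_ge0// -lt0n.
  have ql (k : int) : k != 0 -> nrm (q ^ k) != 1.
    case: k => n n0; first by rewrite lt_eqF// qn// lt0n.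
    rewrite (_ : q ^ Negz n = (q ^+ n.+1)^-1)// nrmV invr_eq1; by rewrite lt_eqF// qn.
  by move/esym/eqP; rewrite (negbTE (ql _ _))//; lia.
- by move=> m j; rewrite (hom_zpow hf) fZ fZi zD /= eqxx mulr1.
Qed.

End GeneralizedWeyl.

(** * Quasi-periodic weights *)

Section Exponentials.
Variable R : realType.
Local Notation C := R[i].

Lemma ImD (z y : C) : complex.Im (z + y) = complex.Im z + complex.Im y. Proof. exact: raddfD. Qed.
Lemma ImB (z y : C) : complex.Im (z - y) = complex.Im z - complex.Im y. Proof. exact: raddfB. Qed.

Lemma two_real : 2%:C = 2 :> C. Proof. exact: (rmorph_nat (real_complex R) 2). Qed.

Lemma horner_ex_diff (al : C) (p : {poly C}) z : diff_at (fun y => p.[al * ex y]) z.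
Proof. by apply: diff_at_horner; apply: diff_atM (diff_at_cst _ _) (diff_at_ex _). Qed.

Lemma leval_ex_diff (al : C) l (p : {poly C}) z : al != 0 -> diff_at (fun y => leval l p (al * ex y)) z.
Proof.
move=> al0; apply: diff_atM (horner_ex_diff _ _ _).
by apply: diff_at_exprz; [rewrite mulf_neq0 ?ex_neq0|exact: diff_atM (diff_at_cst _ _) (diff_at_ex _)].
Qed.

Lemma ex_sub_caratheodory (al r z : C) : al != 0 -> al * ex z = r ->
  exists phi, [/\ cont_at phi z, phi z != 0 & forall y, al * ex y - r = phi y * (y - z)].
Proof.
move=> al0 <-; have [phi [c1 c2 c3]] := ex_caratheodory z.
exists (fun y => al * phi y); split; [exact: cont_atM (cont_at_cst _ _) c1|exact: mulf_neq0|].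
by move=> y; rewrite -mulrBr c3 addrAC subrr add0r mulrA.
Qed.

Lemma ex_sub_pnear (al r z : C) : al != 0 -> pnear_at z (fun y => al * ex y - r != 0).
Proof.
move=> al0; case: (eqVneq (al * ex z) r) => [e|ne].
  by have [phi [c1 c2 c3]] := ex_sub_caratheodory al0 e; exact: simple_zero_pnear c3.
apply: near_at_pnear; apply: (@cont_at_neq0 _ (fun y => al * ex y - r)); last by rewrite subr_eq0.
apply: cont_atD (cont_at_cst _ _); apply: diff_at_cont.
exact: diff_atM (diff_at_cst _ _) (diff_at_ex _).
Qed.

(** Factoring [p] over the algebraically closed field [R[i]] reduces the isolation of zeros to
    [al * ex y - r], whose zeros are simple because [ex] has nonzero derivative. *)
Lemma horner_ex_pnear (al : C) (p : {poly C}) z : al != 0 -> p != 0 -> pnear_at z (fun y => p.[al * ex y] != 0).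
Proof.
move=> al0 p0; have [rs prs] := closed_field_poly_normal p.
have l0 : lead_coef p != 0 by rewrite lead_coef_eq0.
suff : pnear_at z (fun y => (\prod_(r <- rs) ('X - r%:P)).[al * ex y] != 0).
  by apply: pnear_at_imp => y h; rewrite prs hornerZ mulf_neq0.
elim: rs {prs} => [|r rs ih].
  by apply: near_at_pnear; apply: near_atT => y; rewrite big_nil hornerC oner_neq0.
have := pnear_atI (ex_sub_pnear r z al0) ih; apply: pnear_at_imp => y [h1 h2].
by rewrite big_cons hornerM hornerXsubC mulf_neq0.
Qed.

Lemma leval_ex_pnear (al : C) l (p : {poly C}) z : al != 0 -> p != 0 ->
  pnear_at z (fun y => leval l p (al * ex y) != 0).
Proof.
move=> al0 p0; apply: pnear_at_imp (horner_ex_pnear z al0 p0) => y h.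
by rewrite mulf_neq0// expfz_neq0// mulf_neq0// ex_neq0.
Qed.

End Exponentials.

(** * Fourier analysis of an admissible weight on the strip *)

Section Admissible.
Variables (R : realType) (tau q t : R[i]) (l : int) (p : {poly R[i]}).
Local Notation C := R[i].
Hypotheses (tau0 : 0 < complex.Im tau) (qE : q = expC (pi%:C * 'i%C * tau)) (t0 : t != 0) (p0 : p != 0).

Lemma ex_half : ex (tau / 2%:C) = q.
Proof. by rewrite qE /ex two_real; congr expC; field. Qed.

Lemma nome_neq0 : q != 0. Proof. by rewrite -ex_half ex_neq0. Qed.
Let q0 := nome_neq0.

Lemma half_half : tau / 2%:C + tau / 2%:C = tau.
Proof. by rewrite two_real; field. Qed.

Lemma ex_tau : ex tau = q ^+ 2.
Proof. by rewrite -half_half exD ex_half expr2. Qed.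

Lemma Im_half : complex.Im (tau / 2%:C) = complex.Im tau / 2.
Proof. rewrite -fmorphV /=; case: tau => a b /=; ring. Qed.

Lemma nrm_nome_lt1 : nrm q < 1.
Proof.
rewrite -ex_half nrm_ex Im_half -[ltRHS]expR0 ltr_expR oppr_lt0.
by rewrite !mulr_gt0 ?pi_gt0// invr_gt0.
Qed.

Definition strip (z : C) := `|complex.Im z| <= complex.Im tau / 2.

Lemma stripE z : strip z <-> `|(complex.Im z)%:C| <= (complex.Im tau / 2)%:C :> C.
Proof. by rewrite nrmE lecR nrm_real. Qed.

Lemma strip_point (s r : R) : - 2^-1 <= r <= 2^-1 -> strip (s%:C + r%:C * tau).
Proof.
move=> hr; rewrite /strip (_ : complex.Im _ = r * complex.Im tau); last by case: tau => a b /=; ring.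
by rewrite normrM [leRHS]mulrC (gtr0_norm tau0) ler_pM2r// ler_norml.
Qed.

Lemma strip_coord z : strip z -> exists s r : R, - 2^-1 <= r <= 2^-1 /\ z = s%:C + r%:C * tau.
Proof.
move=> hz; pose r := complex.Im z / complex.Im tau.
exists (complex.Re z - r * complex.Re tau), r; split.
  rewrite -ler_norml normrM normfV (gtr0_norm tau0) ler_pdivrMr// mulrC; exact: hz.
have rE : r * complex.Im tau = complex.Im z by rewrite /r divfK// gt_eqF.
apply/eqP; rewrite eq_complex; move: rE; case: (z) (tau) => a b [c d] /= rE.
by apply/andP; split; apply/eqP; rewrite -?rE; ring.
Qed.

(** The bridge between integrals of [w(x) P(al e(x)) e(k x)] and the finite sums over moments that
    occur in [trace_relation]. *)
Lemma cint_leval (w : C -> C) (al : C) (k m : int) (r : {poly C}) : (forall x : R, diff_at w x%:C) -> al != 0 ->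
  cint 0 1 (fun x => w x%:C * leval m r (al * ex x%:C) * ex (k%:~R * x%:C)) =
  \sum_(i < size r) r`_i * al ^ (m + Posz i) * cint 0 1 (fun x => w x%:C * ex ((k + m + Posz i)%:~R * x%:C)).
Proof.
move=> wR al0; have cw : cpath 0 1 (fun x => w x%:C).
  by apply: (cpath_comp (@cpath_real _ 0 1)) => x _; exact: diff_at_cont.
have cwe j : cpath 0 1 (fun x => w x%:C * ex (j%:~R * x%:C)) by apply: cpathM cw (@cpath_exZ _ 0 1 _).
have [_ e] := @cint_sum R 'I_(size r) (index_enum _)
  (fun i x => r`_i * al ^ (m + Posz i) * (w x%:C * ex ((k + m + Posz i)%:~R * x%:C))) 0 1
  (fun i => cpathM (@cpath_cst _ 0 1 _) (cwe _)).
transitivity (\sum_(i < size r) cint 0 1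
   (fun x => r`_i * al ^ (m + Posz i) * (w x%:C * ex ((k + m + Posz i)%:~R * x%:C)))); last first.
  by apply: eq_bigr => i _; rewrite cintZ.
rewrite -e; apply: eq_cint => x _; rewrite levalE; last by rewrite mulf_neq0 ?ex_neq0.
rewrite mulr_sumr mulr_suml.
apply: eq_bigr => i _; rewrite !intrD !mulrDl !exD !exMz exprzMl ?unitfE ?ex_neq0//.
rewrite [ex _ ^ (m + _)]expfzDr ?ex_neq0//.
move: (w _) (r`_i) (al ^ _) (ex _ ^ k) (ex _ ^ m) (ex _ ^ Posz i).
by move=> *; ring.
Qed.

Section OneWeight.
Variables (w h : C -> C) (O : C -> Prop).
Hypotheses (wR : forall x : R, diff_at w x%:C)
  (w1 : forall z, pnear_at z (fun y => w (y + 1) = w y))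
  (wt : forall z, pnear_at z (fun y => w (y + tau) = t * w y))
  (oO : forall z, O z -> near_at z O) (sO : forall z, strip z -> O z)
  (hO : forall z, O z -> diff_at h z)
  (hw : forall z, O z -> pnear_at z (fun y => h y = w (y + tau / 2%:C) * leval l p (ex y))).

Let hstrip z : strip z -> diff_at h z. Proof. by move=> /sO/hO. Qed.

Lemma strip_half (x : R) : strip (x%:C - tau / 2%:C) /\ strip (x%:C + tau / 2%:C).
Proof.
rewrite /strip ImB ImD Im_half sub0r add0r normrN ger0_norm ?lexx//.
by rewrite divr_ge0// ltW.
Qed.

Lemma near_lower z : O (z - tau / 2%:C) ->
  pnear_at z (fun y => h (y - tau / 2%:C) = w y * leval l p (q^-1 * ex y)).
Proof.
move=> /hw/pnear_at_shift; apply: pnear_at_imp => y ->.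
by rewrite subrK exD exN ex_half [ex y * _]mulrC.
Qed.

Lemma near_upper z : O (z + tau / 2%:C) ->
  pnear_at z (fun y => h (y + tau / 2%:C) = t * w y * leval l p (q * ex y)).
Proof.
move=> /hw/pnear_at_shift/(pnear_atI (wt z)); apply: pnear_at_imp => y [wy ->].
by rewrite -addrA half_half wy exD ex_half [ex y * q]mulrC.
Qed.

(** The relation defining [h] is known only off a discrete set, but on the lower edge both sides are
    continuous, since [w] is differentiable on the real line. *)
Lemma h_lower (x : R) : h (x%:C - tau / 2%:C) = w x%:C * leval l p (q^-1 * ex x%:C).
Proof.
have [s1 _] := strip_half x.
apply: (@cont_at_eq _ (fun y => h (y - tau / 2%:C)) (fun y => w y * leval l p (q^-1 * ex y))).
- apply: (@cont_at_comp _ (fun y => y - tau / 2%:C)); last exact: diff_at_cont (hstrip s1).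
  by apply: cont_atD; [exact: cont_at_id|exact: cont_at_cst].
- apply: cont_atM; first exact: diff_at_cont.
  by apply/diff_at_cont/leval_ex_diff; rewrite invr_eq0.
- exact: near_lower (sO s1).
Qed.

Lemma h_upper (x : R) : h (x%:C + tau / 2%:C) = t * w x%:C * leval l p (q * ex x%:C).
Proof.
have [_ s1] := strip_half x.
apply: (@cont_at_eq _ (fun y => h (y + tau / 2%:C)) (fun y => t * w y * leval l p (q * ex y))).
- apply: (@cont_at_comp _ (fun y => y + tau / 2%:C)); last exact: diff_at_cont (hstrip s1).
  by apply: cont_atD; [exact: cont_at_id|exact: cont_at_cst].
- apply: cont_atM; first by apply: cont_atM; [exact: cont_at_cst|exact: diff_at_cont].
  exact/diff_at_cont/leval_ex_diff.
- exact: near_upper (sO s1).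
Qed.

Lemma strip1 z : strip z -> strip (z + 1).
Proof. by rewrite /strip raddfD /= addr0. Qed.

Lemma h_periodic z : strip z -> h (z + 1) = h z.
Proof.
move=> sz; apply: (@cont_at_eq _ (fun y => h (y + 1)) h).
- apply: (@cont_at_comp _ (fun y => y + 1)); last by apply/diff_at_cont/hstrip/strip1.
  by apply: cont_atD; [exact: cont_at_id|exact: cont_at_cst].
- exact/diff_at_cont/hstrip.
- have a1 := pnear_at_shift (hw (sO (strip1 sz))).
  have a2 := pnear_at_shift (w1 (z + tau / 2%:C)).
  apply: pnear_at_imp (pnear_atI a1 (pnear_atI a2 (hw (sO sz)))) => y [-> [e ->]].
  by rewrite exD1 addrAC e.
Qed.

(** Goursat's theorem between the heights [-1/2] and [r]: every horizontal Fourier coefficient of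
    [h] equals the one on the lower edge, where [h] is expressed by [w]. The factor is
    [e(- m tau / 2)]. *)
Lemma h_ex_hor (m : int) (r : R) : - 2^-1 <= r <= 2^-1 ->
  hor tau (fun z => h z * ex (m%:~R * z)) r 0 1 =
  q ^ (- m) * cint 0 1 (fun x => w x%:C * leval l p (q^-1 * ex x%:C) * ex (m%:~R * x%:C)).
Proof.
move=> /andP[r1 r2]; pose f z := h z * ex (m%:~R * z).
have df s r' : 0 <= s <= 1 -> - 2^-1 <= r' <= r -> diff_at f (s%:C + r'%:C * tau).
  move=> _ /andP[h1 h2]; apply: diff_atM.
    by apply: hstrip; apply: strip_point; rewrite h1 (le_trans h2).
  apply: (@diff_at_comp _ (fun z => m%:~R * z)); last exact: diff_at_ex.
  by apply: diff_atM; [exact: diff_at_cst|exact: diff_at_id].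
have per r' : - 2^-1 <= r' <= r -> f (1 + r'%:C * tau) = f (r'%:C * tau).
  move=> /andP[h1 h2]; have sz : strip (r'%:C * tau).
    by have := @strip_point 0 r'; rewrite add0r; apply; rewrite h1 (le_trans h2).
  rewrite addrC /f h_periodic// mulrDr mulr1 exD; congr (_ * _).
  have -> : ex m%:~R = 1 :> C by rewrite -(mulr1 m%:~R) exMz ex1 exp1rz.
  by rewrite mulr1.
rewrite -/f -(periodic_hor_eq df erefl erefl r1 per) /hor -cintZ; last first.
  apply: cpathM (@cpath_exZ _ 0 1 _); apply: cpathM.
    by apply: (cpath_comp (@cpath_real _ 0 1)) => x _; exact: diff_at_cont.
  apply: (@cpath_comp _ (fun y => leval l p (q^-1 * ex y)) 0 1 _ (@cpath_real _ 0 1)) => x _.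
  by apply/diff_at_cont/leval_ex_diff; rewrite invr_eq0.
apply: eq_cint => x _; have -> : x%:C + (- 2^-1)%:C * tau = x%:C - tau / 2%:C.
  by rewrite rmorphN fmorphV mulNr mulrC.
rewrite /f h_lower mulrBr exD -[ex (- _)]/(ex (- (m%:~R * (tau / 2%:C)))).
have -> : ex (- (m%:~R * (tau / 2%:C))) = q ^ (- m) by rewrite exN exMz ex_half invr_expz.
by rewrite mulrA mulrC.
Qed.

(** The heights [-1/2] and [1/2] are compared: [e(m z)] contributes [q^(-m)] and [q^m], and the
    quasi-periodicity of [w] contributes [t]. *)
Lemma weight_relation (m : int) :
  cint 0 1 (fun x => w x%:C * leval l p (q^-1 * ex x%:C) * ex (m%:~R * x%:C)) =
  t * q ^ (2 * m) * cint 0 1 (fun x => w x%:C * leval l p (q * ex x%:C) * ex (m%:~R * x%:C)).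
Proof.
have hr : - 2^-1 <= (2^-1 : R) <= 2^-1 by rewrite -ler_norml ger0_norm.
have := h_ex_hor m hr; rewrite /hor.
have -> : cint 0 1 (fun s => h (s%:C + (2^-1)%:C * tau) * ex (m%:~R * (s%:C + (2^-1)%:C * tau))) =
   t * q ^ m * cint 0 1 (fun x => w x%:C * leval l p (q * ex x%:C) * ex (m%:~R * x%:C)).
  rewrite -cintZ; last first.
    apply: cpathM (@cpath_exZ _ 0 1 _); apply: cpathM.
      by apply: (cpath_comp (@cpath_real _ 0 1)) => x _; exact: diff_at_cont.
    apply: (@cpath_comp _ (fun y => leval l p (q * ex y)) 0 1 _ (@cpath_real _ 0 1)) => x _.
    exact/diff_at_cont/leval_ex_diff.
  apply: eq_cint => x _; have -> : x%:C + (2^-1)%:C * tau = x%:C + tau / 2%:C.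
    by rewrite fmorphV mulrC.
  by rewrite h_upper mulrDr exD [ex (_ * (tau / _))]exMz ex_half; ring.
move=> e; apply: (mulfI (expfz_neq0 (- m) q0)); rewrite -e mulrA; congr (_ * _).
rewrite mulrCA -expfzDr//; congr (_ * _ ^ _); lia.
Qed.

End OneWeight.

Lemma admissibleP w : admissible tau t l p w -> exists (h : C -> C) (O : C -> Prop),
  [/\ forall x : R, diff_at w x%:C, forall z, pnear_at z (fun y => w (y + 1) = w y),
   forall z, pnear_at z (fun y => w (y + tau) = t * w y) &
   [/\ forall z, O z -> near_at z O, forall z, strip z -> O z, forall z, O z -> diff_at h z &
     forall z, O z -> pnear_at z (fun y => h y = w (y + tau / 2%:C) * leval l p (ex y))]].
Proof.
move=> [_ wR /mero_eqE w1 /mero_eqE wt [Om [oO sO [h [hO [S [/cdiscreteE dS hS]]]]]]].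
exists h, Om; split=> //; split=> //; first by move=> z /stripE; exact: sO.
move=> z /oO oz; apply: pnear_at_imp (pnear_atI (near_at_pnear oz) (dS z)) => y [Oy Sy].
exact: hS.
Qed.

Lemma cpath_weight w a b : (forall x : R, diff_at w x%:C) -> cpath a b (fun x => w x%:C).
Proof.
by move=> wR; apply: (cpath_comp (@cpath_real _ a b)) => x _; exact: diff_at_cont.
Qed.

(** [fourier_unique] reaches only the open interval; [s = 0] follows by continuity, and every other
    [s] by subtracting its integer part. *)
Lemma fourier_strip (H : C -> C) (r : R) : (forall s, cont_at H (s%:C + r%:C * tau)) ->
  (forall s, H (s%:C + r%:C * tau + 1) = H (s%:C + r%:C * tau)) ->
  (forall m : int, hor tau (fun z => H z * ex (m%:~R * z)) r 0 1 = 0) ->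
  forall s, H (s%:C + r%:C * tau) = 0.
Proof.
move=> cH pH iH.
have z01 s : 0 < s < 1 -> H (s%:C + r%:C * tau) = 0.
  move=> hs; apply: (@fourier_unique R (fun s => H (s%:C + r%:C * tau)) s _ hs).
    by apply: hor_path => s' _; exact: cH.
  move=> m; have cp : cpath 0 1 (fun s => H (s%:C + r%:C * tau) * ex (m%:~R * s%:C)).
    by apply: cpathM (@cpath_exZ _ 0 1 _); apply: hor_path => s' _; exact: cH.
  have := iH m; rewrite /hor.
  rewrite (@eq_cint _ _ _ _ (fun s => ex (m%:~R * (r%:C * tau)) * (H (s%:C + r%:C * tau) * ex (m%:~R * s%:C)))).
    rewrite cintZ// => /eqP; rewrite mulf_eq0 => /orP[|/eqP//].
    by rewrite (negbTE (ex_neq0 _)).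
  by move=> x _; rewrite mulrDr exD; ring.
have z0 : H (0%:C + r%:C * tau) = 0.
  apply/eqP/negPn/negP => n0; have /near_atR[d d0 hd] := cont_at_neq0 (cH 0) n0.
  pose s := Num.min (d / 2) 2^-1.
  have s0 : 0 < s by rewrite lt_min divr_gt0//= invr_gt0 ltr0n.
  have s1 : s <= 2^-1 by rewrite ge_min lexx orbT.
  have sd : s <= d / 2 by rewrite ge_min lexx.
  have := hd (s%:C + r%:C * tau); rewrite z01 ?eqxx; last by rewrite s0; lra.
  have -> : s%:C + r%:C * tau - (0%:C + r%:C * tau) = s%:C by rewrite rmorph0 add0r addrK.
  by rewrite nrm_real gtr0_norm// => /(_ _)/negP; apply => //; lra.
have pn (n : nat) s : H ((s + n%:R)%:C + r%:C * tau) = H (s%:C + r%:C * tau).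
  elim: n => [|n ih]; first by rewrite addr0.
  rewrite -ih -(pH (s + n%:R)); congr H.
  by rewrite -natr1 !rmorphD rmorph1 /=; ring.
have pz (k : int) s : H ((s + k%:~R)%:C + r%:C * tau) = H (s%:C + r%:C * tau).
  case: k => n; first exact: pn.
  by rewrite -[in RHS](subrK (n.+1%:R) s) pn NegzE mulrNz.
move=> s; rewrite -(pz (- Num.floor s)) mulrNz.
have /andP[f1 f2] := floor_itv s.
case: (eqVneq (s - (Num.floor s)%:~R) 0) => [->|n0]; first exact: z0.
apply: z01; rewrite lt_neqAle eq_sym n0 subr_ge0 f1 /= ltrBlDl.
by move: f2; rewrite intrD.
Qed.

(** Once [h1 = h2] on the closed strip, division by [P(e(x)/q)] gives equality on the band
    [0 <= Im x < Im tau], punctured at zeros of the divisor, and quasi-periodicity carries it to all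
    bands. *)
Theorem weight_unique w1 w2 : admissible tau t l p w1 -> admissible tau t l p w2 ->
  (forall m : int, cint 0 1 (fun x => w1 x%:C * ex (m%:~R * x%:C)) =
     cint 0 1 (fun x => w2 x%:C * ex (m%:~R * x%:C))) -> mero_eq w1 w2.
Proof.
move=> /admissibleP[h1 [Om1 [wR1 w11 wt1 [oO1 sO1 hO1 hw1]]]].
move=> /admissibleP[h2 [Om2 [wR2 w12 wt2 [oO2 sO2 hO2 hw2]]]] eqI.
have H0 z : strip z -> h1 z = h2 z.
  move=> sz; have [s [r [hr ->]]] := strip_coord sz.
  apply/eqP; rewrite -subr_eq0; apply/eqP.
  have dH s' : diff_at h1 (s'%:C + r%:C * tau) /\ diff_at h2 (s'%:C + r%:C * tau).
    by split; [apply/hO1/sO1|apply/hO2/sO2]; exact: strip_point.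
  apply: (@fourier_strip (fun z => h1 z - h2 z)) => [s'|s'|m].
  - by have [d1 d2] := dH s'; apply: cont_atD; [exact: diff_at_cont|exact/cont_atN/diff_at_cont].
  - have ss := strip_point s' hr.
    by rewrite (h_periodic w11 sO1 hO1 hw1 ss) (h_periodic w12 sO2 hO2 hw2 ss).
  - have e1 := h_ex_hor wR1 w11 sO1 hO1 hw1 m hr.
    have e2 := h_ex_hor wR2 w12 sO2 hO2 hw2 m hr.
    have cE s' : cont_at (fun z => ex (m%:~R * z)) (s'%:C + r%:C * tau).
      apply: (@cont_at_comp _ (fun z => m%:~R * z)); last exact: diff_at_cont (diff_at_ex _).
      by apply: cont_atM; [exact: cont_at_cst|exact: cont_at_id].
    have c1 : cpath 0 1 (fun s => h1 (s%:C + r%:C * tau) * ex (m%:~R * (s%:C + r%:C * tau))).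
      apply: (@hor_path _ tau (fun z => h1 z * ex (m%:~R * z))) => s' _.
      by have [d1 _] := dH s'; apply: cont_atM (diff_at_cont d1) (cE _).
    have c2 : cpath 0 1 (fun s => h2 (s%:C + r%:C * tau) * ex (m%:~R * (s%:C + r%:C * tau))).
      apply: (@hor_path _ tau (fun z => h2 z * ex (m%:~R * z))) => s' _.
      by have [_ d1] := dH s'; apply: cont_atM (diff_at_cont d1) (cE _).
    rewrite /hor (@eq_cint _ _ _ _ (fun s => h1 (s%:C + r%:C * tau) * ex (m%:~R * (s%:C + r%:C * tau)) +
       -1 * (h2 (s%:C + r%:C * tau) * ex (m%:~R * (s%:C + r%:C * tau))))); last first.
      by move=> s' _; rewrite mulrBl mulN1r.
    rewrite cintD//; last by apply: cpathM c2; exact: cpath_cst.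
    rewrite cintZ// -[cint 0 1 (fun s => h1 _ * _)]/(hor tau (fun z => h1 z * ex (m%:~R * z)) r 0 1) e1.
    rewrite -[cint 0 1 (fun s => h2 _ * _)]/(hor tau (fun z => h2 z * ex (m%:~R * z)) r 0 1) e2.
    rewrite !cint_leval ?invr_eq0// mulN1r.
    by under eq_bigr do rewrite eqI; rewrite subrr.
have qi0 : q^-1 != 0 by rewrite invr_eq0.
have low z : 0 <= complex.Im z -> complex.Im z < complex.Im tau -> pnear_at z (fun y => w1 y = w2 y).
  move=> z0 z1.
  have szl : strip (z - tau / 2%:C).
    by rewrite /strip ImB Im_half ler_norml; lra.
  have a1 := near_lower hw1 (sO1 _ szl); have a2 := near_lower hw2 (sO2 _ szl).
  have np := leval_ex_pnear l z qi0 p0.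
  have Imn : near_at z (fun y => complex.Im y < complex.Im tau /\ complex.Im z - complex.Im tau < complex.Im y).
    apply/near_atR; exists (Num.min (complex.Im tau - complex.Im z) (complex.Im tau)).
      by rewrite lt_min subr_gt0 z1 tau0.
    move=> y; rewrite lt_min => /andP[y1 y2]; have := norm_Im_le (y - z); rewrite ImB => hy.
    have := le_lt_trans hy y1; have := le_lt_trans hy y2; rewrite !ltr_norml => /andP[h3 h4] /andP[h5 h6].
    by split; lra.
  have low' : pnear_at z (fun y => 0 <= complex.Im y -> w1 y = w2 y).
    apply: pnear_at_imp (pnear_atI (near_at_pnear Imn) (pnear_atI np (pnear_atI a1 a2))).
    move=> y [[y1 _] [ny [e1 e2]]] y0; apply: (mulIf ny); rewrite -e1 -e2; apply: H0.
    by rewrite /strip ImB Im_half ler_norml; lra.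
  move: z0; rewrite le_eqVlt => /predU1P[z0|z0]; last first.
    have pos : near_at z (fun y => 0 <= complex.Im y).
      apply/near_atR; exists (complex.Im z) => // y hy; have := norm_Im_le (y - z).
      by rewrite raddfB /= => /le_lt_trans/(_ hy); rewrite ltr_norml => /andP[h3 h4]; lra.
    by apply: pnear_at_imp (pnear_atI (near_at_pnear pos) low') => y [y0 h]; exact: h.
  (* A neighbourhood of a real point also reaches below the band. There the upper edge of the strip
     is used instead, through the shift by [+ tau / 2] and the factor [t]. *)
  have szu : strip (z + tau / 2%:C).
    by rewrite /strip ImD Im_half ler_norml -z0; have := tau0; lra.
  have b1 := near_upper wt1 hw1 (sO1 _ szu); have b2 := near_upper wt2 hw2 (sO2 _ szu).
  have nq := leval_ex_pnear l z q0 p0.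
  apply: pnear_at_imp (pnear_atI low' (pnear_atI (near_at_pnear Imn) (pnear_atI nq (pnear_atI b1 b2)))).
  move=> y [hl [[_ y1] [ny [e1 e2]]]]; case: (lerP 0 (complex.Im y)) => [/hl//|y0].
  apply: (mulfI t0); apply: (mulIf ny); rewrite -e1 -e2; apply: H0.
  by rewrite /strip ImD Im_half ler_norml; move: y1; rewrite -z0; have := tau0; lra.
have up z : pnear_at z (fun y => w1 y = w2 y) -> pnear_at (z + tau) (fun y => w1 y = w2 y).
  move=> e; have := pnear_atI e (pnear_atI (wt1 z) (wt2 z)).
  rewrite -{1}[z](addrK tau) => /pnear_at_shift; apply: pnear_at_imp => y.
  by rewrite subrK => -[e0 [-> ->]]; rewrite e0.
have down z : pnear_at z (fun y => w1 y = w2 y) -> pnear_at (z - tau) (fun y => w1 y = w2 y).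
  move=> e; have := pnear_atI (wt1 (z - tau)) (wt2 (z - tau)).
  rewrite -{1}[z](subrK tau) in e; move=> /(pnear_atI (pnear_at_shift e)).
  by apply: pnear_at_imp => y [e0 [e1 e2]]; apply: (mulfI t0); rewrite -e1 -e2.
apply/mero_eqE => z; pose k := Num.floor (complex.Im z / complex.Im tau).
have base : pnear_at (z - k%:~R * tau) (fun y => w1 y = w2 y).
  have Ik : complex.Im (k%:~R * tau) = k%:~R * complex.Im tau.
    by rewrite -(rmorph_int (real_complex R)) /=; case: tau => a b /=; ring.
  have /andP[f1 f2] := floor_itv (complex.Im z / complex.Im tau); rewrite -/k in f1 f2.
  apply: low; rewrite ImB Ik.
    by rewrite subr_ge0 -ler_pdivlMr.
  rewrite ltrBlDl -{2}[complex.Im tau]mul1r -mulrDl -ltr_pdivrMr//.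
  by move: f2; rewrite intrD.
rewrite -[z](subrK (k%:~R * tau)); move: (z - k%:~R * tau) base => z' base.
elim: k z' base => [|n ih|n ih] z' base; first by rewrite mul0r addr0.
  by rewrite -addn1 PoszD intrD mulrDl mul1r addrA; apply/up/ih.
by rewrite -addn1 PoszD opprD intrD mulrDl mulN1r addrA; apply/down/ih.
Qed.

End Admissible.

(** * From weights to traces *)

Section Traces.
Variables (R : realType) (A : algType R[i]) (u v Z Zi : A) (tau q t : R[i]) (l : int) (p : {poly R[i]}).
Local Notation C := R[i].
Hypotheses (tau0 : 0 < complex.Im tau) (qE : q = expC (pi%:C * 'i%C * tau)) (t0 : t != 0) (p0 : p != 0).
Hypothesis pres : is_presented u v Z Zi q l p.

Let q0 : q != 0. Proof. exact: nome_neq0 qE. Qed.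
Let q1 : nrm q < 1. Proof. exact: nrm_nome_lt1 tau0 qE. Qed.
Let ZZi : Z * Zi = 1. Proof. by case: pres => [[[]]]. Qed.
Let ZiZ : Zi * Z = 1. Proof. by case: pres => [[[]]]. Qed.

Lemma laurent_leval m (r : {poly C}) : laurent (leval m r).
Proof. by exists (m, r). Qed.

Lemma laurent0 : laurent (fun=> 0 : C).
Proof. by exists (0, 0) => z _; rewrite /leval horner0 mulr0. Qed.

Lemma laurent_ext f g : laurent f -> laurent g -> (forall j : int, f (q ^ (2 * j)) = g (q ^ (2 * j))) ->
  forall z, z != 0 -> f z = g z.
Proof.
move=> lf lg e z z0; apply/eqP; rewrite -subr_eq0 addrC -mulN1r; apply/eqP.
by apply: (laurent_vanish q0 q1 (laurent_lin (-1) lg lf)) => // j; rewrite e mulN1r addNr.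
Qed.

Lemma cpath_leval w m r a b : (forall x : R, diff_at w x%:C) ->
  cpath a b (fun x => w x%:C * leval m r (ex x%:C)).
Proof.
move=> wR; apply: cpathM (cpath_weight wR) _.
apply: (@cpath_comp _ (fun y => leval m r (ex y)) a b _ (@cpath_real _ a b)) => x _.
have := @leval_ex_diff _ 1 m r x%:C (oner_neq0 _); under eq_fun do rewrite mul1r; exact: diff_at_cont.
Qed.

(** The diagonal [d a] consists of the values at [q^(2j)] of some Laurent polynomial. These values
    determine it off [0], so [T], its integral against [w], is independent of the representative
    picked by [choice], and hence linear. *)
Lemma exists_trace w : (forall x : R, diff_at w x%:C) -> exists T : A -> C, is_lin T /\ trace_of_w Z Zi q w T.
Proof.
move=> wR; have [d [dL dg dz]] := diagonal_model pres q0 q1.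
have d0 j : d 0 j = 0 by have := dL (-1) 0 0 j; rewrite scaler0 addr0 mulN1r addNr.
have rep a : exists mr : int * {poly C}, forall j, d a j = leval mr.1 mr.2 (q ^ (2 * j)).
  move: a; apply: (span_ind pres q0) => [|c x y [mx hx] [my hy]|i m].
  - by exists (0, 0) => j; rewrite d0 /leval horner0 mulr0.
  - have [mr h] := laurent_lin c (laurent_leval mx.1 mx.2) (laurent_leval my.1 my.2).
    by exists mr => j; rewrite dL hx hy h// expfz_neq0.
  - case: (eqVneq i 0) => [->|i0].
      exists (m, 1) => j; rewrite (_ : mon _ _ _ _ 0 m = zpow Z Zi m); last exact: mul1r.
      by rewrite dz /leval hornerC mulr1.
    exists (0, 0) => j; rewrite /leval horner0 mulr0; apply: dg i0 _.
    exact: (graded_mon pres q0 q1).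
have [F hF] := choice rep.
pose T a := cint 0 1 (fun x => w x%:C * leval (F a).1 (F a).2 (ex x%:C)).
have key a f : laurent f -> (forall j, d a j = f (q ^ (2 * j))) ->
    T a = cint 0 1 (fun x => w x%:C * f (ex x%:C)).
  move=> lf hf; apply: eq_cint => x _; congr (_ * _).
  by apply: (laurent_ext (laurent_leval _ _) lf); [move=> j; rewrite -hF hf|exact: ex_neq0].
exists T; split; last split.
- move=> c x y; rewrite (key _ (fun z => c * leval (F x).1 (F x).2 z + leval (F y).1 (F y).2 z)); last 2 first.
  + exact: laurent_lin (laurent_leval _ _) (laurent_leval _ _).
  + by move=> j; rewrite dL !hF.
  rewrite /T -cintZ; last exact: cpath_leval.
  rewrite -cintD; last 2 first.
  + by apply: cpathM (@cpath_cst _ 0 1 _) _; exact: cpath_leval.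
  + exact: cpath_leval.
  by apply: eq_cint => z _; rewrite mulrDr mulrCA.
- move=> i i0 a ga; rewrite (key a (fun=> 0) laurent0); last by move=> j; exact: dg ga.
  rewrite (@eq_cint _ _ _ _ (fun x => 0 * w x%:C)) => [|x _]; last by rewrite mulr0 mul0r.
  by rewrite cintZ ?mul0r//; exact: cpath_weight.
- move=> m r; apply: (key _ _ (laurent_leval m r)) => j.
  rewrite aevalE// levalE ?expfz_neq0//; elim/big_rec2: _ => [|i y1 y2 _ <-]; first exact: d0.
  by rewrite dL dz.
Qed.

Lemma trace_zpow w (T : A -> C) m : trace_of_w Z Zi q w T ->
  T (zpow Z Zi m) = cint 0 1 (fun x => w x%:C * ex (m%:~R * x%:C)).
Proof.
move=> [_ /(_ m 1)]; rewrite aevalE// size_poly1 big_ord1 coef1 scale1r addr0 => ->.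
by apply: eq_cint => x _; rewrite /leval hornerC mulr1 exMz.
Qed.

Lemma weight_trace w (T : A -> C) : admissible tau t l p w -> is_lin T -> trace_of_w Z Zi q w T ->
  twisted_trace u v Z Zi t T.
Proof.
move=> adw TL Tw; apply: (twisted_trace_of pres q0 q1 t0 TL) => [i a i0|m].
  by have [h _] := Tw; exact: h.
have [h [Om [wR w1 wt [oO sO hO hw]]]] := admissibleP adw.
have := weight_relation tau0 qE t0 p0 wR w1 wt sO hO hw m.
rewrite !cint_leval ?invr_eq0// => e.
under eq_bigr do rewrite (trace_zpow _ Tw) -exprz_inv.
by under [in RHS]eq_bigr do rewrite (trace_zpow _ Tw).
Qed.

Lemma trace_weight_unique w1 w2 (T : A -> C) : admissible tau t l p w1 -> trace_of_w Z Zi q w1 T ->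
  admissible tau t l p w2 -> trace_of_w Z Zi q w2 T -> mero_eq w1 w2.
Proof.
move=> ad1 T1 ad2 T2; apply: (weight_unique tau0 qE t0 p0 ad1 ad2) => m.
by rewrite -(trace_zpow _ T1) -(trace_zpow _ T2).
Qed.

End Traces.

(** * Construction of the weight *)

Section Punctured.
Variables (K : numFieldType).
Implicit Types (f g w : K -> K) (z : K).

Lemma pnear_at_near z P : pnear_at z P -> pnear_at z (fun y => near_at y P).
Proof.
move=> /near_at_near; apply: near_at_imp => y ny yz.
have nz : near_at y (fun y' => y' - z != 0).
  apply: (@cont_at_neq0 _ (fun y' => y' - z)); last by rewrite subr_eq0.
  exact: cont_atD (@cont_at_id _ y) (cont_at_cst (- z) y).
by apply: near_at_imp (near_atI ny nz) => y' [h1]; rewrite subr_eq0 => /h1.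
Qed.

Lemma near_at_fill z P : pnear_at z P -> P z -> near_at z P.
Proof. by move=> h hz; apply: near_at_imp h => y h; case: (eqVneq y z) => [->|/h]. Qed.

(** Regular points are included, with [k = 0]; being imposed at every point, the condition is purely
    local and [meromorphic] can be assembled from it. *)
Definition pole_at w z := exists k g, near_at z (diff_at g) /\ pnear_at z (fun y => g y = (y - z) ^+ k * w y).

Lemma pole_at_pnear w z : pole_at w z -> pnear_at z (diff_at w).
Proof.
move=> [k [g [dg gw]]]; have nz : pnear_at z (fun y => y != z) by exists 1.
apply: pnear_at_imp (pnear_atI nz (pnear_atI (near_at_pnear dg) (pnear_at_near (pnear_atI nz gw)))).
move=> y [yz [dy hy]]; apply: (@diff_at_near _ (fun y => ((y - z) ^+ k)^-1 * g y)).
  by apply: near_at_imp hy => y' [yz' ->]; rewrite mulrA mulVf ?mul1r// expf_neq0// subr_eq0.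
apply: diff_atM => //; apply: diff_atV; first by rewrite expf_neq0// subr_eq0.
by apply: diff_atX; apply: diff_atD (diff_at_id y) (diff_at_cst (- z) y).
Qed.

Lemma pole_at_shift w c s z : (forall y, w (y + c) = s * w y) -> pole_at w z -> pole_at w (z + c).
Proof.
move=> wc [k [g [dg gw]]]; exists k, (fun y => s * g (y - c)); rewrite -{1}[z](addrK c) in dg.
have gw' : pnear_at (z + c - c) (fun y => g y = (y - z) ^+ k * w y) by rewrite addrK.
split.
  apply: near_at_imp (near_at_shift dg) => y dy; apply: diff_atM (diff_at_cst _ _) _.
  apply: (@diff_at_comp _ (fun y => y - c)) dy.
  exact: diff_atD (diff_at_id y) (diff_at_cst (- c) y).
apply: pnear_at_imp (pnear_at_shift gw') => y ->.
have -> : w y = s * w (y - c) by rewrite -wc subrK.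
by rewrite mulrCA [y - (z + c)](_ : _ = y - c - z)// opprD [- z - c]addrC addrA.
Qed.

End Punctured.

(** * Poles of reciprocals of [P(e(x))] *)

Section Poles.
Variable R : realType.
Local Notation C := R[i].

(** The exceptional set is where [w] fails to be differentiable; it is discrete because a pole
    condition at [z] makes [w] differentiable on a punctured neighbourhood. *)
Lemma meromorphic_poles (w : C -> C) : (forall z, pole_at w z) -> meromorphic w.
Proof.
move=> hw; exists (fun z => ~ diff_at w z); split.
- apply/cdiscreteE => z; apply: pnear_at_imp (pole_at_pnear (hw z)) => y dy; exact.
- by move=> z /contrapT.
- move=> s _; have [k [g [dg gw]]] := hw s; exists k, g.
  have [r r0 hr] := near_atI dg gw; exists r => //.
  by split=> z /hr[h1 h2].
Qed.

(** The zero is simple, yet the exponent is [2]: at a zero the quotient takes the conventional value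
    [0], which is its limit only with the extra factor. *)
Lemma inv_ex_sub_pole (al r z : C) : al != 0 -> near_at z (diff_at (fun y => (y - z) ^+ 2 / (al * ex y - r))).
Proof.
move=> al0; have dX y : diff_at (fun y => (y - z) ^+ 2) y.
  apply: diff_atX; exact: diff_atD (diff_at_id y) (diff_at_cst (- z) y).
have dE y : diff_at (fun y => al * ex y - r) y.
  by apply: diff_atD (diff_at_cst _ _); apply: diff_atM (diff_at_cst _ _) (diff_at_ex _).
have out y : al * ex y - r != 0 -> diff_at (fun y => (y - z) ^+ 2 / (al * ex y - r)) y.
  by move=> ny; apply: diff_atM (dX y) _; apply: diff_atV.
apply: near_at_fill; first exact: pnear_at_imp out (ex_sub_pnear r z al0).
case: (eqVneq (al * ex z) r) => [e|ne]; last by apply: out; rewrite subr_eq0.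
have [phi [c1 c2 c3]] := ex_sub_caratheodory al0 e; exact: diff_at_sqr_div c1 c2 c3.
Qed.

(** Two powers of [y - z] per linear factor of [p], whether or not that factor vanishes at [z]. *)
Lemma inv_leval_pole (al : C) l (p : {poly C}) z : al != 0 -> p != 0 ->
  exists k, near_at z (diff_at (fun y => (y - z) ^+ k / leval l p (al * ex y))).
Proof.
move=> al0 p0; have [rs prs] := closed_field_poly_normal p.
exists (2 * size rs)%N.
have : near_at z (diff_at (fun y => (y - z) ^+ (2 * size rs) / (\prod_(r <- rs) ('X - r%:P)).[al * ex y])).
  elim: rs {prs} => [|r rs ih].
    apply: near_atT => y; apply: (diff_at_near _ (diff_at_cst 1 y)).
    by apply: near_atT => y'; rewrite big_nil hornerC divr1.
  apply: near_at_imp (near_atI (inv_ex_sub_pole r z al0) ih) => y [d1 d2].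
  apply: (diff_at_near _ (diff_atM d1 d2)); apply: near_atT => y'.
  by rewrite big_cons hornerM hornerXsubC mulnS exprD mulrACA invfM.
apply: near_at_imp => y dy.
have dU : diff_at (fun y => ((al * ex y) ^ l * lead_coef p)^-1) y.
  apply: diff_atV; first by rewrite mulf_neq0 ?lead_coef_eq0// expfz_neq0// mulf_neq0// ex_neq0.
  apply: diff_atM (diff_at_cst _ _); apply: diff_at_exprz; first by rewrite mulf_neq0// ex_neq0.
  exact: diff_atM (diff_at_cst _ _) (diff_at_ex _).
apply: (diff_at_near _ (diff_atM dU dy)); apply: near_atT => y'.
have -> : leval l p (al * ex y') =
    (al * ex y') ^ l * lead_coef p * (\prod_(r <- rs) ('X - r%:P)).[al * ex y'].
  by rewrite /leval {1}prs hornerZ mulrA.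
by rewrite [in RHS]invfM; exact: mulrCA.
Qed.

End Poles.

(** * Translating a two-sided series and multiplying it by a Laurent polynomial *)

Section Translates.
Variable R : realType.
Local Notation C := R[i].

(** The two series agree term by term, so convergence at [x + y] is all that enters. *)
Lemma lser_translate (b : int -> C) (s : R) x y : 0 < s -> gbound b s -> annulus s (x + y) ->
  lser b (x + y) = lser (fun m => ex (m%:~R * y) * b m) x.
Proof.
move=> s0 hb hx; have [_ c2] := lser_conv s0 hb hx.
have e1 : pser (fun n => b (Posz n)) (ex (x + y)) =
    pser (fun n => ex ((Posz n)%:~R * y) * b (Posz n)) (ex x).
  rewrite /pser; congr csum; apply/funext => n; rewrite exMz exD exprMn -exprnP.
  by move: (ex x ^+ n) (ex y ^+ n) (b _) => X Y B; rewrite mulrCA mulrA [RHS]mulrAC mulrC mulrA.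
suff e2 : ex (- (x + y)) * pser (fun n => b (Negz n)) (ex (- (x + y))) =
    ex (- x) * pser (fun n => ex ((Negz n)%:~R * y) * b (Negz n)) (ex (- x)) by exact: (f_equal2 +%R e1 e2).
rewrite {1}opprD exD -mulrA; congr (_ * _); apply/esym/csumP.
have := convergesZ (ex (- y)) c2; congr converges; apply/funext => n.
rewrite NegzE mulrNz mulNr -mulrN (exMz (- y) (Posz n.+1)) opprD exD exprMn -exprnP exprS.
have id (V : comPzRingType) (a1 a2 a3 a4 : V) : a1 * (a2 * (a3 * a4)) = a1 * a4 * a2 * a3 by ring.
exact: id.
Qed.

Lemma gboundN (b : int -> C) (s : R) : gbound b s -> gbound (fun m => b (- m)) s.
Proof. by move=> [K hK]; exists K => m; rewrite -abszN; exact: hK. Qed.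

Lemma gbound_le (b : int -> C) (s s' : R) : 0 <= s -> s <= s' -> gbound b s -> gbound b s'.
Proof.
move=> s0 ss /gbound_ge0[K K0 hK]; exists K => m; apply: le_trans (hK m) _.
by rewrite ler_wpM2l// lerXn2r// ?nnegrE// (le_trans s0).
Qed.

(** Multiplication by a Laurent polynomial in [e(x)] is convolution on coefficients. *)
Lemma lser_leval (b : int -> C) (s : R) al l (p : {poly C}) x :
  0 < s -> s <= 1 -> gbound b s -> annulus s x -> al != 0 ->
  lser (fun m => \sum_(i < size p) p`_i * al ^ (l + Posz i) * b (m - (l + Posz i))) x =
  lser b x * leval l p (al * ex x).
Proof.
move=> s0 s1 hb hx al0.
have hB (i : 'I_(size p)) : gbound (fun m => b (m - (l + Posz i))) s by exact: gbound_shift.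
rewrite (lser_sum _ s0 _ hx) => [|i]; last exact: gboundZ.
rewrite levalE; last by rewrite mulf_neq0 ?ex_neq0.
rewrite mulr_sumr; apply: eq_bigr => i _.
rewrite (lserZ _ s0 (hB i) hx) (lser_shift _ s0 s1 hb hx) exMz.
have -> : (al * ex x) ^ (l + Posz i) = al ^ (l + Posz i) * ex x ^ (l + Posz i).
  by apply: exprzMl; rewrite unitfE// ex_neq0.
have id (V : comPzRingType) (a1 a2 a3 a4 : V) : a1 * a2 * (a3 * a4) = a4 * (a1 * (a2 * a3)) by ring.
exact: id.
Qed.

End Translates.

(** * Comparing the strips of convergence with the closed strip *)

Section Nome.
Variables (R : realType) (tau q : R[i]) (rho : R).
Local Notation C := R[i].
Hypotheses (tau0 : 0 < complex.Im tau) (qE : q = expC (pi%:C * 'i%C * tau)).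
Hypotheses (rho0 : 0 < rho) (rho1 : rho < 1) (q_rho : nrm q <= rho).

Let q0 : q != 0. Proof. exact: nome_neq0 qE. Qed.
Let nq0 : 0 < nrm q. Proof. by rewrite nrm_gt0. Qed.
Local Notation half := (tau / 2%:C).

Let sign_le (k x y : R) : 0 < k -> (- (k * (x + y)) <= 0) = (- x <= y).
Proof. by move=> k0; rewrite oppr_le0 pmulr_rge0// -lerBlDl sub0r. Qed.
Let sign_lt (k x y : R) : 0 < k -> (- (k * (x + y)) < 0) = (- x < y).
Proof. by move=> k0; rewrite oppr_lt0 pmulr_rgt0// -ltrBlDl sub0r. Qed.

Let twopi : 0 < 2 * pi :> R. Proof. by rewrite mulr_gt0 ?pi_gt0. Qed.

Lemma nome_ex (z : C) : nrm q * nrm (ex z) = expR (- (2 * pi * (complex.Im tau / 2 + complex.Im z))).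
Proof. by rewrite -nrmM -(ex_half qE) -exD nrm_ex ImD Im_half. Qed.

Lemma nome_ex_le1 (z : C) : (nrm q * nrm (ex z) <= 1) = (- (complex.Im tau / 2) <= complex.Im z).
Proof. by rewrite nome_ex -[X in _ <= X]expR0 ler_expR sign_le. Qed.

Lemma nome_ex_lt1 (z : C) : (nrm q * nrm (ex z) < 1) = (- (complex.Im tau / 2) < complex.Im z).
Proof. by rewrite nome_ex -[X in _ < X]expR0 ltr_expR sign_lt. Qed.

Lemma nrm_ex_le1 (z : C) : (nrm (ex z) <= 1) = (0 <= complex.Im z).
Proof. by rewrite nrm_ex -[X in _ <= X]expR0 ler_expR oppr_le0 pmulr_rge0. Qed.

Let ImN (z : C) : complex.Im (- z) = - complex.Im z. Proof. exact: raddfN. Qed.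

(** On the closed strip [|q|] times [|e(z)|] or its inverse is at most [1], and the factor [rho < 1]
    leaves room around it. *)
Lemma annulus_strip (z : C) : strip tau z -> annulus (nrm q * rho) z.
Proof.
rewrite /strip ler_norml => /andP[z1 z2].
have aux (y : C) : - (complex.Im tau / 2) <= complex.Im y -> nrm q * rho * nrm (ex y) < 1.
  rewrite -nome_ex_le1 => hy; rewrite mulrAC; apply: le_lt_trans rho1.
  by rewrite ler_piMl// ltW.
by split; apply: aux => //; rewrite ImN lerN2.
Qed.

(** This is the purpose of [nrm q <= rho]: the strip where [W] converges meets only the two bands
    adjoining the real line. *)
Lemma Im_annulus (x : C) : annulus rho x -> - (complex.Im tau / 2) < complex.Im x < complex.Im tau / 2.
Proof.
have aux (y : C) : rho * nrm (ex y) < 1 -> - (complex.Im tau / 2) < complex.Im y.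
  by rewrite -nome_ex_lt1; apply: le_lt_trans; rewrite ler_wpM2r ?nrm_ge0.
by move=> [/aux h1 /aux]; rewrite ImN ltrN2 => h2; apply/andP.
Qed.

Let nrm_exB (x : C) : nrm q * nrm (ex (x - half)) = nrm (ex x).
Proof. by rewrite exD exN nrmM nrmV (ex_half qE) mulrCA mulfV ?mulr1// gt_eqF. Qed.
Let nrm_exD (x : C) : nrm (ex (x + half)) = nrm (ex x) * nrm q.
Proof. by rewrite exD nrmM (ex_half qE). Qed.

Lemma annulus_half (x : C) : annulus rho x -> annulus (nrm q * rho) (x - half) /\ annulus (nrm q * rho) (x + half).
Proof.
have aux (y : C) : rho * nrm (ex y) < 1 -> nrm q * rho * nrm (ex (y + half)) < 1.
  move=> h; rewrite nrm_exD [nrm (ex y) * _]mulrC mulrACA; apply: le_lt_trans h; rewrite ler_piMl//.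
    by rewrite mulr_ge0 ?nrm_ge0// ltW.
  by have := ltW (nrm_nome_lt1 tau0 qE) => nq1; rewrite mulr_ile1// ltW.
have aux' (y : C) : rho * nrm (ex y) < 1 -> nrm q * rho * nrm (ex (y - half)) < 1.
  by rewrite mulrAC nrm_exB mulrC.
move=> [h1 h2]; split; split; [exact: aux'|by rewrite opprB addrC; exact: aux|exact: aux|].
by rewrite opprD; exact: aux'.
Qed.

(** The domain of [h] is larger than the closed strip; a point beyond an edge enters the domain of
    [W] after a shift by [tau / 2] toward the real line. *)
Lemma annulus_quarter (z : C) : annulus (nrm q * rho) z ->
  (complex.Im z < - (complex.Im tau / 2) -> annulus rho (z + half)) /\
  (complex.Im tau / 2 <= complex.Im z -> annulus rho (z - half)).
Proof.
have le1 (y : C) : 0 <= complex.Im y -> rho * nrm (ex y) < 1.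
  by rewrite -nrm_ex_le1 => hy; apply: le_lt_trans rho1; rewrite ler_piMr// ltW.
have Imh := Im_half tau.
move=> [h1 h2]; split => hz; split.
- by rewrite nrm_exD mulrA mulrC mulrA.
- by apply: le1; rewrite ImN oppr_ge0 ImD Imh -lerBrDr sub0r ltW.
- by apply: le1; rewrite ImB Imh subr_ge0.
- by rewrite opprB addrC nrm_exD mulrA mulrC mulrA.
Qed.

End Nome.

(** The arguments lie on the circles of radius [|q|] and [1/|q|], which bound the open annulus
    containing the roots. *)
Lemma leval_real_neq0 (R : realType) (q : R[i]) (l : int) (p : {poly R[i]}) (x : R) : q != 0 ->
  (forall z, root p z -> nrm q < nrm z < (nrm q)^-1) ->
  leval l p (q^-1 * ex x%:C) != 0 /\ leval l p (q * ex x%:C) != 0.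
Proof.
move=> q0 roots; have nx : nrm (ex x%:C) = 1 by have := nrm_ex_real 1 x; rewrite mul1r.
have qi0 : q^-1 != 0 by rewrite invr_eq0.
have aux z : nrm z = nrm q \/ nrm z = (nrm q)^-1 -> p.[z] != 0.
  move=> hz; apply/negP => rt; have := roots _ (rt : root p z).
  by case: hz => ->; rewrite ltxx ?andbF.
have e0 := ex_neq0 x%:C.
split; apply: mulf_neq0.
- exact/expfz_neq0/mulf_neq0.
- by apply: aux; right; rewrite nrmM nrmV nx mulr1.
- exact/expfz_neq0/mulf_neq0.
- by apply: aux; left; rewrite nrmM nx mulr1.
Qed.

(** * Gluing the weight from its bands *)

Section Construction.
Variables (R : realType) (tau q t : R[i]) (l : int) (p : {poly R[i]}) (rho : R) (W h : R[i] -> R[i]).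
Local Notation C := R[i].
Hypotheses (tau0 : 0 < complex.Im tau) (qE : q = expC (pi%:C * 'i%C * tau)) (t0 : t != 0) (p0 : p != 0).
Hypothesis roots : forall z, root p z -> nrm q < nrm z < (nrm q)^-1.
Hypotheses (rho0 : 0 < rho) (rho1 : rho < 1) (q_rho : nrm q <= rho).
Local Notation half := (tau / 2%:C).
Hypotheses (hlow : forall x, annulus rho x -> h (x - half) = W x * leval l p (q^-1 * ex x))
  (hup : forall x, annulus rho x -> h (x + half) = t * W x * leval l p (q * ex x))
  (dW : forall x, annulus rho x -> diff_at W x)
  (dh : forall z, annulus (nrm q * rho) z -> diff_at h z)
  (h1 : forall z, h (z + 1) = h z).

Let q0 : q != 0. Proof. exact: nome_neq0 qE. Qed.
Let qi0 : q^-1 != 0. Proof. by rewrite invr_eq0. Qed.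

Lemma Im_intM (k : int) : complex.Im (k%:~R * tau) = k%:~R * complex.Im tau.
Proof. by rewrite -(rmorph_int (real_complex R)) /=; case: tau => a b /=; ring. Qed.

(** The formula for the band [k * Im tau <= Im z < (k + 1) * Im tau]; at zeros of the denominator
    the value is [0] by convention. *)
Definition floor_weight (k : int) (z : C) :=
  t ^ k * (h (z - k%:~R * tau - half) / leval l p (q^-1 * ex (z - k%:~R * tau))).

Definition weight (z : C) := floor_weight (Num.floor (complex.Im z / complex.Im tau)) z.

Lemma weightE (k : int) z : k%:~R * complex.Im tau <= complex.Im z < (k + 1)%:~R * complex.Im tau ->
  weight z = floor_weight k z.
Proof. by move=> hk; rewrite /weight (@floor_def _ _ k)// ler_pdivlMr// ltr_pdivrMr. Qed.

Lemma weight_floor z : exists k : int, k%:~R * complex.Im tau <= complex.Im z < (k + 1)%:~R * complex.Im tau.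
Proof.
exists (Num.floor (complex.Im z / complex.Im tau)); have := floor_itv (complex.Im z / complex.Im tau).
by rewrite ler_pdivlMr// ltr_pdivrMr.
Qed.

Lemma weight_shift (k : int) z : weight (z + k%:~R * tau) = t ^ k * weight z.
Proof.
have [m hm] := weight_floor z; rewrite (weightE hm) (@weightE (m + k)); last first.
  move: hm; rewrite ImD Im_intM !intrD !mulrDl addrAC lerD2r ltrD2r; exact.
rewrite /floor_weight mulrA -expfzDr// [k + m]addrC.
have -> : z + k%:~R * tau - (m + k)%:~R * tau = z - m%:~R * tau by rewrite intrD; ring.
by [].
Qed.

Lemma weight1 z : weight (z + 1) = weight z.
Proof.
rewrite /weight ImD addr0 /floor_weight.
set k := _%:~R * tau; rewrite [z + 1 - k]addrAC exD1.
by rewrite [z - k + 1 - half]addrAC h1.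
Qed.

Lemma weight_tau z : weight (z + tau) = t * weight z.
Proof. by have := weight_shift 1 z; rewrite mul1r expr1z. Qed.

Lemma weight_ge0 z : 0 <= complex.Im z -> complex.Im z < complex.Im tau ->
  weight z = h (z - half) / leval l p (q^-1 * ex z).
Proof.
move=> z1 z2; rewrite (@weightE 0) ?mul0r ?add0r ?mul1r ?z1//.
by rewrite /floor_weight expr0z mul1r mul0r subr0.
Qed.

(** The real line is the seam of two bands: above it the weight is read off [hlow], below it off
    [hup] after one step of quasi-periodicity. Both give [W]. *)
Lemma weight_annulus x : annulus rho x ->
  leval l p (q^-1 * ex x) != 0 -> leval l p (q * ex x) != 0 -> weight x = W x.
Proof.
move=> ax n1 n2; have /andP[x1 x2] := Im_annulus qE q_rho ax.
have [x0|x0] := lerP 0 (complex.Im x).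
  rewrite weight_ge0//; last by move: x2 tau0; lra.
  by rewrite hlow// mulfK.
apply: (mulfI t0); rewrite -weight_tau weight_ge0 ?ImD; last 2 first.
- by move: x1 tau0; lra.
- by move: x0 tau0; lra.
have -> : x + tau - half = x + half by rewrite -{1}(half_half tau) -!addrA subrr addr0.
rewrite hup// exD (ex_tau qE).
have -> : q^-1 * (ex x * q ^+ 2) = q * ex x by rewrite expr2 mulrCA mulKf// mulrC.
by rewrite mulfK.
Qed.

Lemma weight_near_real (x : R) : near_at x%:C (fun y => weight y = W y).
Proof.
have [n1 n2] := leval_real_neq0 l x q0 roots; have ax := annulus_real x rho1.
have c1 := cont_at_neq0 (diff_at_cont (leval_ex_diff l p x%:C qi0)) n1.
have c2 := cont_at_neq0 (diff_at_cont (leval_ex_diff l p x%:C q0)) n2.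
apply: near_at_imp (near_atI (annulus_near ax) (near_atI c1 c2)) => y [ay [m1 m2]].
exact: weight_annulus.
Qed.

Lemma Im_near (z : C) (e : R) : 0 < e -> near_at z (fun y => `|complex.Im y - complex.Im z| < e).
Proof.
move=> e0; apply/near_atR; exists e => // y hy; rewrite -ImB; exact: le_lt_trans (norm_Im_le _) hy.
Qed.

(** Quasi-periodicity moves [z] into the band [0 <= Im z < Im tau]. On its lower edge the weight is
    [W] nearby; in its interior it is [h] divided by [P(e(y)/q)]. *)
Lemma weight_pole z : pole_at weight z.
Proof.
have [k /andP[k1 k2]] := weight_floor z; rewrite -[z](subrK (k%:~R * tau)).
apply: (@pole_at_shift _ _ _ (t ^ k)) => [y|]; first exact: weight_shift.
have y0 : 0 <= complex.Im (z - k%:~R * tau) by rewrite ImB Im_intM subr_ge0.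
have y1 : complex.Im (z - k%:~R * tau) < complex.Im tau.
  by move: k2; rewrite ImB Im_intM intrD mulrDl mul1r ltrBlDl.
move: (z - _) y0 y1 {k1 k2} => {}z y0 y1; case: (eqVneq (complex.Im z) 0) => [z0|z0].
  have -> : z = (complex.Re z)%:C by rewrite [LHS]complexE z0 mulr0 addr0.
  have ax := annulus_real (complex.Re z) rho1.
  exists 0%N, W; split; first exact: near_at_imp dW (annulus_near ax).
  by apply: near_at_pnear; apply: near_at_imp (weight_near_real _) => y ->; rewrite mul1r.
have {}y0 : 0 < complex.Im z by rewrite lt_neqAle eq_sym z0.
have [k' dk] := inv_leval_pole l z qi0 p0.
exists k', (fun y => h (y - half) * ((y - z) ^+ k' / leval l p (q^-1 * ex y))).
have sz : strip tau (z - half).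
  by rewrite /strip ImB Im_half ler_norml; move: y0 y1; lra.
have az := near_at_shift (annulus_near (annulus_strip qE rho0 rho1 sz)).
split.
  apply: near_at_imp (near_atI az dk) => y [ay dy]; apply: diff_atM dy.
  apply: (@diff_at_comp _ (fun y => y - half)); last exact: dh.
  exact: diff_atD (diff_at_id y) (diff_at_cst (- half) y).
have e0 : 0 < Num.min (complex.Im z) (complex.Im tau - complex.Im z).
  by rewrite lt_min y0 subr_gt0.
apply: near_at_pnear; apply: near_at_imp (Im_near z e0) => y.
rewrite lt_min !ltr_norml => /andP[/andP[i1 i2] /andP[i3 i4]].
rewrite weight_ge0; first exact: mulrCA.
  by move: i1; lra.
by move: i4; lra.
Qed.

(** The domain of [h] sticks out of the closed strip on both sides. Between the edges the claim is
    the band formula; beyond them it is [hlow] or [hup] combined with [weight_annulus], whose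
    nonvanishing conditions are met off a point. *)
Lemma weight_strip z : pnear_at z (fun y => annulus (nrm q * rho) y ->
  h y = weight (y + half) * leval l p (ex y)).
Proof.
have n0 := leval_ex_pnear l z (oner_neq0 _) p0.
have n1 := leval_ex_pnear l z (expf_neq0 2 q0) p0.
have n2 := leval_ex_pnear l z (expf_neq0 2 qi0) p0.
apply: pnear_at_imp (pnear_atI n0 (pnear_atI n1 n2)) => y [+ [m1 m2]] ay.
rewrite mul1r => m0; have [a1 a2] := annulus_quarter qE rho0 rho1 ay.
have exB : ex (y - half) = q^-1 * ex y by rewrite exD exN (ex_half qE) mulrC.
have exH : ex (y + half) = q * ex y by rewrite exD (ex_half qE) mulrC.
have Imh := Im_half tau.
have [y1|y1] := ltrP (complex.Im y) (- (complex.Im tau / 2)).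
  have e1 : leval l p (q^-1 * ex (y + half)) = leval l p (ex y) by rewrite exH mulKf.
  rewrite weight_annulus; [|exact: a1|by rewrite e1|by rewrite exH mulrA -expr2].
  by have := hlow (a1 y1); rewrite e1 addrK.
have [y2|y2] := ltrP (complex.Im y) (complex.Im tau / 2); last first.
  have e1 : leval l p (q * ex (y - half)) = leval l p (ex y) by rewrite exB mulVKf.
  have -> : y + half = y - half + tau by rewrite -{3}(half_half tau) addrA subrK.
  rewrite weight_tau weight_annulus; [|exact: a2|by rewrite exB mulrA -expr2|by rewrite e1].
  by have := hup (a2 y2); rewrite e1 subrK.
rewrite weight_ge0 ?ImD ?Imh; last 2 first.
- by move: y1; lra.
- by move: y2; lra.
by rewrite addrK exH mulKf// divfK.
Qed.

Theorem weight_admissible : admissible tau t l p weight.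
Proof.
split.
- exact: meromorphic_poles weight_pole.
- move=> x; have ax := annulus_real x rho1; apply: (@diff_at_near _ W); last exact: dW.
  by apply: near_at_imp (weight_near_real x) => y.
- exact/mero_eq_all/weight1.
- exact/mero_eq_all/weight_tau.
exists (annulus (nrm q * rho)); split.
- by move=> z az; have [r r0 hr] := annulus_near az; exists r.
- by move=> z /stripE; exact: annulus_strip.
exists h; split; first exact: dh.
exists (fun y => annulus (nrm q * rho) y /\ h y <> weight (y + half) * leval l p (ex y)); split.
  by apply/cdiscreteE => z; apply: pnear_at_imp (weight_strip z) => y hy [/hy].
by move=> z az nz; apply: contrapT => nh; apply: nz.
Qed.

End Construction.

Section Coefficients.
Variable R : realType.
Local Notation C := R[i].

Lemma nrm_exprz (z : C) (m : int) : nrm (z ^ m) = nrm z ^ m.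
Proof. by case: m => n; [exact: nrmX|rewrite NegzE -!invr_expz nrmV; congr _^-1; exact: nrmX]. Qed.

Lemma gbound_coef n (F : 'I_n -> C) (l : int) (c : int -> C) (rho : R) : 0 < rho -> rho <= 1 -> gbound c rho ->
  gbound (fun m => \sum_(i < n) F i * c (- (m - (l + Posz i)))) rho.
Proof.
move=> r0 r1 hc; apply: gbound_sum (ltW r0) _ => i; apply: gboundZ.
exact: (@gbound_shift R (fun m => c (- m))) _ r0 r1 (gboundN hc).
Qed.

(** The first expression is used for [m >= 0] and the second for [m < 0]; either way a factor
    [|q|^|m|] is gained. *)
Lemma gbound_twist (q : C) (b f g : int -> C) (rho : R) : 0 < rho -> q != 0 ->
  (forall m, b m = q ^ m * f m) -> (forall m, b m = q ^ (- m) * g m) ->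
  gbound f rho -> gbound g rho -> gbound b (nrm q * rho).
Proof.
move=> r0 q0 bf bg /gbound_ge0[K1 K10 h1] /gbound_ge0[K2 K20 h2]; have nq0 : 0 < nrm q by rewrite nrm_gt0.
exists (K1 + K2) => -[n|n].
  rewrite bf nrmM nrm_exprz exprMn mulrCA; apply: ler_wpM2l; first exact: exprn_ge0 (ltW nq0).
  by apply: le_trans (h1 _) _; rewrite ler_wpM2r ?lerDl// exprn_ge0// ltW.
rewrite bg (_ : - Negz n = Posz n.+1)// nrmM nrm_exprz exprMn mulrCA.
apply: ler_wpM2l; first exact: exprn_ge0 (ltW nq0).
by apply: le_trans (h2 _) _; rewrite ler_wpM2r ?lerDr// exprn_ge0// ltW.
Qed.

End Coefficients.

(** * Realising a solution of the recurrence by a weight *)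

Section Existence.
Variables (R : realType) (tau q t : R[i]) (l : int) (p : {poly R[i]}).
Local Notation C := R[i].
Hypotheses (tau0 : 0 < complex.Im tau) (qE : q = expC (pi%:C * 'i%C * tau)) (t0 : t != 0) (p0 : p.[0] != 0).
Hypothesis roots : forall z, root p z -> nrm q < nrm z < (nrm q)^-1.
Local Notation half := (tau / 2%:C).

Let q0 : q != 0. Proof. exact: nome_neq0 qE. Qed.
Let pn0 : p != 0. Proof. by apply: contraNneq p0 => ->; rewrite horner0. Qed.

Theorem exists_weight (c : int -> C) :
  (forall m : int, \sum_(i < size p) p`_i * q ^ (- (l + Posz i)) * c (m + l + Posz i) =
     t * q ^ (2 * m) * \sum_(i < size p) p`_i * q ^ (l + Posz i) * c (m + l + Posz i)) ->
  exists w, admissible tau t l p w /\ forall m : int, cint 0 1 (fun x => w x%:C * ex (m%:~R * x%:C)) = c m.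
Proof.
move=> rel; have nq1 := nrm_nome_lt1 tau0 qE; have nq0 : 0 < nrm q by rewrite nrm_gt0.
have [rho' /andP[r0' r1'] hc'] := decay_two_sided q0 nq1 t0 p0 roots rel.
(* Enlarging [rho'] to at least [|q|] keeps the strip of convergence of [W] between the edges. *)
have [rho [r0 r1 q_rho hc]] : exists rho, [/\ 0 < rho, rho < 1, nrm q <= rho & gbound c rho].
  exists (Num.max rho' (nrm q)); split.
  - by rewrite lt_max r0'.
  - by rewrite gt_max r1'.
  - by rewrite le_max lexx orbT.
  - by apply: gbound_le hc'; rewrite ?le_max ?lexx// ltW.
have hcN := gboundN hc.
(* [f] and [g] are the coefficients of [W P(e(x)/q)] and [W P(q e(x))], and [b] those of [h]. The
   recurrence at [- m] is the identity [fg], which lets both translates of [h] be matched with one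
   sequence [b]. *)
pose f m := \sum_(i < size p) p`_i * q^-1 ^ (l + Posz i) * c (- (m - (l + Posz i))).
pose g m := \sum_(i < size p) p`_i * q ^ (l + Posz i) * c (- (m - (l + Posz i))).
pose b m := q ^ m * f m.
have hf : gbound f rho by exact: gbound_coef r0 (ltW r1) hc.
have hg : gbound g rho by exact: gbound_coef r0 (ltW r1) hc.
have shiftE (m : int) (i : nat) : - m + l + Posz i = - (m - (l + Posz i)) by rewrite opprB -addrA addrC.
have fg m : f m = t * q ^ (- (2 * m)) * g m.
  have := rel (- m); rewrite mulrN; under eq_bigr do rewrite shiftE -exprz_inv.
  by under [X in _ = _ * X -> _]eq_bigr do rewrite shiftE.
have bg m : b m = q ^ (- m) * (t * g m).
  have e : q ^ m * q ^ (- (2 * m)) = q ^ (- m).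
    by rewrite -expfzDr// (_ : 2 * m = m + m) ?opprD ?addrA ?subrr ?sub0r// mulr2n mulrDl mul1r.
  have id (V : comPzRingType) (a1 a2 a3 a4 : V) : a1 * (a2 * a3 * a4) = a1 * a3 * (a2 * a4) by ring.
  by rewrite /b fg -e; exact: id.
have hb : gbound b (nrm q * rho) by exact: (gbound_twist r0 q0 _ bg hf (gboundZ t hg)).
have qr0 : 0 < nrm q * rho by exact: mulr_gt0.
have qi0 : q^-1 != 0 by rewrite invr_eq0.
have hlow x : annulus rho x -> lser b (x - half) = lser (fun m => c (- m)) x * leval l p (q^-1 * ex x).
  move=> ax; have [a1 _] := annulus_half tau0 qE r0 ax.
  rewrite -(lser_leval _ _ r0 (ltW r1) hcN ax qi0) (lser_translate qr0 hb a1).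
  apply: eq_lser => m; rewrite -/(f m) mulrN exN exMz (ex_half qE) /b mulrA mulVf ?mul1r//.
  exact: expfz_neq0.
have hup x : annulus rho x -> lser b (x + half) = t * lser (fun m => c (- m)) x * leval l p (q * ex x).
  move=> ax; have [_ a1] := annulus_half tau0 qE r0 ax.
  rewrite -mulrA -(lser_leval _ _ r0 (ltW r1) hcN ax q0) (lser_translate qr0 hb a1) -(lserZ t r0 hg ax).
  apply: eq_lser => m; rewrite exMz (ex_half qE) bg mulrA -expfzDr// subrr.
  by rewrite expr0z mul1r.
have dW x : annulus rho x -> diff_at (lser (fun m => c (- m))) x by exact: lser_diff r0 hcN.
have dh z : annulus (nrm q * rho) z -> diff_at (lser b) z by exact: lser_diff qr0 hb.
exists (weight tau q t l p (lser b)); split.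
  exact: (weight_admissible tau0 qE t0 pn0 roots r0 r1 q_rho hlow hup dW dh (lserD1 b)).
move=> m; have := cint_lser m r0 r1 hcN; rewrite opprK => <-; apply: eq_cint => x _.
congr (_ * _); exact: (near_at_here (weight_near_real tau0 qE t0 roots r1 q_rho hlow hup x)).
Qed.

End Existence.

Section TraceSum.
Variables (R : realType) (A : algType R[i]) (Z Zi : A) (T : A -> R[i]).
Hypotheses (TL : is_lin T) (ZZi : Z * Zi = 1) (ZiZ : Zi * Z = 1).

Lemma trace_aeval m (r : {poly R[i]}) :
  T (aeval Z Zi m r) = \sum_(i < size r) r`_i * T (zpow Z Zi (m + Posz i)).
Proof.
rewrite aevalE//; elim/big_rec2: _ => [|i y1 y2 _ <-]; last exact: TL.
by have := TL (-1) 0 0; rewrite scaler0 addr0 mulN1r addNr.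
Qed.

End TraceSum.

Unset Implicit Arguments.

Theorem theorem2p2 (R : realType) (tau q t : R[i]) (l : int) (p : {poly R[i]})
    (A : algType R[i]) (u v Z Zi : A) :
  0 < complex.Im tau -> q = expC (pi%:C * 'i%C * tau) -> t != 0 ->
  p.[0] != 0 -> (0 < (size p).-1)%N ->
  is_presented u v Z Zi q l p ->
  ((forall w, admissible tau t l p w -> exists T : A -> R[i], is_lin T /\ trace_of_w Z Zi q w T) /\
   (forall w (T : A -> R[i]), admissible tau t l p w -> is_lin T -> trace_of_w Z Zi q w T ->
      twisted_trace u v Z Zi t T)) /\
  ((forall z, root p z -> `|q| < `|z| < `|q|^-1) ->
   forall T : A -> R[i], twisted_trace u v Z Zi t T ->
     (exists w, admissible tau t l p w /\ trace_of_w Z Zi q w T) /\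
     (forall w1 w2, admissible tau t l p w1 -> trace_of_w Z Zi q w1 T ->
        admissible tau t l p w2 -> trace_of_w Z Zi q w2 T -> mero_eq w1 w2)).
Proof.
move=> tau0 qE t0 p00 _ pres; have p0 : p != 0 by apply: contraNneq p00 => ->; rewrite horner0.
have q0 := nome_neq0 qE; have q1 := nrm_nome_lt1 tau0 qE.
split; first split.
- by move=> w [_ wR _ _ _]; apply: (exists_trace tau0 qE pres).
- by move=> w T; apply: (weight_trace tau0 qE t0 p0 pres).
move=> roots T hT; split; last first.
  by move=> w1 w2; apply: (trace_weight_unique tau0 qE t0 p0 pres).
have roots' z : root p z -> nrm q < nrm z < (nrm q)^-1.
  by move=> /roots; rewrite !nrmE -fmorphV !ltcR.
have [TL _] := hT; have [Tg rel] := twisted_traceP pres q0 q1 t0 TL hT.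
(* The recurrence required of the moments [T (Z^m)] is exactly [trace_relation]. *)
have [w [adw wE]] := exists_weight (c := fun m => T (zpow Z Zi m)) tau0 qE t0 p00 roots' rel.
exists w; split=> //; split=> [i i0 a|m r]; first exact: Tg.
have [[ZZi ZiZ] _ _ _ _] := pres.1; have [_ wR _ _ _] := adw.
rewrite trace_aeval// cint01E.
(* The trivial factors [1] and [e(0 x)] bring the integrand into the shape of [cint_leval]. *)
transitivity (cint 0 1 (fun x => w x%:C * leval m r (1 * ex x%:C) * ex ((0 : int)%:~R * x%:C))).
  rewrite cint_leval ?oner_neq0//; apply: eq_bigr => i _.
  by rewrite exp1rz mulr1 wE add0r.
by apply: eq_cint => x _; rewrite mul1r mul0r ex0 mulr1.
Qed.
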